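(* The operator $I_0^*:h^{-\frac{1}{2}} \left( \{u'_{k,k}\}_{k=0}^\infty \right)\to L^2(\ker \overline\partial)$ is surjective. More specifically, for any $f\in L^2(\ker \overline\partial)$, given by $f = \sum_{k=0}^\infty \langle f, Z_k\rangle_{SM} Z_k$, the function $W_f\in h^{-\frac{1}{2}} \left( \{u'_{k,k}\}_{k=0}^\infty \right)$ given by $$ W_f := \sum_{k=0}^\infty \langle f, Z_k\rangle_{SM} W_k \qquad\text{satisfies}\qquad I_0^* W_f = \left( \left( \frac{W_f}{\cos\alpha} \right)_\psi \right)_0 = f. $$ Moreover, the distribution $\left( \frac{W_f}{\cos\alpha} \right)_\psi \in h^{-\frac{1}{2}} \left( \left\{\left( \frac{u'_{k,k}}{\cos\alpha} \right)_\psi\right\}_{k=0}^\infty \right)$ (i) is fiberwise holomorphic, (ii) satisfies $\left\langle \left( \frac{W_f}{\cos\alpha} \right)_\psi, e^{im\theta}Z_k \right\rangle_{SM} = 0$ for every $k\ge 1$ and $m>0$.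
   Context: $M=\{\mathrm{x}=(x,y): x^2+y^2\le 1\}$ is the Euclidean unit disc and $SM=M\times\mathbb{S}^1$, with points $(\mathrm{x},\theta)$ and inner product $\langle u,v\rangle_{SM}=\int_{SM}u\overline v\,d\mathrm{x}\,d\theta$ (functions on $M$ are viewed as $\theta$-independent functions on $SM$). $\partial_+SM$ is the set of inward-pointing boundary directions, in fan-beam coordinates $(\beta,\alpha)\in\mathbb{S}^1\times[-\pi/2,\pi/2]$: base point $(\cos\beta,\sin\beta)$, direction angle $\theta=\beta+\pi+\alpha$, measure $d\beta\,d\alpha$. $X=\cos\theta\,\partial_x+\sin\theta\,\partial_y$. For $h$ on $\partial_+SM$, $h_\psi$ is the solution of $Xh_\psi=0$ on $SM$, $h_\psi|_{\partial_+SM}=h$. Fiberwise average: $u_0(\mathrm{x})=\frac1{2\pi}\int_0^{2\pi}u(\mathrm{x},\theta)\,d\theta$. $I_0$ is the unattenuated X-ray transform (integration along lines) restricted to functions on $M$, as an operator $H_0\to L^2(\partial_+SM)$, where $H_0\cong L^2(M)$ is the subspace of $\theta$-independent functions in $L^2(SM)$. Its adjoint is $I_0^*h=\left(\left(\frac h{\cos\alpha}\right)_\psi\right)_0$. $L^2(\ker\overline\partial)$ is the space of $f\in L^2(M)$ with $\overline\partial f=0$, $\overline\partial=\frac12(\partial_x+i\partial_y)$. For $k\ge0$ set $$Z_k(\mathrm{x})=\sqrt{\tfrac{k+1}{2\pi^2}}\,(x+iy)^k,\qquad u'_{k,k}(\beta,\alpha)=\frac1{\pi\sqrt2}e^{ik\beta}\big(e^{i(2k+1)\alpha}+(-1)^ke^{-i\alpha}\big),\qquad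 W_k=(-1)^k\frac{\sqrt{k+1}}2\,u'_{k,k}.$$ The $Z_k$, viewed in $L^2(SM)$, are an orthonormal basis of $L^2(\ker\overline\partial)$. The $u'_{k,k}$ are orthogonal in $L^2(\partial_+SM)$ with common norm, and the $\left(\frac{u'_{k,k}}{\cos\alpha}\right)_\psi$ are orthogonal in $L^2(SM)$ with common norm. For such a family $\{e_k\}_{k\ge0}$, $h^{-1/2}(\{e_k\})$ is the space of formal series $\sum_kc_ke_k$ with $\sum_k(k+1)^{-1}|c_k|^2<\infty$. Linear operations on such series ($I_0^*$, division by $\cos\alpha$, $(\cdot)_\psi$, fiberwise average, Fourier projections in $\theta$, pairings) are understood by linear, termwise extension; in particular $\left(\frac{W_f}{\cos\alpha}\right)_\psi=\sum_k\langle f,Z_k\rangle_{SM}\left(\frac{W_k}{\cos\alpha}\right)_\psi$. Fiberwise holomorphic means containing only harmonics $e^{ik\theta}$ with $k\ge0$. *)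

(* Defs.v *)
From HB Require Import structures.
From mathcomp Require Import all_boot all_order all_algebra.
From mathcomp Require Import complex.
From mathcomp Require Import all_classical all_reals all_analysis.

Set Implicit Arguments.
Unset Strict Implicit.
Unset Printing Implicit Defensive.

Import Order.TTheory GRing.Theory Num.Theory.
Import numFieldNormedType.Exports.

Local Open Scope classical_set_scope.
Local Open Scope ring_scope.
Local Open Scope complex_scope.

Local Notation normc := ComplexField.Normc.normc.

Section ComplexValued.
Context {R : realType}.

Definition expi (t : R) : R[i] := cos t +i* sin t.

Definition cintegral d (T : measurableType d) (mu : {measure set T -> \bar R})
    (D : set T) (f : T -> R[i]) : R[i] :=
  (\int[mu]_(x in D) complex.Re (f x)) +i* (\int[mu]_(x in D) complex.Im (f x)).

Definition cmeasurable_fun d (T : measurableType d) (D : set T)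
    (f : T -> R[i]) : Prop :=
  measurable_fun D (fun x => complex.Re (f x)) /\
  measurable_fun D (fun x => complex.Im (f x)).

Definition ccontinuous (V : topologicalType) (f : V -> R[i]) : Prop :=
  continuous (fun x => complex.Re (f x)) /\
  continuous (fun x => complex.Im (f x)).

Definition ccontinuous_within (V : topologicalType) (A : set V)
    (f : V -> R[i]) : Prop :=
  {within A, continuous (fun x => complex.Re (f x))} /\
  {within A, continuous (fun x => complex.Im (f x))}.

Definition cderivable (V : normedModType R) (f : V -> R[i]) (p v : V) : Prop :=
  derivable (fun q => complex.Re (f q)) p v /\
  derivable (fun q => complex.Im (f q)) p v.

Definition cderive (V : normedModType R) (v : V) (f : V -> R[i]) (p : V) :
    R[i] :=
  'D_v (fun q => complex.Re (f q)) p +i* 'D_v (fun q => complex.Im (f q)) p.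

Definition cseries_cvg (a : nat -> R[i]) (l : R[i]) : Prop :=
  (fun n => normc (\sum_(0 <= k < n) a k - l)) @ \oo --> (0 : R).

End ComplexValued.

(* A formal series sum_k c_k e_k is given by its coefficients; the family [e]
   is recorded in the type, so that a linear operator acts on a series by
   changing the family and keeping the coefficients. *)
Section FormalSeries.
Context {R : realType}.

Definition fseries (V : Type) (e : nat -> V) : Type := nat -> R[i].

Definition termwise (V V' : Type) (A : V -> V') (e : nat -> V)
    (c : fseries e) : fseries (A \o e) := c.

Definition scale_family (T : Type) (a : nat -> R[i]) (e : nat -> T -> R[i]) :
    nat -> T -> R[i] :=
  fun k x => a k * e k x.

(* sum_k c_k (a_k e_k) rewritten as sum_k (c_k a_k) e_k *)
Definition unscale (T : Type) (a : nat -> R[i]) (e : nat -> T -> R[i])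
    (c : fseries (scale_family a e)) : fseries e :=
  fun k => c k * a k.

Definition h_neg_half (V : Type) (e : nat -> V) (c : fseries e) : Prop :=
  cvgn (series (fun k => normc (c k) ^+ 2 / k.+1%:R)).

End FormalSeries.

(* Functions on the disc M and on SM are total functions on R^2 and R^2 x R of
   which only the values on [disk] and [SM] matter.  Points of S^1 are
   represented by arbitrary real angles, and integrals over S^1 are taken over
   [circle].  Functions on the inward boundary are functions of
   (beta, alpha), with alpha in [-pi/2, pi/2]. *)
Section UnitDisc.
Context {R : realType}.

Local Notation RT := (measurableTypeR R).
Local Notation C := R[i].

Definition disk : set (R * R) := [set p | p.1 ^+ 2 + p.2 ^+ 2 <= 1].
Definition open_disk : set (R * R) := [set p | p.1 ^+ 2 + p.2 ^+ 2 < 1].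
Definition circle : set R := `[0, 2 * pi].
Definition SM : set ((R * R) * R) := disk `*` circle.

Definition area := (@lebesgue_measure R \x @lebesgue_measure R)%E.
Definition volume := (area \x @lebesgue_measure R)%E.

Definition zcoord (p : R * R) : C := p.1 +i* p.2.

Definition dir (t : R) : R * R := (cos t, sin t).

Definition liftSM (f : R * R -> C) : (R * R) * R -> C := fun q => f q.1.

Definition innerSM (u v : (R * R) * R -> C) : C :=
  cintegral volume SM (fun q => u q * (v q)^*).

Definition sqnormM (f : R * R -> C) : \bar R :=
  (\int[area]_(p in disk) (normc (f p) ^+ 2)%:E)%E.

Definition L2M (f : R * R -> C) : Prop :=
  cmeasurable_fun (disk : set (RT * RT)%type) f /\ (sqnormM f < +oo)%E.

Definition d_x (f : R * R -> C) : R * R -> C := cderive ((1, 0) : R * R) f.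
Definition d_y (f : R * R -> C) : R * R -> C := cderive ((0, 1) : R * R) f.

Definition dbar (f : R * R -> C) : R * R -> C :=
  fun p => 2%:R^-1 * (d_x f p + 'i * d_y f p).

Fixpoint class_C (n : nat) (f : R * R -> C) : Prop :=
  ccontinuous f /\
  if n is m.+1 then
    [/\ forall p, cderivable f p (1, 0), forall p, cderivable f p (0, 1),
        class_C m (d_x f) & class_C m (d_y f)]
  else True.

Definition test_function (phi : R * R -> C) : Prop :=
  (forall n, class_C n phi) /\
  closure [set p | phi p != 0] `<=` open_disk.

(* dbar f = 0 in the sense of distributions on the open disc *)
Definition L2_ker_dbar (f : R * R -> C) : Prop :=
  L2M f /\
  forall phi, test_function phi ->
    cintegral area disk (fun p => f p * dbar phi p) = 0.

Definition sums_to (e : nat -> R * R -> C) (c : fseries e)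
    (g : R * R -> C) : Prop :=
  sqnormM (fun p => \sum_(0 <= k < n) c k * e k p - g p)
    @[n --> \oo] --> 0%E.

(* X u = 0 on SM, X being the derivative along the unit speed lines
   t |-> (p + t (cos theta, sin theta), theta): u is differentiable with zero
   derivative along X over interior points, and continuous along each closed
   chord up to its endpoints. *)
Definition X_null (u : (R * R) * R -> C) : Prop :=
  (forall p theta, open_disk p ->
     cderivable (fun q => u (q, theta)) p (dir theta) /\
     cderive (dir theta) (fun q => u (q, theta)) p = 0) /\
  (forall p theta, disk p ->
     ccontinuous_within [set t : R | disk (p + t *: dir theta)]
       (fun t : R => u (p + t *: dir theta, theta))).

Definition transport_solution (h : R * R -> C) (u : (R * R) * R -> C) : Prop :=
  X_null u /\
  forall beta alpha, - (pi / 2) <= alpha <= pi / 2 ->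
    u (dir beta, beta + pi + alpha) = h (beta, alpha).

(* h_psi: the solution, unique on [disk] x R *)
Definition psi (h : R * R -> C) : (R * R) * R -> C :=
  xget (fun=> 0) [set u | transport_solution h u].

(* At the tangential directions alpha = +-pi/2 the quotient is 0 by convention;
   these only affect a null set of SM. *)
Definition divcos (h : R * R -> C) : R * R -> C :=
  fun b => h b / (cos b.2)%:C.

Definition fiber_average (u : (R * R) * R -> C) : R * R -> C :=
  fun p => ((2 * pi)^-1)%:C *
    cintegral lebesgue_measure circle (fun t => u (p, t)).

(* u = sum_m e^(i m theta) (fiber_coef m u), so fiber_coef 0 is the average *)
Definition fiber_coef (m : int) (u : (R * R) * R -> C) : R * R -> C :=
  fiber_average (fun q => expi (- (m%:~R * q.2)) * u q).

(* adjoint of the X-ray transform on theta-independent functions, with respect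
   to d beta d alpha on the inward boundary *)
Definition I0adj (h : R * R -> C) : R * R -> C :=
  fiber_average (psi (divcos h)).

Definition Z (k : nat) : R * R -> C :=
  fun p => (Num.sqrt (k.+1%:R / (2 * pi ^+ 2)))%:C * zcoord p ^+ k.

Definition u' (k : nat) : R * R -> C :=
  fun b => ((pi * Num.sqrt 2)^-1)%:C * expi (k%:R * b.1) *
    (expi (k.*2.+1%:R * b.2) + (-1) ^+ k * expi (- b.2)).

Definition W_factor (k : nat) : C :=
  (-1) ^+ k * (Num.sqrt k.+1%:R / 2)%:C.

Definition W : nat -> R * R -> C := scale_family W_factor u'.

Definition Z_expansion (f : R * R -> C) : fseries Z :=
  fun k => innerSM (liftSM f) (liftSM (Z k)).

Definition W_series (f : R * R -> C) : fseries W :=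
  fun k => innerSM (liftSM f) (liftSM (Z k)).

Definition Wf (f : R * R -> C) : fseries u' := unscale (W_series f).

Definition Wf_psi (f : R * R -> C) : fseries (psi \o (divcos \o u')) :=
  termwise psi (termwise divcos (Wf f)).

Definition eZ (m : int) (k : nat) : (R * R) * R -> C :=
  fun q => expi (m%:~R * q.2) * Z k q.1.

Definition series_pairing (e : nat -> (R * R) * R -> C) (c : fseries e)
    (v : (R * R) * R -> C) (l : C) : Prop :=
  cseries_cvg (fun j => c j * innerSM (e j) v) l.

Definition fiberwise_holomorphic (e : nat -> (R * R) * R -> C)
    (c : fseries e) : Prop :=
  forall m : int, m < 0 -> sums_to (termwise (fiber_coef m) c) (fun=> 0).

End UnitDisc.

(* Main.v *)
(* Write [z = x + iy] and [E = exp(2 i theta)].  The function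
   [T = conj z E - z] is constant along lines, and [(u'_k / cos)_psi] is
   [sqrt 2 / pi] times the polynomial [v_k] given by [v_0 = 1], [v_1 = T],
   [v_(k+2) = T v_(k+1) + E v_k].  It contains only the harmonics
   [E^0, ..., E^k], which is (i); its fiberwise average is
   [sqrt 2 / pi (- z)^k], so that [I_0^* W_k = Z_k].  The coefficient of [E^l]
   in [v_k], [l >= 1], is orthogonal to all holomorphic powers, which is (ii).

   It remains to expand a weakly holomorphic square integrable [f] in the
   [Z_k].  Testing [dbar f = 0] against cutoffs of
   [(1 - |z|^2) z^a (conj z)^b] yields a recurrence between the moments of [f],
   by which all of them vanish as soon as [f] is orthogonal to every [z^k]; a
   function with vanishing moments is 0 almost everywhere.  This is applied to
   the difference of [f] and the sum of its power series, which converges by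
   Bessel's inequality. *)
Require Import Defs.
From HB Require Import structures.
From mathcomp Require Import all_boot all_order all_algebra.
From mathcomp Require Import complex ring lra.
From mathcomp Require Import all_classical all_reals all_analysis.
From mathcomp Require Import measurable_realfun lebesgue_integral_fubini.

Set Implicit Arguments.
Unset Strict Implicit.
Unset Printing Implicit Defensive.

Import Order.TTheory GRing.Theory Num.Theory.
Import numFieldNormedType.Exports.

Local Open Scope classical_set_scope.
Local Open Scope complex_scope.
Local Open Scope ring_scope.

Local Notation normc := ComplexField.Normc.normc.

(** * Complex-valued integrals *)

(** The polynomials v_j have a geometric origin. If b and b' are the entry and exit points of an
    oriented chord, as complex numbers, then T = - (b + b') and E = - b b', so v_j is the complete
    homogeneous polynomial of degree j in - b and - b'. Up to a common factor, dividing u'_k by cos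
    alpha divides (- b')^(k+1) - (- b)^(k+1) by b - b'; this quotient is a polynomial, which is why
    the solution is a polynomial in z, conj z and E.

    Two obstacles shape the rest. Test functions have compact support in the open disc, whereas f is
    only integrable up to the circle; the factor 1 - |z|^2 keeps the derivatives of the cutoffs
    bounded uniformly, so that dominated convergence removes them and leaves no boundary term.
    Moreover [psi] is a choice of solution, determined here only over interior points; identities
    are therefore proved over the open disc and carried to the closed one across a null set, in a
    form valid for arbitrary integrands. *)

Section ComplexFacts.
Context {R : realType}.
Local Notation C := R[i].
Implicit Types x y z : C.

Lemma ReD x y : complex.Re (x + y) = complex.Re x + complex.Re y.
Proof. by case: x y => [? ?] [? ?]. Qed.

Lemma ImD x y : complex.Im (x + y) = complex.Im x + complex.Im y.
Proof. by case: x y => [? ?] [? ?]. Qed.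

Lemma ReM x y : complex.Re (x * y) =
  complex.Re x * complex.Re y - complex.Im x * complex.Im y.
Proof. by case: x y => [? ?] [? ?]. Qed.

Lemma ImM x y : complex.Im (x * y) =
  complex.Re x * complex.Im y + complex.Im x * complex.Re y.
Proof. by case: x y => [? ?] [? ?]. Qed.

Lemma ReN x : complex.Re (- x) = - complex.Re x.
Proof. by case: x => [? ?]. Qed.

Lemma ImN x : complex.Im (- x) = - complex.Im x.
Proof. by case: x => [? ?]. Qed.

Lemma Re_sum (I : Type) (s : seq I) (P : pred I) (F : I -> C) :
  complex.Re (\sum_(i <- s | P i) F i) = \sum_(i <- s | P i) complex.Re (F i).
Proof. exact: (big_morph _ ReD). Qed.

Lemma Im_sum (I : Type) (s : seq I) (P : pred I) (F : I -> C) :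
  complex.Im (\sum_(i <- s | P i) F i) = \sum_(i <- s | P i) complex.Im (F i).
Proof. exact: (big_morph _ ImD). Qed.

Lemma sqr_normcE x : normc x ^+ 2 = complex.Re x ^+ 2 + complex.Im x ^+ 2.
Proof. by case: x => a b /=; rewrite sqr_sqrtr// addr_ge0 ?sqr_ge0. Qed.

Lemma normc_ge0 x : 0 <= normc x.
Proof. by case: x => a b /=. Qed.

Lemma normr_Re x : `|complex.Re x| <= normc x.
Proof.
rewrite -(ler_pXn2r (ltn0Sn 1)) ?nnegrE ?normc_ge0// sqr_normcE real_normK ?num_real//.
by rewrite lerDl sqr_ge0.
Qed.

Lemma normr_Im x : `|complex.Im x| <= normc x.
Proof.
rewrite -(ler_pXn2r (ltn0Sn 1)) ?nnegrE ?normc_ge0// sqr_normcE real_normK ?num_real//.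
by rewrite lerDr sqr_ge0.
Qed.

Lemma normcX x n : normc (x ^+ n) = normc x ^+ n.
Proof.
elim: n => [|n IHn]; last by rewrite !exprS ComplexField.Normc.normcM IHn.
by rewrite !expr0 ComplexField.Normc.normc1.
Qed.

Lemma normc_real (a : R) : normc (a%:C) = `|a|.
Proof. by rewrite /= expr0n addr0 sqrtr_sqr. Qed.

Lemma complex_eqP x y :
  complex.Re x = complex.Re y -> complex.Im x = complex.Im y -> x = y.
Proof. by case: x y => [? ?] [? ?] /= -> ->. Qed.

Lemma sqr_normc_conj x : (normc x ^+ 2)%:C = x * x^*.
Proof.
by rewrite sqr_normcE; case: x => a b; apply: complex_eqP => /=; ring.
Qed.

Lemma sqr_normcB x y : normc (x - y) ^+ 2 =
  normc x ^+ 2 - 2 * complex.Re (x * y^*) + normc y ^+ 2.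
Proof. by rewrite !sqr_normcE; case: x y => [a b] [c d] /=; ring. Qed.

Lemma sqr_normcB_le x y :
  normc (x - y) ^+ 2 <= 2 * normc x ^+ 2 + 2 * normc y ^+ 2.
Proof.
rewrite !sqr_normcE; case: x y => [a b] [c d] /=.
have := sqr_ge0 (a + c); have := sqr_ge0 (b + d); rewrite !sqrrD; lra.
Qed.

Lemma expiD (s t : R) : expi (s + t) = expi s * expi t.
Proof. by apply: complex_eqP; rewrite /= ?cosD ?sinD //; ring. Qed.

Lemma expi0 : expi (0 : R) = 1.
Proof. by rewrite /expi cos0 sin0. Qed.

Lemma expiMn (n : nat) (t : R) : expi (n%:R * t) = expi t ^+ n.
Proof.
elim: n => [|n IHn]; first by rewrite mul0r expi0.
by rewrite exprS -IHn -natr1 mulrDl mul1r addrC expiD.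
Qed.

Lemma expi_conj (t : R) : (expi t)^* = expi (- t).
Proof. by rewrite /expi cosN sinN. Qed.

Lemma expiNK (t : R) : expi t * expi (- t) = 1.
Proof. by rewrite -expiD subrr expi0. Qed.

Lemma normc_expi (t : R) : normc (expi t) = 1.
Proof. by rewrite /= cos2Dsin2 sqrtr1. Qed.

End ComplexFacts.

Section ComplexIntegral.
Context d (T : measurableType d) (R : realType).
Variable mu : {measure set T -> \bar R}.
Local Notation C := R[i].
Implicit Types (D : set T) (f g : T -> C).

Lemma cmeasurable_cst D (c : C) : cmeasurable_fun D (fun=> c).
Proof. by split; exact: measurable_cst. Qed.

Lemma cmeasurableD D f g : cmeasurable_fun D f -> cmeasurable_fun D g ->
  cmeasurable_fun D (fun x => f x + g x).
Proof.
move=> [f1 f2] [g1 g2]; split.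
- by under eq_fun do rewrite ReD; exact: measurable_funD.
- by under eq_fun do rewrite ImD; exact: measurable_funD.
Qed.

Lemma cmeasurableM D f g : cmeasurable_fun D f -> cmeasurable_fun D g ->
  cmeasurable_fun D (fun x => f x * g x).
Proof.
move=> [f1 f2] [g1 g2]; split.
- under eq_fun do rewrite ReM.
  by apply: measurable_funB; exact: measurable_funM.
- under eq_fun do rewrite ImM.
  by apply: measurable_funD; exact: measurable_funM.
Qed.

Lemma cmeasurableN D f : cmeasurable_fun D f ->
  cmeasurable_fun D (fun x => - f x).
Proof.
move=> [f1 f2]; split.
- by under eq_fun do rewrite ReN; exact: measurable_funN.
- by under eq_fun do rewrite ImN; exact: measurable_funN.
Qed.

Lemma cmeasurableB D f g : cmeasurable_fun D f -> cmeasurable_fun D g ->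
  cmeasurable_fun D (fun x => f x - g x).
Proof. by move=> mf mg; apply: cmeasurableD => //; exact: cmeasurableN. Qed.

Lemma cmeasurableS D E f : measurable E -> D `<=` E ->
  cmeasurable_fun E f -> cmeasurable_fun D f.
Proof. by move=> mE DE [f1 f2]; split; apply: measurable_funS DE _. Qed.

Lemma measurable_sqr_normc D f : cmeasurable_fun D f ->
  measurable_fun D (fun x => normc (f x) ^+ 2).
Proof.
move=> [f1 f2]; under eq_fun do rewrite sqr_normcE.
by apply: measurable_funD; exact: measurable_funX.
Qed.

Lemma measurable_normc D f : cmeasurable_fun D f ->
  measurable_fun D (fun x => normc (f x)).
Proof.
move=> mf.
(* The norm is the power 1/2 of its square, and real powers are measurable. *)
rewrite (_ : (fun x => _) =
    (@powR R ^~ 2^-1) \o (fun x => normc (f x) ^+ 2)); last first.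
  apply/funext => x /=.
  by rewrite powR12_sqrt ?sqr_ge0// sqrtr_sqr ger0_norm// normc_ge0.
by apply: measurableT_comp (measurable_sqr_normc mf); exact: measurable_powR.
Qed.

Definition cintegrable D f :=
  mu.-integrable D (EFin \o (fun x => complex.Re (f x))) /\
  mu.-integrable D (EFin \o (fun x => complex.Im (f x))).

Lemma cintegrable_measurable D f : cintegrable D f -> cmeasurable_fun D f.
Proof.
by case=> f1 f2; split; apply/measurable_EFinP; exact: (measurable_int mu).
Qed.

(** Bounds are proved for the norm, whereas [cintegrable] is componentwise; |Re f|, |Im f| <= |f| <=
    |Re f| + |Im f| relates the two. *)
Lemma cintegrableP D f : measurable D ->
  cintegrable D f <->
  cmeasurable_fun D f /\ mu.-integrable D (EFin \o (fun x => normc (f x))).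
Proof.
move=> mD; split.
  move=> [f1 f2]; have mf : cmeasurable_fun D f by exact: cintegrable_measurable.
  split=> //; apply: (@le_integrable _ _ _ mu D mD _
    (EFin \o (fun x => `|complex.Re (f x)| + `|complex.Im (f x)|))).
  - exact/measurable_EFinP/measurable_normc.
  - move=> x _; rewrite /= lee_fin ger0_norm ?normc_ge0// ger0_norm; last first.
      by rewrite addr_ge0.
    rewrite -(ler_pXn2r (ltn0Sn 1)) ?nnegrE ?normc_ge0 ?addr_ge0//.
    rewrite sqr_normcE sqrrD !real_normK ?num_real//.
    by rewrite addrAC lerDl mulrn_wge0// mulr_ge0.
  - rewrite (_ : EFin \o _ = (EFin \o (Num.norm \o fun x => complex.Re (f x))) \+
      (EFin \o (Num.norm \o fun x => complex.Im (f x))))%E; last first.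
      by apply/funext => x /=; rewrite EFinD.
    by apply: integrableD => //; exact: integrable_norm.
move=> [[f1 f2] fi]; split.
- apply: le_integrable fi => //; first exact/measurable_EFinP.
  by move=> x _; rewrite /= lee_fin (ger0_norm (normc_ge0 _)) normr_Re.
- apply: le_integrable fi => //; first exact/measurable_EFinP.
  by move=> x _; rewrite /= lee_fin (ger0_norm (normc_ge0 _)) normr_Im.
Qed.

Lemma eq_cintegrable D f g : measurable D -> (forall x, D x -> f x = g x) ->
  cintegrable D f -> cintegrable D g.
Proof.
move=> mD fg [f1 f2]; split.
- by apply: eq_integrable f1 => // x /[1!inE] /fg /= ->.
- by apply: eq_integrable f2 => // x /[1!inE] /fg /= ->.
Qed.

Lemma eq_cintegral D f g : (forall x, D x -> f x = g x) ->
  cintegral mu D f = cintegral mu D g.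
Proof.
by move=> fg; congr (_ +i* _); apply: eq_Rintegral => x /[1!inE] /fg ->.
Qed.

Lemma cintegrableD D f g : measurable D -> cintegrable D f ->
  cintegrable D g -> cintegrable D (fun x => f x + g x).
Proof.
move=> mD [f1 f2] [g1 g2]; split.
- rewrite (_ : _ \o _ = (EFin \o fun x => complex.Re (f x)) \+
    (EFin \o fun x => complex.Re (g x)))%E; first exact: integrableD.
  by apply/funext => x /=; rewrite ReD EFinD.
- rewrite (_ : _ \o _ = (EFin \o fun x => complex.Im (f x)) \+
    (EFin \o fun x => complex.Im (g x)))%E; first exact: integrableD.
  by apply/funext => x /=; rewrite ImD EFinD.
Qed.

Lemma cintegralD D f g : measurable D -> cintegrable D f ->
  cintegrable D g -> cintegral mu D (fun x => f x + g x) =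
  cintegral mu D f + cintegral mu D g.
Proof.
move=> mD [f1 f2] [g1 g2]; apply: complex_eqP => /=.
- by under eq_Rintegral do rewrite ReD; rewrite RintegralD.
- by under eq_Rintegral do rewrite ImD; rewrite RintegralD.
Qed.

Let integrableZ (h : T -> R) D (r : R) : measurable D ->
  mu.-integrable D (EFin \o h) -> mu.-integrable D (EFin \o (fun x => r * h x)).
Proof.
move=> mD hi; rewrite (_ : _ \o _ = fun x => (r%:E * (EFin \o h) x)%E).
  exact: integrableZl.
by apply/funext => x /=; rewrite EFinM.
Qed.

Lemma cintegrableZ D f (c : C) : measurable D -> cintegrable D f ->
  cintegrable D (fun x => c * f x).
Proof.
move=> mD fi; apply/(cintegrableP _ mD); split.
  by apply: cmeasurableM; [exact: cmeasurable_cst|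
    exact: cintegrable_measurable].
under [X in _ \o X]eq_fun do rewrite ComplexField.Normc.normcM.
by apply: integrableZ => //; move/(cintegrableP _ mD) : fi => [].
Qed.

Lemma cintegralZ D f (c : C) : measurable D -> cintegrable D f ->
  cintegral mu D (fun x => c * f x) = c * cintegral mu D f.
Proof.
case: c => a b mD [f1 f2]; apply: complex_eqP => /=.
- under eq_Rintegral do rewrite ReM /=.
  by rewrite RintegralB ?RintegralZl//; exact: integrableZ.
- under eq_Rintegral do rewrite ImM /=.
  by rewrite RintegralD ?RintegralZl//; exact: integrableZ.
Qed.

Lemma cintegral0 D : cintegral mu D (fun=> 0) = 0.
Proof. by apply: complex_eqP; rewrite /= /Rintegral integral0. Qed.

Lemma cintegrable0 D : measurable D -> cintegrable D (fun=> 0).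
Proof. by move=> mD; split; exact: integrable0. Qed.

Lemma cintegrable_sum D (I : Type) (s : seq I) (F : I -> T -> C) :
  measurable D -> (forall i, cintegrable D (F i)) ->
  cintegrable D (fun x => \sum_(i <- s) F i x).
Proof.
move=> mD iF; elim: s => [|i s IHs].
  by under eq_fun do rewrite big_nil; exact: cintegrable0.
by under eq_fun do rewrite big_cons; exact: cintegrableD.
Qed.

Lemma cintegral_sum D (I : Type) (s : seq I) (F : I -> T -> C) :
  measurable D -> (forall i, cintegrable D (F i)) ->
  cintegral mu D (fun x => \sum_(i <- s) F i x) =
  \sum_(i <- s) cintegral mu D (F i).
Proof.
move=> mD iF; elim: s => [|i s IHs].
  by under eq_cintegral do rewrite big_nil; rewrite big_nil cintegral0.
rewrite big_cons -IHs -cintegralD//; last exact: cintegrable_sum.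
by under eq_cintegral do rewrite big_cons.
Qed.

Lemma cintegrableN D f : measurable D -> cintegrable D f ->
  cintegrable D (fun x => - f x).
Proof.
by move=> mD fi; under eq_fun do rewrite -mulN1r; exact: cintegrableZ.
Qed.

Lemma cintegrableB D f g : measurable D -> cintegrable D f ->
  cintegrable D g -> cintegrable D (fun x => f x - g x).
Proof. by move=> mD fi gi; apply: cintegrableD => //; exact: cintegrableN. Qed.

Lemma cintegralB D f g : measurable D -> cintegrable D f ->
  cintegrable D g -> cintegral mu D (fun x => f x - g x) =
  cintegral mu D f - cintegral mu D g.
Proof.
move=> mD fi gi; rewrite cintegralD//; last exact: cintegrableN.
congr (_ + _); rewrite -mulN1r -cintegralZ//.
by under [in RHS]eq_cintegral do rewrite mulN1r.
Qed.

Lemma cintegral_conj D f : measurable D -> cintegrable D f ->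
  cintegral mu D (fun x => (f x)^*) = (cintegral mu D f)^*.
Proof.
move=> mD [f1 f2]; apply: complex_eqP => /=.
- by apply: eq_Rintegral => x _; case: (f x).
- rewrite -mulN1r -RintegralZl//; apply: eq_Rintegral => x _.
  by case: (f x) => a b /=; rewrite mulN1r.
Qed.

Lemma cintegrable_bounded D f (M : R) : measurable D -> (mu D < +oo)%E ->
  cmeasurable_fun D f -> (forall x, D x -> normc (f x) <= M) ->
  cintegrable D f.
Proof.
move=> mD muD mf fM; apply/(cintegrableP _ mD); split=> //.
apply: measurable_bounded_integrable => //; first exact: measurable_normc.
exists M; split; first exact: num_real.
move=> r Mr x Dx; rewrite /= ger0_norm ?normc_ge0//.
exact: le_trans (fM _ Dx) (ltW Mr).
Qed.

Lemma cintegrableM_bounded D f g (M : R) : measurable D -> cintegrable D f ->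
  cmeasurable_fun D g -> (forall x, D x -> normc (g x) <= M) ->
  cintegrable D (fun x => f x * g x).
Proof.
move=> mD /(cintegrableP _ mD)[mf fi] mg gM; apply/(cintegrableP _ mD).
split; first exact: cmeasurableM.
apply: (@le_integrable _ _ _ mu D mD _
  (EFin \o (fun x => M * normc (f x)))); last exact: integrableZ.
- exact/measurable_EFinP/measurable_normc/cmeasurableM.
- move=> x Dx; rewrite /= lee_fin ger0_norm ?normc_ge0//.
  rewrite ComplexField.Normc.normcM mulrC.
  apply: le_trans (ler_norm _); apply: ler_wpM2r (gM _ Dx).
  exact: normc_ge0.
Qed.

(** The real and the imaginary part are bounded separately, hence the crude factor 2; the estimate
    only serves to make a quantity arbitrarily small. *)
Lemma cintegral_le D f (g : T -> R) : measurable D -> cintegrable D f ->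
  mu.-integrable D (EFin \o g) -> (forall x, D x -> normc (f x) <= g x) ->
  normc (cintegral mu D f) <= 2 * \int[mu]_(x in D) g x.
Proof.
move=> mD [f1 f2] gi fg.
have h (k : T -> R) : mu.-integrable D (EFin \o k) ->
    (forall x, D x -> `|k x| <= normc (f x)) ->
    `|\int[mu]_(x in D) k x| <= \int[mu]_(x in D) g x.
  move=> ki kf; apply: le_trans (le_normr_Rintegral mD ki) _.
  apply: le_Rintegral => //; first exact: integrable_norm.
  by move=> x Dx; apply: le_trans (kf x Dx) (fg x Dx).
rewrite [cintegral _ _ _]complexE mulr2n mulrDl mul1r.
apply: le_trans (le_normcD _ _) _; rewrite lerD//.
  by rewrite normc_real; apply: h => // x _; exact: normr_Re.
rewrite ComplexField.Normc.normcM normc_real /= expr0n expr1n add0r sqrtr1 mul1r.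
by apply: h => // x _; exact: normr_Im.
Qed.

End ComplexIntegral.
Arguments eq_cintegral {d T R mu D f} g _.
Arguments cintegrableP {d T R mu D} f _.

(** * Directional derivatives *)

Section DerivativeRules.
Context {R : realType} {V : normedModType R}.
Implicit Types (f g : V -> R) (x v : V).

Lemma is_derive_add f g x v df dg :
  is_derive x v f df -> is_derive x v g dg ->
  is_derive x v (fun y => f y + g y) (df + dg).
Proof. exact: is_deriveD. Qed.

Lemma is_derive_mul f g x v df dg :
  is_derive x v f df -> is_derive x v g dg ->
  is_derive x v (fun y => f y * g y) (df * g x + f x * dg).
Proof.
move=> fx gx; rewrite addrC [df * _]mulrC.
exact: (is_deriveM fx gx).
Qed.

Lemma is_derive_scale f x v (a df : R) :
  is_derive x v f df -> is_derive x v (fun y => a * f y) (a * df).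
Proof. exact: is_deriveZ. Qed.

Lemma is_derive_const x v (a : R) : is_derive x v (fun=> a) 0.
Proof. exact: is_derive_cst. Qed.

(** The difference quotients of [f] at [x] along [v] are those of its restriction to a line, at 0.
    This brings the one-variable chain rule, integration along slices and the mean value theorem
    along chords to directional derivatives. *)
Lemma is_derive_line f x v df :
  is_derive x v f df <-> is_derive (0 : R) 1 (fun h => f (h *: v + x)) df.
Proof.
have E : (fun h : R => h^-1 *: ((f \o shift x) (h *: v) - f x)) =
  (fun h : R => h^-1 *: (((fun h => f (h *: v + x)) \o shift 0) (h *: 1) -
     f (0 *: v + x))).
  by apply/funext => h /=; rewrite addr0 scale0r add0r /GRing.scale /= mulr1.
by split=> -[d1 d2]; split; rewrite /derivable /derive ?E// -?E.
Qed.

Lemma is_derive_compr f (h : R -> R) x v (a b : R) :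
  is_derive (f x) 1 h a -> is_derive x v f b ->
  is_derive x v (fun y => h (f y)) (a * b).
Proof.
move=> ha /is_derive_line fb; apply/is_derive_line.
by apply: is_derive1_comp; rewrite ?scale0r ?add0r.
Qed.

End DerivativeRules.

(** * Calculus on the line and on the circle *)

Section OneVariable.
Context {R : realType}.
Local Notation mu := (@lebesgue_measure R).

Lemma is_derive_continuous (F f : R -> R) :
  (forall x : R, is_derive x 1 F (f x)) -> continuous F.
Proof.
by move=> dF x; apply/differentiable_continuous/derivable1_diffP.
Qed.

Lemma integral_is_derive (f F : R -> R) (a b : R) : a <= b -> continuous f ->
  (forall x : R, is_derive x 1 F (f x)) ->
  (\int[mu]_(x in `[a, b]) (f x)%:E = (F b - F a)%:E)%E.
Proof.
rewrite le_eqVlt => /predU1P[<-|ab] cf dF.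
  by rewrite set_itv1 integral_set1 subrr.
have cF := is_derive_continuous dF.
rewrite (continuous_FTC2 (F := F))//.
- exact: continuous_subspaceT.
- split.
  + by move=> x _; have [] := dF x.
  + exact/cvg_at_right_filter/cF.
  + exact/cvg_at_left_filter/cF.
- by move=> x _; rewrite derive1E; have /@derive_val := dF x.
Qed.

Lemma Rintegral_is_derive (f F : R -> R) (a b : R) : a <= b -> continuous f ->
  (forall x : R, is_derive x 1 F (f x)) ->
  \int[mu]_(x in `[a, b]) f x = F b - F a.
Proof. by move=> ab cf dF; rewrite /Rintegral (integral_is_derive ab cf dF). Qed.

Lemma sin_natr_2pi (n : nat) : sin (n%:R * (2 * pi)) = 0 :> R.
Proof.
rewrite [X in sin X](_ : _ = 0 + pi *+ 2 *+ n); last first.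
  by rewrite add0r -[RHS]mulr_natl -[pi *+ 2]mulr_natl.
by rewrite (periodicn (@sinD2pi R)) sin0.
Qed.

Lemma cos_natr_2pi (n : nat) : cos (n%:R * (2 * pi)) = 1 :> R.
Proof.
rewrite [X in cos X](_ : _ = 0 + pi *+ 2 *+ n); last first.
  by rewrite add0r -[RHS]mulr_natl -[pi *+ 2]mulr_natl.
by rewrite (periodicn (@cosD2pi R)) cos0.
Qed.

Lemma measurable_circle : measurable (@circle R : set (measurableTypeR R)).
Proof. exact: measurable_itv. Qed.

Lemma lebesgue_circle : mu (@circle R) = (2 * pi)%:E.
Proof.
rewrite lebesgue_measure_itv/= lte_fin mulr_gt0 ?pi_gt0//.
by rewrite oppr0 adde0.
Qed.

Lemma is_derive_sinZ (a x : R) :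
  is_derive x 1 (fun t => sin (a * t)) (a * cos (a * x)).
Proof.
rewrite -[a in a * cos _]mulr1 mulrC.
exact: is_derive_compr (is_derive_scale a (is_derive_id x 1)).
Qed.

Lemma is_derive_cosZ (a x : R) :
  is_derive x 1 (fun t => cos (a * t)) (- (a * sin (a * x))).
Proof.
rewrite -[a in a * sin _]mulr1 mulrC -mulNr.
exact: is_derive_compr (is_derive_scale a (is_derive_id x 1)).
Qed.

Lemma cintegral_expi (m : int) :
  cintegral mu (@circle R) (fun t => expi (m%:~R * t)) =
  if m == 0 then (2 * pi)%:C else 0.
Proof.
have ppi : (0 : R) <= 2 * pi by rewrite mulr_ge0 ?pi_ge0.
case: eqP => [->|/eqP m0].
  rewrite (eq_cintegral (fun=> 1)); last first.
    by move=> t _; rewrite mul0r expi0.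
  have cstE (r : R) : \int[mu]_(_ in @circle R) r = r * (2 * pi).
    rewrite Rintegral_cst; last exact: measurable_circle.
    by rewrite /= lebesgue_circle.
  by rewrite /cintegral /= !cstE mul1r mul0r.
have a0 : m%:~R != 0 :> R by rewrite intr_eq0.
have [sa ca] : sin (m%:~R * (2 * pi)) = 0 :> R /\ cos (m%:~R * (2 * pi)) = 1 :> R.
  case: (intP m) => [|n|n].
  - by rewrite mul0r sin0 cos0.
  - by rewrite sin_natr_2pi cos_natr_2pi.
  - by rewrite mulrNz mulNr sinN cosN sin_natr_2pi cos_natr_2pi oppr0.
have csin : continuous (fun t : R => sin (m%:~R * t)).
  exact: is_derive_continuous (is_derive_sinZ _).
have ccos : continuous (fun t : R => cos (m%:~R * t)).
  exact: is_derive_continuous (is_derive_cosZ _).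
have dS (x : R) : is_derive x 1 (fun t => m%:~R^-1 * sin (m%:~R * t))
    (cos (m%:~R * x)).
  by have := is_derive_scale m%:~R^-1 (is_derive_sinZ m%:~R x);
    rewrite mulrA mulVf// mul1r.
have dC (x : R) : is_derive x 1 (fun t => - m%:~R^-1 * cos (m%:~R * t))
    (sin (m%:~R * x)).
  by have := is_derive_scale (- m%:~R^-1) (is_derive_cosZ m%:~R x);
    rewrite mulrNN mulrA mulVf// mul1r.
apply: complex_eqP => /=.
- rewrite (Rintegral_is_derive ppi ccos dS).
  by rewrite sa !mulr0 sin0 mulr0 subrr.
- rewrite (Rintegral_is_derive ppi csin dC).
  by rewrite ca mulr0 cos0 subrr.
Qed.

(** The substitution x = sin t turns the integral into that of 2 cos^2 t, with primitive t + sin t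
    cos t. The integrand is the length of a vertical slice of the disc. *)
Lemma integral_circle_arc :
  (\int[mu]_(x in `[(-1)%R, 1%R]) (2 * Num.sqrt (1 - x ^+ 2))%:E = (pi : R)%:E)%E.
Proof.
have pp : - (pi / 2) < pi / 2 :> R.
  by rewrite gtrN// divr_gt0// pi_gt0.
have := @integration_by_substitution_increasing R (@sin R)
  (fun x => 2 * Num.sqrt (1 - x ^+ 2)) (- (pi / 2)) (pi / 2) (ltW pp).
rewrite sinN sin_pihalf => subst; rewrite {}subst.
- transitivity (\int[mu]_(x in `[(- (pi / 2))%R, (pi / 2)%R])
      (2 * cos x ^+ 2)%:E)%E.
    apply: eq_integral => x; rewrite inE/= => xpi; congr (_%:E).
    rewrite mulrfctE /=.
    rewrite derive1E (@derive_val _ _ _ _ _ _ _ (is_derive_sin x)).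
    by rewrite -cos2sin2 sqrtr_sqr ger0_norm ?cos_ge0_pihalf// -mulrA -expr2.
  have dF (x : R) : is_derive x 1 (fun x => x + sin x * cos x) (2 * cos x ^+ 2).
    apply: is_derive_eq (is_derive_add (is_derive_id x 1)
      (is_derive_mul (is_derive_sin x) (is_derive_cos x))) _.
    by have := cos2Dsin2 x; rewrite !expr2 mulrN; lra.
  have cF : continuous (fun x : R => 2 * cos x ^+ 2).
    move=> x; apply: cvgM; first exact: cvg_cst.
    by apply: cvgM; exact: continuous_cos.
  rewrite (integral_is_derive (ltW pp) cF dF).
  by rewrite sinN cosN cos_pihalf !mulr0 !addr0 opprK -splitr.
- by move=> x y xp yp; rewrite ltr_sin.
- move=> x _; rewrite (_ : (derive1 sin) = cos); first exact: continuous_cos.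
  by apply/funext => y; rewrite derive1E; apply: derive_val.
- rewrite (_ : (derive1 sin) = cos); last first.
    by apply/funext => y; rewrite derive1E; apply: derive_val.
  by apply/cvg_ex; eexists; apply: cvg_at_right_filter; exact: continuous_cos.
- rewrite (_ : (derive1 sin) = cos); last first.
    by apply/funext => y; rewrite derive1E; apply: derive_val.
  by apply/cvg_ex; eexists; apply: cvg_at_left_filter; exact: continuous_cos.
- split.
  + by move=> x _; exact: derivable_sin.
  + exact/cvg_at_right_filter/continuous_sin.
  + exact/cvg_at_left_filter/continuous_sin.
- apply: continuous_subspaceT => x; apply: cvgM; first exact: cvg_cst.
  apply: continuous_comp; last exact: sqrt_continuous.
  by apply: cvgB; [exact: cvg_cst|exact: exprn_continuous].
Qed.

End OneVariable.

(** * The unit disc *)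

Section NullSets.
Context d (T : measurableType d) (R : realType).
Variable mu : {measure set T -> \bar R}.
Local Open Scope ereal_scope.
Import HBNNSimple.

Lemma ge0_integral_setC_null (N : set T) (g : T -> \bar R) :
  measurable N -> mu N = 0 -> (forall x, 0 <= g x) ->
  \int[mu]_x g x = \int[mu]_x (g \_ (~` N)) x.
Proof.
move=> mN muN g0.
have gN0 x : 0 <= (g \_ (~` N)) x by rewrite patchE; case: ifP.
have gN x : (g \_ (~` N)) x <= g x by rewrite patchE; case: ifP.
rewrite !ge0_integralTE//; apply/eqP; rewrite eq_le; apply/andP; split.
- apply: ge_ereal_sup => _ [h /= hg <-].
  have mC : measurable (~` N) by exact: measurableC.
  pose h' : {nnsfun T >-> R} := proj_nnsfun h mC.
  have h'E x : h' x = (h x * (x \in ~` N)%:R)%R by rewrite /h' /= mindicE.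
  have -> : sintegral mu h = sintegral mu h'.
    rewrite -!integralT_nnsfun (ge0_negligible_integral mN)//; last 2 first.
      exact/measurable_EFinP.
      by move=> x _; rewrite lee_fin; exact: fun_ge0.
    rewrite [RHS](ge0_negligible_integral mN)//; last 2 first.
      exact/measurable_EFinP.
      by move=> x _; rewrite lee_fin; exact: fun_ge0.
    apply: eq_integral => x; rewrite inE => -[_ Nx].
    by rewrite h'E mem_set// mulr1.
  apply: ereal_sup_ubound; exists h' => //; rewrite /mkset => x.
  rewrite patchE h'E; case: (x \in ~` N); first by rewrite mulr1.
  by rewrite mulr0.
- apply: ge_ereal_sup => _ [h /= hg <-].
  by apply: ereal_sup_ubound; exists h => //= x; exact: le_trans (gN x).
Qed.

(* No measurability of [f] is needed: simple functions below [f] may be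
   multiplied by the indicator of the complement of [N]. *)
Lemma integral_setD_null (D N : set T) (f : T -> \bar R) :
  measurable N -> mu N = 0 ->
  \int[mu]_(x in D) f x = \int[mu]_(x in D `\` N) f x.
Proof.
move=> mN muN; rewrite integral_mkcond integralE.
rewrite [RHS]integral_mkcond [RHS]integralE.
have E (g : T -> \bar R) : (g \_ D) \_ (~` N) = g \_ (D `\` N).
  by rewrite setDE setIC patch_setI.
rewrite (ge0_integral_setC_null mN muN)//.
rewrite [X in _ - X](ge0_integral_setC_null mN muN)//.
by rewrite -funepos_restrict -funeneg_restrict E.
Qed.

End NullSets.

Section Disk.
Context {R : realType}.
Local Notation RT := (measurableTypeR R).
Local Notation R2 := (RT * RT)%type.
Local Notation mu := (@lebesgue_measure R).
Local Notation area := (@area R).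
Local Notation C := R[i].
Local Notation disk := (@disk R : set R2).
Local Notation open_disk := (@open_disk R : set R2).

Let rho (p : R2) : R := p.1 ^+ 2 + p.2 ^+ 2.

Let measurable_rho D : measurable_fun D rho.
Proof.
apply: (measurable_funS measurableT (@subsetT _ D)).
by apply: measurable_funD; apply: measurable_funX;
  [exact: measurable_fst|exact: measurable_snd].
Qed.

Lemma measurable_disk : measurable disk.
Proof.
have := @measurable_rho setT measurableT _ (measurable_itv `]-oo, 1%R]).
rewrite setTI; congr measurable; apply/seteqP; split => p /=; rewrite in_itv//.
Qed.

Lemma measurable_open_disk : measurable open_disk.
Proof.
have := @measurable_rho setT measurableT _ (measurable_itv `]-oo, 1%R[).
rewrite setTI; congr measurable; apply/seteqP; split => p /=; rewrite in_itv//.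
Qed.

Lemma open_disk_sub : open_disk `<=` disk.
Proof. by move=> p /ltW. Qed.

Lemma disk_norm (p : R2) : disk p <-> normc (zcoord p) <= 1.
Proof.
rewrite -(ler_pXn2r (ltn0Sn 1)) ?nnegrE ?normc_ge0// sqr_normcE expr1n.
by split.
Qed.

Lemma open_disk_norm (p : R2) : open_disk p <-> normc (zcoord p) < 1.
Proof.
rewrite -(ltr_pXn2r (ltn0Sn 1)) ?nnegrE ?normc_ge0// sqr_normcE expr1n.
by split.
Qed.

Lemma lebesgue_xsection_disk (x : RT) :
  mu (xsection disk x) = (2 * Num.sqrt (1 - x ^+ 2))%:E.
Proof.
set s := Num.sqrt _; have s0 : 0 <= s by exact: sqrtr_ge0.
have [x1|x1] := lerP (x ^+ 2) 1.
  have -> : xsection disk x = `[- s, s]%classic.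
    apply/seteqP; split => y; rewrite /xsection /= inE/= in_itv/=;
      rewrite -ler_norml -(ler_pXn2r (ltn0Sn 1)) ?nnegrE// sqr_sqrtr ?subr_ge0//;
      by rewrite real_normK ?num_real// lerBrDl.
  rewrite lebesgue_measure_itv/= lte_fin.
  case: ltrP => sN; last by rewrite (_ : s = 0) ?mulr0//; lra.
  by rewrite -EFinB opprK mulr_natl mulr2n.
(* [Num.sqrt] is 0 on negative numbers, which agrees with the empty section. *)
have -> : s = 0 by rewrite /s ler0_sqrtr// subr_le0 ltW.
rewrite mulr0 (_ : xsection _ _ = set0) ?measure0//.
rewrite -subset0 => y; rewrite /xsection/= inE /Defs.disk /= => xy.
have := sqr_ge0 y; lra.
Qed.

Lemma area_disk : area disk = (pi : R)%:E.
Proof.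
rewrite /area /product_measure1.
under eq_integral do rewrite /= lebesgue_xsection_disk.
rewrite -integral_circle_arc [RHS]integral_mkcond; apply: eq_integral => x _.
rewrite patchE; case: ifPn => //; rewrite notin_setE/= in_itv/= => /negP.
rewrite -ler_norml -ltNge => x1; rewrite ler0_sqrtr ?mulr0//.
rewrite subr_le0 -[x ^+ 2]real_normK ?num_real//.
by rewrite exprn_ege1// ltW.
Qed.

Lemma area_disk_lty : (area disk < +oo)%E.
Proof. by rewrite area_disk ltry. Qed.

Lemma measurable_unit_circle : measurable (disk `\` open_disk).
Proof. exact: measurableD measurable_disk measurable_open_disk. Qed.

(** Each vertical section of the circle has at most two points. *)
Lemma area_unit_circle : area (disk `\` open_disk) = 0%E.
Proof.
rewrite /area /product_measure1 integral0_eq// => x _ /=.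
set s := Num.sqrt (1 - x ^+ 2).
apply: (@subset_measure0 _ _ _ mu _ [set s; - s]).
- by apply: measurable_xsection; exact: measurable_unit_circle.
- by apply: measurableU; exact: measurable_set1.
- move=> y; rewrite /xsection/= inE/= => -[h1 /negP]; rewrite -leNgt => h2.
  have E : y ^+ 2 = 1 - x ^+ 2.
    by apply/eqP; rewrite eq_le; apply/andP; split;
      [move: h1|move: h2]; rewrite /Defs.disk/=; lra.
  have : `|y| = s by rewrite -sqrtr_sqr E.
  by case: ler0P => _ <-; [right; rewrite opprK|left].
- by apply: countable_lebesgue_measure0; apply: finite_set_countable.
Qed.

(** The integrand is arbitrary because it may involve [psi], whose values over the boundary circle
    are not controlled. *)
Lemma integral_disk (f : R2 -> \bar R) :
  (\int[area]_(p in disk) f p = \int[area]_(p in open_disk) f p)%E.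
Proof.
rewrite (integral_setD_null _ _ measurable_unit_circle area_unit_circle).
by rewrite setDD setIidr//; exact: open_disk_sub.
Qed.

Lemma eq_sqnormM (f g : R2 -> C) :
  (forall p, open_disk p -> f p = g p) -> sqnormM f = sqnormM g.
Proof.
move=> fg; rewrite /sqnormM !integral_disk; apply: eq_integral => p.
by rewrite inE => pd; rewrite fg.
Qed.

End Disk.

(** * Measurability of continuous functions of two variables *)

Section ContinuousMeasurable.
Context {R : realType}.
Local Notation RT := (measurableTypeR R).
Local Notation R2 := (RT * RT)%type.

Let box (t : rat * rat * rat) : set R2 :=
  [set p : R2 | `|ratr t.1.1 - p.1| < ratr t.2 /\ `|ratr t.1.2 - p.2| < ratr t.2].

Let measurable_box t : measurable (box t).
Proof.
rewrite (_ : box t = ball (ratr t.1.1 : R) (ratr t.2 : R) `*`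
  ball (ratr t.1.2 : R) (ratr t.2 : R)).
  by apply: measurableX; exact: measurable_ball.
by apply/seteqP; split.
Qed.

(** Continuity refers to the product topology and integration to the product sigma-algebra. An open
    set is the union of the countably many rational boxes that it contains. *)
Lemma open_measurable_prod (U : set (R * R)) : open U -> measurable (U : set R2).
Proof.
move=> oU.
have -> : (U : set R2) =
    \bigcup_(t : rat * rat * rat) (if `[< box t `<=` U >] then box t else set0).
  apply/seteqP; split=> [p Up|p [t _]]; last by case: asboolP => // + bp; apply.
  move: oU; rewrite openE => /(_ p Up) /nbhs_ballP[e /= e0 eU].
  (* The centre (a, b) lies within q of p, so a point within q of the centre is within 2 q < e of
     p. *)
  have [q] : exists q : rat, ratr q \in `]0, (e / 2)[.
    by apply: rat_in_itvoo; rewrite divr_gt0.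
  rewrite in_itv/= => /andP[q0 qe].
  have [a] : exists a : rat, ratr a \in `]p.1 - ratr q, (p.1 + ratr q)[.
    by apply: rat_in_itvoo; lra.
  rewrite in_itv/= => /andP[a1 a2].
  have [b] : exists b : rat, ratr b \in `]p.2 - ratr q, (p.2 + ratr q)[.
    by apply: rat_in_itvoo; lra.
  rewrite in_itv/= => /andP[b1 b2].
  exists (a, b, q) => //.
  have bp : box (a, b, q) p by split; rewrite /= ltr_norml; apply/andP; split; lra.
  case: asboolP => // -[] r [/=]; rewrite !ltr_norml.
  move=> /andP[r1 r2] /andP[r3 r4]; apply: eU.
  by split; rewrite /ball /= ltr_norml; apply/andP; split; lra.
apply: countable_bigcupT_measurable => // t.
by case: asboolP => // _; exact: measurable_box.
Qed.

Lemma continuous_measurable_prod (f : R * R -> R) :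
  continuous f -> measurable_fun (setT : set R2) f.
Proof.
move=> /continuousP cf; apply: (measurability _ (RGenOpens.measurableE R)).
move=> _ [_ [a [b ->] <-]]; rewrite setTI.
by apply: open_measurable_prod; apply: cf; exact: interval_open.
Qed.

End ContinuousMeasurable.

(** * Smooth functions and the dbar operator *)

Section SmoothFunctions.
Context {R : realType}.
Local Notation C := R[i].
Implicit Types (f g : R * R -> R) (p : R * R).

Let ex : R * R := (1, 0).
Let ey : R * R := (0, 1).

(** Real counterpart of [class_C] with the partial derivatives as witnesses: exhibiting them makes
    closure under sums and products a plain induction. *)
Fixpoint real_class_C (n : nat) f : Prop :=
  continuous f /\
  if n is m.+1 then
    exists fx fy, [/\ forall p, is_derive p ex f (fx p),
      forall p, is_derive p ey f (fy p), real_class_C m fx & real_class_C m fy]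
  else True.

Lemma real_class_C_continuous n f : real_class_C n f -> continuous f.
Proof. by case: n => [|n] []. Qed.

Lemma real_class_CW n f : real_class_C n.+1 f -> real_class_C n f.
Proof.
elim: n f => [|n IHn] f [cf]; first by [].
by move=> [fx [fy [h1 h2 h3 h4]]]; split=> //; exists fx, fy; split=> //; exact: IHn.
Qed.

Lemma real_class_C_cst n (a : R) : real_class_C n (fun=> a).
Proof.
elim: n a => [|n IHn] a; split=> //; try by move=> p; exact: cvg_cst.
exists (fun=> 0), (fun=> 0); split=> //; first by move=> p; exact: is_derive_const.
by move=> p; exact: is_derive_const.
Qed.

Lemma real_class_C_add n f g : real_class_C n f -> real_class_C n g ->
  real_class_C n (fun p => f p + g p).
Proof.
elim: n f g => [|n IHn] f g [cf hf] [cg hg]; split=> //;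
  try by move=> p; apply: cvgD; [exact: cf|exact: cg].
have [fx [fy [f1 f2 f3 f4]]] := hf; have [gx [gy [g1 g2 g3 g4]]] := hg.
exists (fun p => fx p + gx p), (fun p => fy p + gy p).
split; [move=> p; exact: is_derive_add|move=> p; exact: is_derive_add| |].
- exact: IHn.
- exact: IHn.
Qed.

Lemma real_class_C_mul n f g : real_class_C n f -> real_class_C n g ->
  real_class_C n (fun p => f p * g p).
Proof.
elim: n f g => [|n IHn] f g hf hg; have cf := real_class_C_continuous hf;
  have cg := real_class_C_continuous hg; split=> //;
  try by move=> p; apply: cvgM; [exact: cf|exact: cg].
have := hf => -[_ [fx [fy [f1 f2 f3 f4]]]].
have := hg => -[_ [gx [gy [g1 g2 g3 g4]]]].
exists (fun p => fx p * g p + f p * gx p), (fun p => fy p * g p + f p * gy p).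
split; [move=> p; exact: is_derive_mul|move=> p; exact: is_derive_mul| |].
- by apply: real_class_C_add; apply: IHn => //; exact: real_class_CW.
- by apply: real_class_C_add; apply: IHn => //; exact: real_class_CW.
Qed.

Lemma is_derive_fst p (v : R * R) : is_derive p v fst v.1.
Proof.
apply/is_derive_line.
rewrite (_ : (fun h => _) = (fun h : R => v.1 * h + p.1)); last first.
  by apply/funext => h /=; rewrite /GRing.scale /= mulrC.
rewrite -[X in is_derive _ _ _ X]mulr1 -[X in is_derive _ _ _ X]addr0.
exact: (is_derive_add (is_derive_scale v.1 (is_derive_id (0 : R) (1 : R)))).
Qed.

Lemma is_derive_snd p (v : R * R) : is_derive p v snd v.2.
Proof.
apply/is_derive_line.
rewrite (_ : (fun h => _) = (fun h : R => v.2 * h + p.2)); last first.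
  by apply/funext => h /=; rewrite /GRing.scale /= mulrC.
rewrite -[X in is_derive _ _ _ X]mulr1 -[X in is_derive _ _ _ X]addr0.
exact: (is_derive_add (is_derive_scale v.2 (is_derive_id (0 : R) (1 : R)))).
Qed.

Lemma real_class_C_fst n : real_class_C n fst.
Proof.
have cf : continuous (@fst R R) by move=> p; exact: cvg_fst.
case: n => [|n]; split=> //.
exists (fun=> 1), (fun=> 0); split; try exact: real_class_C_cst.
- by move=> p; exact: is_derive_fst.
- by move=> p; exact: is_derive_fst.
Qed.

Lemma real_class_C_snd n : real_class_C n snd.
Proof.
have cf : continuous (@snd R R) by move=> p; exact: cvg_snd.
case: n => [|n]; split=> //.
exists (fun=> 0), (fun=> 1); split; try exact: real_class_C_cst.
- by move=> p; exact: is_derive_snd.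
- by move=> p; exact: is_derive_snd.
Qed.

Lemma class_CP n (f : R * R -> C) : class_C n f <->
  real_class_C n (fun p => complex.Re (f p)) /\
  real_class_C n (fun p => complex.Im (f p)).
Proof.
elim: n f => [|n IHn] f; split.
- by move=> [[]].
- by move=> [[? _] [? _]].
- move=> [[c1 c2] [dx dy /IHn[hx1 hx2] /IHn[hy1 hy2]]]; split; split=> //.
  + exists (fun p => complex.Re (d_x f p)), (fun p => complex.Re (d_y f p)).
    split=> // p; first exact: derivableP (proj1 (dx p)).
    exact: derivableP (proj1 (dy p)).
  + exists (fun p => complex.Im (d_x f p)), (fun p => complex.Im (d_y f p)).
    split=> // p; first exact: derivableP (proj2 (dx p)).
    exact: derivableP (proj2 (dy p)).
- move=> [[c1 [fx [fy [h1 h2 h3 h4]]]] [c2 [gx [gy [k1 k2 k3 k4]]]]].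
  split=> //; split.
  + by move=> p; split; [case: (h1 p)|case: (k1 p)].
  + by move=> p; split; [case: (h2 p)|case: (k2 p)].
  + apply/IHn; split.
      rewrite (_ : (fun p => _) = fx)//; apply/funext => p /=.
      by case: (h1 p).
    rewrite (_ : (fun p => _) = gx)//; apply/funext => p /=.
    by case: (k1 p).
  + apply/IHn; split.
      rewrite (_ : (fun p => _) = fy)//; apply/funext => p /=.
      by case: (h2 p).
    rewrite (_ : (fun p => _) = gy)//; apply/funext => p /=.
    by case: (k2 p).
Qed.

Lemma class_C_mul n (f g : R * R -> C) : class_C n f -> class_C n g ->
  class_C n (fun p => f p * g p).
Proof.
move=> /class_CP[f1 f2] /class_CP[g1 g2]; apply/class_CP; split.
- under eq_fun do rewrite ReM -mulrN -mulN1r mulrCA.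
  apply: real_class_C_add; first exact: real_class_C_mul.
  by apply: real_class_C_mul; [exact: real_class_C_cst|exact: real_class_C_mul].
- under eq_fun do rewrite ImM.
  by apply: real_class_C_add; exact: real_class_C_mul.
Qed.

Lemma class_C_exp n (f : R * R -> C) k : class_C n f ->
  class_C n (fun p => f p ^+ k).
Proof.
move=> hf; elim: k => [|k IHk].
  by apply/class_CP; split; exact: real_class_C_cst.
by under eq_fun do rewrite exprS; exact: class_C_mul.
Qed.

Lemma class_C_zcoord n : class_C n (@zcoord R).
Proof.
by apply/class_CP; split; [exact: real_class_C_fst|exact: real_class_C_snd].
Qed.

Lemma class_C_zconj n : class_C n (fun p => (@zcoord R p)^*).
Proof.
apply/class_CP; split; first exact: real_class_C_fst.
rewrite (_ : (fun p => _) = (fun p => -1 * p.2)).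
  by apply: real_class_C_mul; [exact: real_class_C_cst|exact: real_class_C_snd].
by apply/funext => p /=; rewrite mulN1r.
Qed.

Lemma class_C_real n f : real_class_C n f -> class_C n (fun p => (f p)%:C).
Proof. by move=> hf; apply/class_CP; split => //; exact: real_class_C_cst. Qed.

End SmoothFunctions.

(** * Flat functions exp(- c / t) / t^m *)

Section FlatExponential.
Context {R : realType}.
Implicit Types (c t : R) (m n : nat).

(* Every derivative of [exp (- c / t)] is a combination of these. *)
Definition flat_exp c m t : R := if 0 < t then expR (- (c / t)) / t ^+ m else 0.

Lemma flat_exp_le0 c m t : t <= 0 -> flat_exp c m t = 0.
Proof. by rewrite /flat_exp ltNge => ->. Qed.

Lemma flat_exp_mul c m t : t * flat_exp c m.+1 t = flat_exp c m t.
Proof.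
rewrite /flat_exp; case: ifPn => t0; last by rewrite mulr0.
have tn0 : t != 0 by rewrite gt_eqF.
by rewrite exprS invfM; field; rewrite expf_neq0 tn0.
Qed.

Lemma flat_exp_ge0 c m t : 0 <= flat_exp c m t.
Proof.
by rewrite /flat_exp; case: ifPn => // t0; rewrite divr_ge0 ?expR_ge0 ?exprn_ge0 ?ltW.
Qed.

(** With u = c / t, one term of the exponential series gives u^(m+2) / (m+2)! <= exp u, hence K =
    (m+2)! / c^(m+2). The two spare powers of t make the derivative at 0 vanish. *)
Lemma flat_exp_bound c m : 0 < c ->
  exists2 K, 0 < K & forall t, flat_exp c m t <= K * t ^+ 2.
Proof.
move=> c0; exists ((m.+2)`!%:R / c ^+ m.+2).
  by rewrite divr_gt0 ?exprn_gt0// ltr0n fact_gt0.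
move=> t; rewrite /flat_exp; case: ifPn => t0; last first.
  by rewrite mulr_ge0 ?sqr_ge0// divr_ge0// exprn_ge0// ltW.
have u0 : 0 < c / t by rewrite divr_gt0.
have := expR_ge1Dxn m.+1 (ltW u0) => h.
have {}h : (c / t) ^+ m.+2 / (m.+2)`!%:R <= expR (c / t).
  by apply: le_trans h; rewrite lerDr.
have f0 : 0 < (m.+2)`!%:R :> R by rewrite ltr0n fact_gt0.
have {}h : expR (- (c / t)) <= (m.+2)`!%:R / (c / t) ^+ m.+2.
  move: h; rewrite ler_pdivrMr// expRN ler_pdivlMr ?exprn_gt0// => h.
  by rewrite [leLHS]mulrC ler_pdivrMr ?expR_gt0// [leRHS]mulrC.
rewrite ler_pdivrMr ?exprn_gt0//; apply: le_trans h _.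
rewrite [leRHS](_ : _ = (m.+2)`!%:R / c ^+ m.+2 * t ^+ m.+2).
  by rewrite expr_div_n invf_div mulrA mulrAC.
by rewrite -[LHS]mulrA -(exprD t 2 m).
Qed.

Lemma is_derive_flat_exp c m t : 0 < c ->
  is_derive t 1 (flat_exp c m)
    (c * flat_exp c m.+2 t - m%:R * flat_exp c m.+1 t).
Proof.
move=> c0; have [t0|t0|->] := ltgtP t 0.
- rewrite !flat_exp_le0 ?ltW// !mulr0 subr0.
  apply: near_eq_is_derive (is_derive_const t 1 0).
  near=> s; rewrite flat_exp_le0// ltW//; near: s.
  exact: lt_nbhsl.
- have tn0 : t != 0 by rewrite gt_eqF.
  have dV : is_derive t 1 (fun s : R => s^-1) (- t ^- 2).
    have := is_deriveV tn0 (is_derive_id t 1).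
    by rewrite /GRing.scale /= mulr1.
  have dX (u : R) : is_derive u 1 (fun u => u ^+ m) (m%:R * u ^+ m.-1).
    apply: DeriveDef; first exact: exprn_derivable.
    by rewrite exp_derive /GRing.scale /= mulr1.
  have dE (u : R) : is_derive u 1 (fun u => expR (- c * u)) (expR (- c * u) * - c).
    have := is_derive_compr (is_derive_expR (- c * u))
      (is_derive_scale (- c) (is_derive_id u 1)).
    by rewrite mulr1.
  (* For t > 0 the function is s |-> exp(- c s) s^m composed with the inverse. *)
  have := is_derive_compr (is_derive_mul (dE t^-1) (dX t^-1)) dV.
  have e : \forall s \near t, expR (- c * s^-1) * s^-1 ^+ m = flat_exp c m s.
    near=> s; rewrite /flat_exp ifT ?exprVn ?mulNr//.
    by near: s; exact: lt_nbhsr.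
  move=> /(near_eq_is_derive e) d.
  apply: is_derive_eq d _; rewrite /flat_exp t0 -!mulNr -!exprVn.
  by case: (m) => [|k]; rewrite ?[_.+1.-1]/= ?exprS ?expr0; ring.
(* At 0 the difference quotient is at most K |h| in absolute value. *)
- have [K K0 fK] := flat_exp_bound m c0.
  rewrite !flat_exp_le0// !mulr0 subr0.
  suff h : (fun h : R => h^-1 *: ((flat_exp c m \o shift 0) (h *: 1) - flat_exp c m 0))
      @ 0^' --> (0 : R).
    by apply: DeriveDef; [apply/cvg_ex; exists 0|exact: cvg_lim].
  apply/cvgrPdist_le => e e0; near=> h.
  have h0 : h != 0 by near: h; exact: nbhs_dnbhs_neq.
  have hK : `|h| <= e / K.
    near: h; apply: dnbhs0_le; exact: divr_gt0.
  rewrite sub0r normrN /GRing.scale /= mulr1 addr0 (flat_exp_le0 _ _ (lexx 0)) subr0.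
  rewrite normrM normfV mulrC ler_pdivrMr ?normr_gt0//.
  rewrite (ger0_norm (flat_exp_ge0 _ _ _)); apply: le_trans (fK h) _.
  rewrite -[h ^+ 2]real_normK ?num_real// expr2 mulrA ler_wpM2r//.
  by rewrite mulrC -ler_pdivlMr.
Unshelve. all: by end_near. Qed.

End FlatExponential.

(** * Rules for the dbar operator *)

Section Dbar.
Context {R : realType}.
Local Notation C := R[i].
Implicit Types (f g : R * R -> C) (p v : R * R).

Definition is_cderive p v f (df : C) :=
  is_derive p v (fun q => complex.Re (f q)) (complex.Re df) /\
  is_derive p v (fun q => complex.Im (f q)) (complex.Im df).

Lemma is_cderive_mul p v f g df dg :
  is_cderive p v f df -> is_cderive p v g dg ->
  is_cderive p v (fun q => f q * g q) (df * g p + f p * dg).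
Proof.
move=> [f1 f2] [g1 g2]; split.
- rewrite (_ : (fun q => _) = (fun q => complex.Re (f q) * complex.Re (g q) +
     -1 * (complex.Im (f q) * complex.Im (g q)))); last first.
    by apply/funext => q; rewrite ReM mulN1r.
  apply: is_derive_eq (is_derive_add (is_derive_mul f1 g1)
    (is_derive_scale (-1) (is_derive_mul f2 g2))) _.
  by rewrite ReD !ReM; ring.
- rewrite (_ : (fun q => _) = (fun q => complex.Re (f q) * complex.Im (g q) +
     complex.Im (f q) * complex.Re (g q))); last first.
    by apply/funext => q; rewrite ImM.
  apply: is_derive_eq (is_derive_add (is_derive_mul f1 g2)
    (is_derive_mul f2 g1)) _.
  by rewrite ImD !ImM; ring.
Qed.

(** [dbar] is total and has a value even where partial derivatives do not exist; this relation
    records their existence, as the product rule requires. *)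
Definition has_dbar p f (a : C) := exists fx fy,
  [/\ is_cderive p (1, 0) f fx, is_cderive p (0, 1) f fy &
      a = 2%:R^-1 * (fx + 'i * fy)].

Lemma has_dbarE p f a : has_dbar p f a -> dbar f p = a.
Proof.
move=> [fx [fy [[x1 x2] [y1 y2] ->]]]; rewrite /dbar; congr (_ * (_ + _ * _)).
- by apply: complex_eqP; [case: x1|case: x2].
- by apply: complex_eqP; [case: y1|case: y2].
Qed.

Lemma has_dbar_mul p f g a b : has_dbar p f a -> has_dbar p g b ->
  has_dbar p (fun q => f q * g q) (a * g p + f p * b).
Proof.
move=> [fx [fy [x y ->]]] [gx [gy [x' y' ->]]].
exists (fx * g p + f p * gx), (fy * g p + f p * gy); split.
- exact: is_cderive_mul.
- exact: is_cderive_mul.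
- by ring.
Qed.

Lemma has_dbar_cst p (c : C) : has_dbar p (fun=> c) 0.
Proof.
exists 0, 0; split; last by rewrite mulr0 addr0 mulr0.
- by split; exact: is_derive_const.
- by split; exact: is_derive_const.
Qed.

Lemma has_dbar_zcoord p : has_dbar p (@zcoord R) 0.
Proof.
exists 1, 'i; split.
- by split; [exact: is_derive_fst|exact: is_derive_snd].
- by split; [exact: is_derive_fst|exact: is_derive_snd].
- by rewrite -expr2 sqr_i subrr mulr0.
Qed.

Lemma has_dbar_zconj p : has_dbar p (fun q => (@zcoord R q)^*) 1.
Proof.
have E : (fun q : R * R => complex.Im (zcoord q)^*) = (fun q => -1 * q.2).
  by apply/funext => q; rewrite mulN1r.
exists 1, (- 'i); split.
- split; first exact: is_derive_fst.
  rewrite E; apply: is_derive_eq (is_derive_scale (-1) (is_derive_snd p _)) _.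
  by rewrite /= mulr0.
- split; first by rewrite /= oppr0; exact: is_derive_fst.
  rewrite E; apply: is_derive_eq (is_derive_scale (-1) (is_derive_snd p _)) _.
  by rewrite /= mulr1.
- by rewrite mulrN -expr2 sqr_i opprK -(natrD _ 1 1) mulVf// pnatr_eq0.
Qed.

Lemma has_dbar_exp p f a n : has_dbar p f a ->
  has_dbar p (fun q => f q ^+ n) (n%:R * f p ^+ n.-1 * a).
Proof.
move=> fa; elim: n => [|n IHn].
  by rewrite !mul0r; exact: has_dbar_cst.
rewrite (_ : (fun q => _) = (fun q => f q * f q ^+ n)); last first.
  by apply/funext => q; rewrite exprS.
rewrite (_ : _ * a = a * f p ^+ n + f p * (n%:R * f p ^+ n.-1 * a)).
  exact: has_dbar_mul.
by case: n {IHn} => [|n] /=; rewrite -natr1 ?exprS; ring.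
Qed.

(** The dbar derivative of |z|^2 is z, whence the factor - z. *)
Lemma has_dbar_radial p (h dh : R -> R) (a : R) :
  is_derive (a - (p.1 ^+ 2 + p.2 ^+ 2)) 1 h (dh (a - (p.1 ^+ 2 + p.2 ^+ 2))) ->
  has_dbar p (fun q => (h (a - (q.1 ^+ 2 + q.2 ^+ 2)))%:C)
    (- (dh (a - (p.1 ^+ 2 + p.2 ^+ 2)))%:C * zcoord p).
Proof.
move=> hd; set D := dh _ in hd *.
have dq (v : R * R) : is_derive p v (fun q => a - (q.1 ^+ 2 + q.2 ^+ 2))
    (- (2 * (v.1 * p.1 + v.2 * p.2))).
  rewrite (_ : (fun q => _) =
    (fun q : R * R => a + -1 * (q.1 * q.1 + q.2 * q.2))); last first.
    by apply/funext => q; rewrite mulN1r !expr2.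
  apply: is_derive_eq (is_derive_add (is_derive_const p v a) (is_derive_scale (-1)
    (is_derive_add (is_derive_mul (is_derive_fst p v) (is_derive_fst p v))
      (is_derive_mul (is_derive_snd p v) (is_derive_snd p v))))) _.
  by ring.
exists (D * (- (2 * p.1)))%:C, (D * (- (2 * p.2)))%:C; split.
- split; last exact: is_derive_const.
  have := @is_derive_compr R _ (fun q : R * R => a - (q.1 ^+ 2 + q.2 ^+ 2)) h
    p (1, 0) D _ hd (dq (1, 0)).
  by rewrite /= mul1r mul0r addr0.
- split; last exact: is_derive_const.
  have := @is_derive_compr R _ (fun q : R * R => a - (q.1 ^+ 2 + q.2 ^+ 2)) h
    p (0, 1) D _ hd (dq (0, 1)).
  by rewrite /= mul1r mul0r add0r.
- have n2 : (2 : R) != 0 by rewrite pnatr_eq0.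
  rewrite (_ : 2%:R^-1 = (2^-1)%:C); last by rewrite fmorphV rmorph_nat.
  by apply: complex_eqP => /=; field.
Qed.

Lemma class_C_has_dbar n p f : class_C n.+1 f -> has_dbar p f (dbar f p).
Proof.
move=> [_ [dx dy _ _]]; exists (d_x f p), (d_y f p); split=> //.
- by have [h1 h2] := dx p; split; [exact: (derivableP h1)|exact: (derivableP h2)].
- by have [h1 h2] := dy p; split; [exact: (derivableP h1)|exact: (derivableP h2)].
Qed.

End Dbar.

(** * Integrals of derivatives over the disc *)

Section Green.
Context {R : realType}.
Local Notation RT := (measurableTypeR R).
Local Notation R2 := (RT * RT)%type.
Local Notation mu := (@lebesgue_measure R).
Local Notation area := (@area R).
Local Notation disk := (@disk R : set R2).
Local Notation open_disk := (@open_disk R : set R2).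
Implicit Types (f g : R * R -> R).

Lemma disk_coord (p : R * R) : disk p -> -1 <= p.1 <= 1 /\ -1 <= p.2 <= 1.
Proof.
have h (x : R) : x ^+ 2 <= 1 -> -1 <= x <= 1.
  by rewrite -ler_norml -real_normK ?num_real// expr_le1.
rewrite /Defs.disk /= => pd.
by have := sqr_ge0 p.1; have := sqr_ge0 p.2; split; apply: h; lra.
Qed.

Lemma continuous_disk_bounded f : continuous f ->
  exists M, forall p, disk p -> `|f p| <= M.
Proof.
(* The bound is taken on the enclosing square, which is compact as a product of segments. *)
move=> cf; pose Q := (`[(-1 : R), 1] `*` `[(-1 : R), 1])%classic.
have cQ : compact Q by apply: compact_setX; exact: segment_compact.
have cnf : {within Q, continuous (fun p => `|f p|)}.
  by apply: continuous_subspaceT => p; apply: cvg_norm; exact: cf.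
have [] := @compact_EVT_max _ R _ Q _ cQ cnf.
  by exists (0, 0); split; rewrite /= in_itv/=; lra.
move=> c _ fc; exists `|f c| => p /disk_coord[p1 p2]; apply: fc.
by rewrite inE; split; rewrite /= in_itv.
Qed.

Lemma continuous_disk_integrable f : continuous f ->
  area.-integrable disk (EFin \o (f : R2 -> R)).
Proof.
move=> cf; have [M fM] := continuous_disk_bounded cf.
have mf : measurable_fun disk (f : R2 -> R).
  apply: (measurable_funS measurableT (@subsetT _ disk)).
  exact: continuous_measurable_prod.
apply: measurable_bounded_integrable; [|exact: area_disk_lty|exact: mf|].
  exact: measurable_disk.
exists M; split; first exact: num_real.
by move=> r Mr p pd; exact: le_trans (fM p pd) (ltW Mr).
Qed.

Let open_disk_coord (x y : R) : open_disk (x, y) ->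
  x \in `[(-1), 1] /\ y \in `[(-1), 1].
Proof. by move/open_disk_sub/disk_coord; rewrite !in_itv. Qed.

Let integral_slice (F f : R -> R) : continuous f ->
  (forall x : R, is_derive x 1 F (f x)) -> F 1 = 0 -> F (-1) = 0 ->
  (forall x, x \notin `[(-1 : R), 1] -> f x = 0) ->
  (\int[mu]_x (f x)%:E = 0)%E.
Proof.
move=> cf dF F1 FN1 f0.
transitivity (\int[mu]_(x in `[(-1)%R, 1%R]) (f x)%:E)%E.
  rewrite [RHS]integral_mkcond; apply: eq_integral => x _; rewrite patchE.
  by case: ifPn => //; rewrite notin_setE => /negP /f0 ->.
rewrite (integral_is_derive _ cf dF) ?F1 ?FN1 ?subrr//.
Qed.

(** As [fx] vanishes off the disc, the integral runs over the whole plane. Fubini integrates in x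
    first, and each slice gives f(1, y) - f(-1, y) = 0. *)
Lemma Rintegral_disk_derive_x f (fx : R * R -> R) : continuous fx ->
  (forall p : R * R, is_derive p (1, 0) f (fx p)) ->
  (forall p, ~ open_disk p -> f p = 0 /\ fx p = 0) ->
  \int[area]_(p in disk) fx p = 0.
Proof.
move=> cfx df f0; have fi := continuous_disk_integrable cfx.
have fE : fx = fx \_ disk.
  apply/funext => p; rewrite patchE; case: ifPn => //; rewrite notin_setE => pd.
  by have [|//] := f0 p; move=> /open_disk_sub.
rewrite /Rintegral integral_mkcond.
have {}fi : area.-integrable setT (EFin \o (fx : R2 -> R)).
  move/(integrable_mkcond _ measurable_disk) : fi.
  by rewrite restrict_EFin -fE.
rewrite restrict_EFin -fE /area -(integral21_prod_meas1 fi) integral0_eq// => y _.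
apply: (@integral_slice (fun x => f (x, y))).
- move=> x; apply: (@continuous_comp _ _ _ (fun x => (x, y)) fx);
    last exact: cfx.
  by apply: (@cvg_pair _ _ _ _ (nbhs x) (nbhs y)); [exact: cvg_id|exact: cvg_cst].
- move=> x; apply/is_derive_line.
  move: (df (x, y)) => /is_derive_line; congr (is_derive _ _ _ _).
  apply/funext => h; rewrite (_ : h *: (1, 0) + (x, y) = (h *: 1 + x, y))//.
  by congr pair; rewrite /= scaler0 add0r.
- apply: (proj1 (f0 _ _)); rewrite /Defs.open_disk/= expr1n.
  by have := sqr_ge0 y; lra.
- apply: (proj1 (f0 _ _)); rewrite /Defs.open_disk/= sqrrN expr1n.
  by have := sqr_ge0 y; lra.
- by move=> x xn; apply: (proj2 (f0 _ _)) => /open_disk_coord[xi _]; rewrite xi in xn.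
Qed.

Lemma Rintegral_disk_derive_y f (fy : R * R -> R) : continuous fy ->
  (forall p : R * R, is_derive p (0, 1) f (fy p)) ->
  (forall p, ~ open_disk p -> f p = 0 /\ fy p = 0) ->
  \int[area]_(p in disk) fy p = 0.
Proof.
move=> cfy df f0; have fi := continuous_disk_integrable cfy.
have fE : fy = fy \_ disk.
  apply/funext => p; rewrite patchE; case: ifPn => //; rewrite notin_setE => pd.
  by have [|//] := f0 p; move=> /open_disk_sub.
rewrite /Rintegral integral_mkcond.
have {}fi : area.-integrable setT (EFin \o (fy : R2 -> R)).
  move/(integrable_mkcond _ measurable_disk) : fi.
  by rewrite restrict_EFin -fE.
rewrite restrict_EFin -fE /area -(integral12_prod_meas1 fi) integral0_eq// => x _.
apply: (@integral_slice (fun y => f (x, y))).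
- move=> y; apply: (@continuous_comp _ _ _ (fun y => (x, y)) fy);
    last exact: cfy.
  by apply: (@cvg_pair _ _ _ _ (nbhs x) (nbhs y)); [exact: cvg_cst|exact: cvg_id].
- move=> y; apply/is_derive_line.
  move: (df (x, y)) => /is_derive_line; congr (is_derive _ _ _ _).
  apply/funext => h; rewrite (_ : h *: (0, 1) + (x, y) = (x, h *: 1 + y))//.
  by congr pair; rewrite /= scaler0 add0r.
- apply: (proj1 (f0 _ _)); rewrite /Defs.open_disk/= expr1n.
  by have := sqr_ge0 x; lra.
- apply: (proj1 (f0 _ _)); rewrite /Defs.open_disk/= sqrrN expr1n.
  by have := sqr_ge0 x; lra.
- by move=> y yn; apply: (proj2 (f0 _ _)) => /open_disk_coord[_ yi]; rewrite yi in yn.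
Qed.

End Green.

(** * Dominated convergence for complex integrands *)

Section ComplexDominated.
Context d (T : measurableType d) (R : realType).
Variables (mu : {measure set T -> \bar R}) (D : set T).
Hypothesis mD : measurable D.
Local Notation C := R[i].

Let Rintegral_cvg0 (f_ : nat -> T -> R) (f g : T -> R) :
  (forall n, measurable_fun D (f_ n)) ->
  measurable_fun D f ->
  (forall x, D x -> f_ ^~ x @ \oo --> f x) ->
  mu.-integrable D (EFin \o g) ->
  (forall n x, D x -> `|f_ n x| <= g x) ->
  (forall n, \int[mu]_(x in D) f_ n x = 0) ->
  \int[mu]_(x in D) f x = 0.
Proof.
move=> mf_ mf cf ig fg f0.
have [] := @dominated_convergence _ T R mu D mD (fun n => EFin \o f_ n)
  (EFin \o f) (EFin \o g) _ _ _ ig _.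
- by move=> n; exact/measurable_EFinP.
- exact/measurable_EFinP.
- by apply: aeW => x Dx; apply: cvg_EFin; [exact: nearW|exact: cf].
- by apply: aeW => x n Dx; rewrite /= lee_fin fg.
move=> _ _ h; rewrite /Rintegral.
suff -> : (\int[mu]_(x in D) (f x)%:E = 0)%E by [].
apply: (cvg_unique _ h) => //.
rewrite (_ : (fun n => _) = cst 0%E); first exact: cvg_cst.
apply/funext => n /=; rewrite -[RHS]/((0 : R)%:E) -(f0 n) /Rintegral fineK//.
apply: integrable_fin_num => //; apply: le_integrable ig => //.
- exact/measurable_EFinP.
- move=> x Dx; rewrite /= lee_fin; apply: le_trans (ler_norm _).
  exact: fg.
Qed.

Lemma cintegral_dominated_eq0 (f_ : nat -> T -> C) (f : T -> C) (g : T -> R) :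
  (forall n, cmeasurable_fun D (f_ n)) -> cmeasurable_fun D f ->
  (forall x, D x -> complex.Re (f_ n x) @[n --> \oo] --> complex.Re (f x)) ->
  (forall x, D x -> complex.Im (f_ n x) @[n --> \oo] --> complex.Im (f x)) ->
  mu.-integrable D (EFin \o g) ->
  (forall n x, D x -> normc (f_ n x) <= g x) ->
  (forall n, cintegral mu D (f_ n) = 0) -> cintegral mu D f = 0.
Proof.
move=> mf_ [mf1 mf2] cf1 cf2 ig fg f0; apply: complex_eqP => /=.
- apply: (@Rintegral_cvg0 (fun n x => complex.Re (f_ n x)) _ g) => //.
  + by move=> n; case: (mf_ n).
  + by move=> n x Dx; apply: le_trans (normr_Re _) (fg n x Dx).
  + by move=> n; have := congr1 (@complex.Re R) (f0 n).
- apply: (@Rintegral_cvg0 (fun n x => complex.Im (f_ n x)) _ g) => //.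
  + by move=> n; case: (mf_ n).
  + by move=> n x Dx; apply: le_trans (normr_Im _) (fg n x Dx).
  + by move=> n; have := congr1 (@complex.Im R) (f0 n).
Qed.

End ComplexDominated.

(** * Smooth functions and test functions on the disc *)

Section TestFunctions.
Context {R : realType}.
Local Notation C := R[i].
Local Notation RT := (measurableTypeR R).
Local Notation R2 := (RT * RT)%type.
Local Notation area := (@area R).
Local Notation disk := (@disk R : set R2).
Local Notation open_disk := (@open_disk R : set R2).
Implicit Types (f g phi Q : R * R -> C).

Definition smooth f := forall n, class_C n f.

Lemma smooth_mul f g : smooth f -> smooth g -> smooth (fun p => f p * g p).
Proof. by move=> sf sg n; exact: class_C_mul. Qed.

Lemma smooth_cst (c : C) : smooth (fun=> c).
Proof. by move=> n; apply/class_CP; split; exact: real_class_C_cst. Qed.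

Lemma smooth_add f g : smooth f -> smooth g -> smooth (fun p => f p + g p).
Proof.
move=> sf sg n; have /class_CP[f1 f2] := sf n; have /class_CP[g1 g2] := sg n.
apply/class_CP; split.
- by under eq_fun do rewrite ReD; exact: real_class_C_add.
- by under eq_fun do rewrite ImD; exact: real_class_C_add.
Qed.

Lemma smooth_dbar f : smooth f -> smooth (dbar f).
Proof.
move=> sf; have dx : smooth (d_x f) by move=> n; have [_ []] := sf n.+1.
have dy : smooth (d_y f) by move=> n; have [_ []] := sf n.+1.
apply: smooth_mul; first exact: smooth_cst.
by apply: smooth_add => //; apply: smooth_mul => //; exact: smooth_cst.
Qed.

Lemma smooth_zmonom a b : smooth (fun p => @zcoord R p ^+ a * (zcoord p)^* ^+ b).
Proof.
apply: smooth_mul => n; apply: class_C_exp; first exact: class_C_zcoord.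
exact: class_C_zconj.
Qed.

Lemma smooth_measurable f : smooth f -> cmeasurable_fun disk (f : R2 -> C).
Proof.
move=> /(_ 0)[[c1 c2] _]; split.
- apply: (measurable_funS measurableT (@subsetT _ disk)).
  exact: continuous_measurable_prod.
- apply: (measurable_funS measurableT (@subsetT _ disk)).
  exact: continuous_measurable_prod.
Qed.

Lemma smooth_bounded f : smooth f ->
  exists2 M, 0 <= M & forall p, disk p -> normc (f p) <= M.
Proof.
move=> /(_ 0)[[c1 c2] _]; have [M1 h1] := continuous_disk_bounded c1.
have [M2 h2] := continuous_disk_bounded c2.
have d0 : disk (0, 0) by rewrite /Defs.disk /= expr0n addr0.
exists (M1 + M2).
  by rewrite addr_ge0//; [apply: le_trans (h1 _ d0)|apply: le_trans (h2 _ d0)].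
move=> p pd; rewrite [f p]complexE; apply: le_trans (le_normcD _ _) _.
rewrite lerD// ?normc_real ?h1//.
by rewrite ComplexField.Normc.normcM normc_real /= expr0n expr1n add0r sqrtr1 mul1r h2.
Qed.

Lemma smooth_cintegrable f : smooth f -> cintegrable area disk (f : R2 -> C).
Proof.
move=> sf; have [M _ fM] := smooth_bounded sf.
apply: (cintegrable_bounded measurable_disk area_disk_lty _ fM).
exact: smooth_measurable.
Qed.

Lemma cintegrableM_smooth f g : cintegrable area disk (f : R2 -> C) ->
  smooth g -> cintegrable area disk (fun p : R2 => f p * g p).
Proof.
move=> fi sg; have [M _ gM] := smooth_bounded sg.
by apply: (cintegrableM_bounded measurable_disk fi _ gM); exact: smooth_measurable.
Qed.

Lemma test_function_mul Q phi : smooth Q -> test_function phi ->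
  test_function (fun p => Q p * phi p).
Proof.
move=> sQ [sphi cphi]; split; first exact: smooth_mul.
apply: subset_trans cphi; apply: closureS => p /=.
by apply: contra_neq => ->; rewrite mulr0.
Qed.

(** Off the open disc [phi] vanishes in a neighbourhood of each point, so its partial derivatives
    vanish there too and each integrates to 0. *)
Lemma integral_dbar_test phi : test_function phi ->
  cintegral area disk (dbar phi) = 0.
Proof.
move=> [sphi cphi].
have off p : ~ open_disk p -> \forall q \near p, phi q = 0.
  move=> pd; have : open (~` closure [set q | phi q != 0]).
    by apply: closed_openC; exact: closed_closure.
  rewrite openE => /(_ p) h; apply: filterS (h _).
    by move=> q /= qn; apply: contrapT => /eqP q0; apply/qn/subset_closure.
  by move=> /cphi.
have [_ [dx dy cx cy]] := sphi 1.
have zero (g : R * R -> R) p v : (\forall q \near p, g q = 0) -> 'D_v g p = 0.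
  move=> g0; apply: derive_val.
  apply: near_eq_is_derive (is_derive_const p v 0).
  by apply: filterS g0 => q ->.
have nRe p : ~ open_disk p -> \forall q \near p, complex.Re (phi q) = 0.
  by move=> /off; apply: filterS => q ->.
have nIm p : ~ open_disk p -> \forall q \near p, complex.Im (phi q) = 0.
  by move=> /off; apply: filterS => q ->.
have sx : smooth (d_x phi) by move=> n; have [_ []] := sphi n.+1.
have sy : smooth (d_y phi) by move=> n; have [_ []] := sphi n.+1.
have ix : cintegral area disk (d_x phi) = 0.
  have [[c1 c2] _] := sx 0; apply: complex_eqP => /=.
  - apply: (@Rintegral_disk_derive_x _ (fun p => complex.Re (phi p))) => //.
      by move=> p; have [h1 h2] := dx p; exact: (derivableP h1).
    by move=> p /nRe pd; split; [exact: nbhs_singleton pd|exact: zero].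
  - apply: (@Rintegral_disk_derive_x _ (fun p => complex.Im (phi p))) => //.
      by move=> p; have [h1 h2] := dx p; exact: (derivableP h2).
    by move=> p /nIm pd; split; [exact: nbhs_singleton pd|exact: zero].
have iy : cintegral area disk (d_y phi) = 0.
  have [[c1 c2] _] := sy 0; apply: complex_eqP => /=.
  - apply: (@Rintegral_disk_derive_y _ (fun p => complex.Re (phi p))) => //.
      by move=> p; have [h1 h2] := dy p; exact: (derivableP h1).
    by move=> p /nRe pd; split; [exact: nbhs_singleton pd|exact: zero].
  - apply: (@Rintegral_disk_derive_y _ (fun p => complex.Im (phi p))) => //.
      by move=> p; have [h1 h2] := dy p; exact: (derivableP h2).
    by move=> p /nIm pd; split; [exact: nbhs_singleton pd|exact: zero].
have six := smooth_cintegrable sx; have siy := smooth_cintegrable sy.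
have mD := @measurable_disk R.
have i1 := cintegrableZ 'i mD siy; have i2 := cintegrableD mD six i1.
rewrite /dbar (cintegralZ _ mD i2) (cintegralD mD six i1) (cintegralZ _ mD siy).
by rewrite ix iy mulr0 addr0 mulr0.
Qed.

(** As z^k is holomorphic, z^k dbar phi = dbar (z^k phi), and z^k phi is again a test function. *)
Lemma zexp_weakly_holomorphic k phi : test_function phi ->
  cintegral area disk (fun p => zcoord p ^+ k * dbar phi p) = 0.
Proof.
move=> tphi; have sz : smooth (fun p => @zcoord R p ^+ k).
  by move=> n; apply: class_C_exp; exact: class_C_zcoord.
rewrite -[RHS](integral_dbar_test (test_function_mul sz tphi)).
apply: eq_cintegral => p _; apply/esym/has_dbarE.
have := has_dbar_mul (has_dbar_exp k (has_dbar_zcoord p))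
  (class_C_has_dbar p (proj1 tphi 1)).
by rewrite mulr0 mul0r add0r.
Qed.

End TestFunctions.

(** * Weakly holomorphic functions *)

Section Cutoff.
Context {R : realType}.
Implicit Types (c s t : R) (n : nat).

(* A smooth approximation of the positive part of [s]. *)
Definition cutoff n s : R := s * flat_exp n.+1%:R^-1 0 s.

Definition dcutoff n s : R :=
  flat_exp n.+1%:R^-1 0 s + n.+1%:R^-1 * flat_exp n.+1%:R^-1 1 s.

Let invn_gt0 n : 0 < n.+1%:R^-1 :> R.
Proof. by rewrite invr_gt0 ltr0n. Qed.

Lemma is_derive_cutoff n s : is_derive s 1 (cutoff n) (dcutoff n s).
Proof.
apply: is_derive_eq
  (is_derive_mul (is_derive_id s 1) (is_derive_flat_exp 0 s (invn_gt0 n))) _.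
by rewrite mul0r subr0 mul1r mulrCA flat_exp_mul.
Qed.

Lemma flat_exp0_le1 c s : 0 < c -> flat_exp c 0 s <= 1.
Proof.
move=> c0; rewrite /flat_exp; case: ifPn => // s0.
by rewrite expr0 divr1 expR_le1 oppr_le0 divr_ge0 ?ltW.
Qed.

Lemma cutoff_bound n s : s <= 1 -> `|cutoff n s| <= 1.
Proof.
move=> s1; rewrite /cutoff normrM (ger0_norm (flat_exp_ge0 _ _ _)).
have [s0|s0] := lerP s 0; first by rewrite flat_exp_le0// mulr0.
rewrite gtr0_norm// mulr_ile1 ?flat_exp_ge0 ?flat_exp0_le1//.
exact: ltW.
Qed.

(** With u = 1 / ((n+1) s) this is (1 + u) exp(- u) <= 1. The bound is uniform in [n] thanks to the
    factor s in [cutoff]; cutoffs of the constant 1 would have unbounded derivatives. *)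
Lemma dcutoff_bound n s : `|dcutoff n s| <= 1.
Proof.
rewrite /dcutoff ger0_norm; last first.
  by rewrite addr_ge0 ?flat_exp_ge0// mulr_ge0 ?flat_exp_ge0 ?ltW.
have [s0|s0] := lerP s 0; first by rewrite !flat_exp_le0// mulr0 addr0.
rewrite /flat_exp s0 expr0 expr1 divr1 mulrCA.
set u := _ / s; set E := expR _.
rewrite (_ : E + _ = (1 + u) * E); last by rewrite /u; ring.
by rewrite /E expRN ler_pdivrMr ?expR_gt0// mul1r expR_ge1Dx.
Qed.

Let cvg_u s : 0 < s -> (n.+1%:R^-1 / (s - n.+1%:R^-1) : R) @[n --> \oo] --> (0 : R).
Proof.
move=> s0; have h := @cvg_harmonic R.
rewrite -(mul0r s^-1) -{2}(subr0 s); apply: cvgM => //; apply: cvgV.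
  by rewrite subr0 gt_eqF.
by apply: cvgB => //; exact: cvg_cst.
Qed.

Let near_pos s : 0 < s -> \forall n \near \oo, 0 < s - n.+1%:R^-1.
Proof.
move=> s0; have /cvgrPdist_lt/(_ _ s0) := @cvg_harmonic R.
apply: filterS => n; rewrite sub0r normrN ger0_norm ?subr_gt0//.
exact: ltW (invn_gt0 n).
Qed.

Let cvg_expu s : 0 < s ->
  expR (- (n.+1%:R^-1 / (s - n.+1%:R^-1))) @[n --> \oo] --> expR (- 0 : R).
Proof.
move=> s0.
apply: (@cvg_comp _ _ _ (fun n => - (n.+1%:R^-1 / (s - n.+1%:R^-1))) expR).
  by apply: cvgN; exact: cvg_u.
exact: continuous_expR.
Qed.

(** This is used at s = 1 - |z|^2. The shift makes the cutoff vanish for |z|^2 >= 1 - 1 / (n+1),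
    which keeps its support inside the open disc. *)
Lemma cvg_cutoff s : 0 < s -> cutoff n (s - n.+1%:R^-1) @[n --> \oo] --> s.
Proof.
move=> s0.
have h : (s - n.+1%:R^-1) * expR (- (n.+1%:R^-1 / (s - n.+1%:R^-1)))
    @[n --> \oo] --> (s - 0) * expR (- 0).
  apply: cvgM; last exact: cvg_expu.
  by apply: cvgB; [exact: cvg_cst|exact: cvg_harmonic].
rewrite subr0 oppr0 expR0 mulr1 in h; apply: cvg_trans h.
apply: near_eq_cvg; near=> n.
have sp : 0 < s - n.+1%:R^-1 by near: n; exact: near_pos.
by rewrite /cutoff /flat_exp sp expr0 divr1.
Unshelve. all: by end_near. Qed.

Lemma cvg_dcutoff s : 0 < s -> dcutoff n (s - n.+1%:R^-1) @[n --> \oo] --> (1 : R).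
Proof.
move=> s0.
have h : (1 + n.+1%:R^-1 / (s - n.+1%:R^-1)) *
    expR (- (n.+1%:R^-1 / (s - n.+1%:R^-1))) @[n --> \oo] --> (1 + 0) * expR (- 0).
  apply: cvgM; last exact: cvg_expu.
  by apply: cvgD; [exact: cvg_cst|exact: cvg_u].
rewrite addr0 oppr0 expR0 mulr1 in h; apply: cvg_trans h.
apply: near_eq_cvg; near=> n.
have sp : 0 < s - n.+1%:R^-1 by near: n; exact: near_pos.
by rewrite /dcutoff /flat_exp sp expr0 expr1 divr1; ring.
Unshelve. all: by end_near. Qed.

(** Differentiation raises the exponent m, so the induction on [k] treats all m at once. *)
Lemma real_class_C_flat_exp k c m (f : R * R -> R) : 0 < c ->
  (forall k, real_class_C k f) ->
  real_class_C k (fun p => flat_exp c m (f p)).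
Proof.
move=> c0 sf.
have cf i : continuous (fun p => flat_exp c i (f p)).
  move=> p; apply: continuous_comp; first exact: (real_class_C_continuous (sf 0%N)).
  by apply: is_derive_continuous => t; exact: is_derive_flat_exp.
elim: k m => [|k IHk] m; split=> //.
have [_ [fx [fy [h1 h2 h3 h4]]]] := sf k.+1.
pose g p := c * flat_exp c m.+2 (f p) + - m%:R * flat_exp c m.+1 (f p).
have sg : real_class_C k g.
  by apply: real_class_C_add; apply: real_class_C_mul => //;
    exact: real_class_C_cst.
have gE p v df : is_derive p v f df ->
    is_derive p v (fun p => flat_exp c m (f p)) (g p * df).
  move=> d; have := is_derive_compr (is_derive_flat_exp m (f p) c0) d.
  by rewrite /g mulNr.
exists (fun p => g p * fx p), (fun p => g p * fy p); split.
- by move=> p; exact: gE.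
- by move=> p; exact: gE.
- exact: real_class_C_mul.
- exact: real_class_C_mul.
Qed.

End Cutoff.

Section WeaklyHolomorphic.
Context {R : realType}.
Local Notation C := R[i].
Local Notation RT := (measurableTypeR R).
Local Notation R2 := (RT * RT)%type.
Local Notation area := (@area R).
Local Notation disk := (@disk R : set R2).
Local Notation open_disk := (@open_disk R : set R2).
Implicit Types (f Q : R * R -> C) (p : R * R).

Let rho p : R := p.1 ^+ 2 + p.2 ^+ 2.
Let lev (n : nat) : R := 1 - n.+1%:R^-1.

Definition disk_test n Q : R * R -> C :=
  fun p => (cutoff n (lev n - rho p))%:C * Q p.

Let real_class_C_lev k (a : R) : real_class_C k (fun p => a - rho p).
Proof.
have -> : (fun p => a - rho p) = (fun p => a + -1 * (p.1 * p.1 + p.2 * p.2)).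
  by apply/funext => p; rewrite mulN1r /rho !expr2.
apply: real_class_C_add; first exact: real_class_C_cst.
apply: real_class_C_mul; first exact: real_class_C_cst.
apply: real_class_C_add; apply: real_class_C_mul; try exact: real_class_C_fst;
  exact: real_class_C_snd.
Qed.

Lemma test_function_disk_test n Q : smooth Q -> test_function (disk_test n Q).
Proof.
move=> sQ; have c0 : 0 < n.+1%:R^-1 :> R by rewrite invr_gt0 ltr0n.
split.
  apply: smooth_mul sQ => k; apply: class_C_real.
  apply: real_class_C_mul; first exact: real_class_C_lev.
  by apply: real_class_C_flat_exp => // i; exact: real_class_C_lev.
(* A closed disc, of squared radius 1 - 1 / (n+1), that contains the support. *)
pose K := [set p : R * R | rho p <= lev n].
have cK : closed K.
  apply: (@closed_comp _ _ rho [set x | x <= lev n]); last exact: closed_le.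
  move=> p _; apply: cvgD; rewrite /= ?expr2; apply: cvgM;
    [exact: cvg_fst|exact: cvg_fst|exact: cvg_snd|exact: cvg_snd].
apply: (@subset_trans _ K).
  rewrite [X in _ `<=` X](closure_id K).1//; apply: closureS => p /=.
  apply: contra_neqP => /negP; rewrite -ltNge => pn.
  by rewrite /disk_test /cutoff flat_exp_le0 ?mulr0 ?mul0r// subr_le0 ltW.
by move=> p; rewrite /K /Defs.open_disk /= => /le_lt_trans; apply;
  rewrite /lev gtrBl.
Qed.

Lemma dbar_disk_test n Q p : smooth Q -> dbar (disk_test n Q) p =
  (cutoff n (lev n - rho p))%:C * dbar Q p -
  (dcutoff n (lev n - rho p))%:C * (zcoord p * Q p).
Proof.
move=> sQ; apply: has_dbarE.
have := has_dbar_mul (@has_dbar_radial _ p (cutoff n) (dcutoff n) (lev n)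
  (is_derive_cutoff _ _)) (class_C_has_dbar p (sQ 1%N)).
by rewrite addrC mulNr mulNr mulrA.
Qed.

(* Green's formula with the factor [1 - |z|^2] vanishing on the boundary. *)
Lemma weakly_holomorphic_green f Q : cintegrable area disk (f : R2 -> C) ->
  (forall phi, test_function phi ->
     cintegral area disk (fun p => f p * dbar phi p) = 0) ->
  smooth Q ->
  cintegral area disk (fun p : R2 =>
    f p * ((1 - rho p)%:C * dbar Q p - zcoord p * Q p)) = 0.
Proof.
move=> fi wf sQ.
have mo := @measurable_open_disk R; have md := @measurable_disk R.
have toopen (g : R2 -> C) : cintegral area disk g = cintegral area open_disk g.
  by rewrite /cintegral /Rintegral !integral_disk.
have sdQ := smooth_dbar sQ.
have szQ : smooth (fun p => zcoord p * Q p).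
  by apply: smooth_mul => // n; exact: class_C_zcoord.
have [M1 M10 hM1] := smooth_bounded sdQ.
have [M2 M20 hM2] := smooth_bounded szQ.
have [mf nf] := (cintegrableP _ md).1 fi.
have ReB_real (a b : R) (u v w : C) : complex.Re (u * (a%:C * v - b%:C * w)) =
    a * complex.Re (u * v) - b * complex.Re (u * w).
  by case: u v w => [? ?] [? ?] [? ?] /=; ring.
have ImB_real (a b : R) (u v w : C) : complex.Im (u * (a%:C * v - b%:C * w)) =
    a * complex.Im (u * v) - b * complex.Im (u * w).
  by case: u v w => [? ?] [? ?] [? ?] /=; ring.
have dbarE n p : dbar (disk_test n Q) p =
    (cutoff n (1 - rho p - n.+1%:R^-1))%:C * dbar Q p -
    (dcutoff n (1 - rho p - n.+1%:R^-1))%:C * (zcoord p * Q p).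
  by rewrite dbar_disk_test// /lev [1 - _ - _]addrAC.
have limE p : f p * ((1 - rho p)%:C * dbar Q p - zcoord p * Q p) =
    f p * ((1 - rho p)%:C * dbar Q p - (1 : R)%:C * (zcoord p * Q p)).
  by rewrite mul1r.
(* On the circle the derivatives of the cutoffs are 0 and do not tend to 1, so the limit is taken
   over the open disc, where integrals are the same. *)
rewrite toopen.
apply: (@cintegral_dominated_eq0 _ _ _ _ _ mo
  (fun n p => f p * dbar (disk_test n Q) p) _
  (fun p => (M1 + M2) * normc (f p))).
- move=> n; apply: cmeasurableM.
    by apply: cmeasurableS mf => //; exact: open_disk_sub.
  apply: (cmeasurableS md); first exact: open_disk_sub.
  exact/smooth_measurable/smooth_dbar/(proj1 (test_function_disk_test n sQ)).
- apply: cmeasurableM.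
    by apply: cmeasurableS mf => //; exact: open_disk_sub.
  apply: (cmeasurableS md); first exact: open_disk_sub.
  apply: cmeasurableB; last exact: smooth_measurable.
  apply: cmeasurableM; last exact: smooth_measurable.
  apply: smooth_measurable => n; apply: class_C_real.
  exact: real_class_C_lev.
- move=> p pd; rewrite (_ : (fun n => _) = (fun n =>
      cutoff n (1 - rho p - n.+1%:R^-1) * complex.Re (f p * dbar Q p) -
      dcutoff n (1 - rho p - n.+1%:R^-1) * complex.Re (f p * (zcoord p * Q p)))).
    rewrite limE ReB_real; apply: cvgB; apply: cvgM; try exact: cvg_cst.
      by apply: cvg_cutoff; rewrite subr_gt0.
    by apply: cvg_dcutoff; rewrite subr_gt0.
  by apply/funext => n; rewrite dbarE ReB_real.
- move=> p pd; rewrite (_ : (fun n => _) = (fun n =>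
      cutoff n (1 - rho p - n.+1%:R^-1) * complex.Im (f p * dbar Q p) -
      dcutoff n (1 - rho p - n.+1%:R^-1) * complex.Im (f p * (zcoord p * Q p)))).
    rewrite limE ImB_real; apply: cvgB; apply: cvgM; try exact: cvg_cst.
      by apply: cvg_cutoff; rewrite subr_gt0.
    by apply: cvg_dcutoff; rewrite subr_gt0.
  by apply/funext => n; rewrite dbarE ImB_real.
- have nf' : area.-integrable open_disk (EFin \o (fun p : R2 => normc (f p))).
    by apply: (integrableS md mo) nf; exact: open_disk_sub.
  rewrite (_ : _ \o _ = (fun p : R2 =>
    ((M1 + M2)%:E * (EFin \o (fun p : R2 => normc (f p))) p)%E)).
    exact: integrableZl.
  by apply/funext => p /=; rewrite EFinM.
- move=> n p /open_disk_sub pd; rewrite ComplexField.Normc.normcM mulrC.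
  apply: ler_wpM2r; first exact: normc_ge0.
  rewrite dbar_disk_test//; apply: le_trans (le_normcD _ _) _; rewrite normcN.
  have s1 : lev n - rho p <= 1.
    rewrite /lev -addrA gerDl -opprD oppr_le0 addr_ge0 ?invr_ge0//.
    by rewrite addr_ge0 ?sqr_ge0.
  rewrite !(ComplexField.Normc.normcM (_%:C)) !normc_real lerD//.
    rewrite -[leRHS]mul1r ler_pM ?normc_ge0 ?normr_ge0 ?hM1//.
    exact: cutoff_bound.
  rewrite -[leRHS]mul1r ler_pM ?normc_ge0 ?normr_ge0 ?hM2//.
  exact: dcutoff_bound.
- move=> n; rewrite -toopen; apply: wf; exact: test_function_disk_test.
Qed.

End WeaklyHolomorphic.

(** * Moments of weakly holomorphic functions *)

Section Moments.
Context {R : realType}.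
Local Notation C := R[i].
Local Notation RT := (measurableTypeR R).
Local Notation R2 := (RT * RT)%type.
Local Notation area := (@area R).
Local Notation disk := (@disk R : set R2).
Local Notation z := (@zcoord R).
Implicit Types (f : R * R -> C).

Definition weakly_holomorphic f := cintegrable area disk (f : R2 -> C) /\
  forall phi, test_function phi ->
    cintegral area disk (fun p => f p * dbar phi p) = 0.

Definition moment f a b : C :=
  cintegral area disk (fun p => f p * (z p ^+ a * (z p)^* ^+ b)).

Lemma zcoord_sqr (p : R * R) : z p * (z p)^* = (p.1 ^+ 2 + p.2 ^+ 2)%:C.
Proof. by rewrite -sqr_normc_conj sqr_normcE. Qed.

Lemma dbar_zmonom a b p : dbar (fun q => z q ^+ a * (z q)^* ^+ b) p =
  b%:R * (z p ^+ a * (z p)^* ^+ b.-1).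
Proof.
apply: has_dbarE.
have := has_dbar_mul (has_dbar_exp a (has_dbar_zcoord p))
  (has_dbar_exp b (has_dbar_zconj p)).
by rewrite mulr0 mul0r add0r mulr1 mulrCA.
Qed.

Lemma moment_integrable f a b : cintegrable area disk (f : R2 -> C) ->
  cintegrable area disk (fun p : R2 => f p * (z p ^+ a * (z p)^* ^+ b)).
Proof. by move=> fi; apply: cintegrableM_smooth => //; exact: smooth_zmonom. Qed.

(** Green's formula with Q = z^a: as dbar Q = 0, only - z^(a+1) remains. *)
Lemma moment_S0 f a : weakly_holomorphic f -> moment f a.+1 0 = 0.
Proof.
move=> [fi wf]; have := weakly_holomorphic_green fi wf (@smooth_zmonom R a 0).
move=> h; apply: (mulfI (x := -1)); first by rewrite oppr_eq0 oner_eq0.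
rewrite mulr0 -cintegralZ; [|exact: measurable_disk|exact: moment_integrable].
rewrite -[RHS]h; apply: eq_cintegral => p _.
by rewrite dbar_zmonom exprS; ring.
Qed.

(** Green's formula with Q = z^a (conj z)^(b+1), for which dbar Q = (b+1) z^a (conj z)^b; the terms
    in z^(a+1) (conj z)^(b+1) add up to the factor b + 2. *)
Lemma moment_SS f a b : weakly_holomorphic f ->
  b.+2%:R * moment f a.+1 b.+1 = b.+1%:R * moment f a b.
Proof.
move=> [fi wf]; have := weakly_holomorphic_green fi wf (@smooth_zmonom R a b.+1).
move=> h; apply/esym/eqP; rewrite -subr_eq0; apply/eqP; rewrite -[RHS]h.
have md := @measurable_disk R.
have i1 := moment_integrable a b fi; have i2 := moment_integrable a.+1 b.+1 fi.
rewrite /moment -(cintegralZ _ md i1) -(cintegralZ _ md i2) -cintegralB//;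
  try exact: cintegrableZ.
apply: eq_cintegral => p _.
rewrite (_ : (1 - _)%:C = 1 - z p * (z p)^*); last by rewrite zcoord_sqr rmorphB.
by rewrite dbar_zmonom [_.+1.-1]/= !exprS -(natr1 b.+1); ring.
Qed.

Lemma moment_lt f a b : weakly_holomorphic f -> (b < a)%N -> moment f a b = 0.
Proof.
move=> wf; elim: b a => [|b IHb] [//|a] ab; first exact: moment_S0.
have := moment_SS a b wf; rewrite IHb// mulr0 => /eqP.
by rewrite mulf_eq0 pnatr_eq0 => /eqP.
Qed.

(** The recurrence runs along the diagonals of constant a - b. Each starts at some (0, k) or (k+1,
    0), and the moments of the second kind always vanish. *)
Lemma moment_eq0 f : weakly_holomorphic f -> (forall k, moment f 0 k = 0) ->
  forall a b, moment f a b = 0.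
Proof.
move=> wf f0; elim=> [|a IHa] [|b]//; first exact: moment_S0.
have := moment_SS a b wf; rewrite IHa mulr0 => /eqP.
by rewrite mulf_eq0 pnatr_eq0 => /eqP.
Qed.

Lemma weakly_holomorphic_zexp k : weakly_holomorphic (fun p => z p ^+ k).
Proof.
split; last by move=> phi; exact: zexp_weakly_holomorphic.
by apply: smooth_cintegrable => n; apply: class_C_exp; exact: class_C_zcoord.
Qed.

(** The constant 1 is weakly holomorphic, so the moment recurrence evaluates these integrals from
    the area pi alone; the case a < b follows by conjugation. *)
Lemma integral_zmonom a b : cintegral area disk (fun p => z p ^+ a * (z p)^* ^+ b) =
  if a == b then (pi / a.+1%:R)%:C else 0.
Proof.
have w1 := weakly_holomorphic_zexp 0.
have E i j : cintegral area disk (fun p => z p ^+ i * (z p)^* ^+ j) =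
    moment (fun p => z p ^+ 0) i j.
  by apply: eq_cintegral => p _; rewrite expr0 mul1r.
have [ab|ab|->] := ltngtP a b; last 1 first.
- elim: b => [|b IHb].
    rewrite divr1; under eq_cintegral do rewrite !expr0 mul1r.
    have cstE (r : R) : \int[area]_(_ in disk) r = r * pi.
      rewrite Rintegral_cst; last exact: measurable_disk.
      by rewrite [Measure.sort _ _]area_disk.
    by rewrite /cintegral /= !cstE mul1r mul0r.
  move: (moment_SS b b w1); rewrite -!E IHb => h.
  apply: (mulfI (x := b.+2%:R)); first by rewrite pnatr_eq0.
  rewrite h; have n1 : b.+1%:R != 0 :> R by rewrite pnatr_eq0.
  have n2 : b.+2%:R != 0 :> R by rewrite pnatr_eq0.
  by rewrite -!(rmorph_nat (real_complex R)) -!rmorphM /=; congr (_%:C);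
    rewrite !(mulrCA _ pi) !divff.
- have := moment_lt w1 ab; rewrite -E => h.
  rewrite -[LHS]conjCK -cintegral_conj; last 2 first.
  + exact: measurable_disk.
  + exact/smooth_cintegrable/smooth_zmonom.
  rewrite -[RHS]conjC0 -h; congr (_^*); apply: eq_cintegral => p _.
  by rewrite rmorphM !rmorphXn /= conjCK mulrC.
- by rewrite E moment_lt.
Qed.

(* [disk_poly l p] is the coefficient of [exp(2 i l theta)] in [v_(l+p)]. *)
Fixpoint disk_poly (l : nat) : nat -> R * R -> C :=
  fix disk_poly_l (p : nat) : R * R -> C := fun q =>
  match l, p with
  | 0, _ => (- z q) ^+ p
  | _, 0 => (z q)^* ^+ l
  | l'.+1, p'.+1 =>
      (z q)^* * disk_poly l' p q - z q * disk_poly_l p' q + disk_poly l' p' q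
  end.

Lemma disk_poly0p p q : disk_poly 0 p q = (- z q) ^+ p.
Proof. by case: p. Qed.

Lemma disk_polyl0 l q : disk_poly l 0 q = (z q)^* ^+ l.
Proof. by case: l => //; rewrite disk_poly0p !expr0. Qed.

(** Comparison of the coefficients of E^(l+1) in v_(l+p+2) = T v_(l+p+1) + E v_(l+p). *)
Lemma disk_polySS l p q : disk_poly l.+1 p.+1 q =
  (z q)^* * disk_poly l p.+1 q - z q * disk_poly l.+1 p q + disk_poly l p q.
Proof. by []. Qed.

Lemma smooth_disk_poly l p : smooth (disk_poly l p).
Proof.
elim: l p => [|l IHl] p.
  rewrite (_ : disk_poly 0 p = (fun q => (-1) ^+ p * z q ^+ p)).
    apply: smooth_mul; first exact: smooth_cst.
    by move=> n; apply: class_C_exp; exact: class_C_zcoord.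
  by apply/funext => q; rewrite disk_poly0p [LHS]exprNn.
have sz : smooth z by move=> n; exact: class_C_zcoord.
have sc : smooth (fun q => (z q)^*) by move=> n; exact: class_C_zconj.
elim: p => [|p IHp].
  rewrite (_ : disk_poly _ 0 = (fun q => (z q)^* ^+ l.+1)).
    by move=> n; apply: class_C_exp.
  by apply/funext => q; rewrite disk_polyl0.
rewrite (_ : disk_poly _ _ = (fun q => ((z q)^* * disk_poly l p.+1 q +
   (-1) * (z q * disk_poly l.+1 p q)) + disk_poly l p q)); last first.
  by apply/funext => q; rewrite disk_polySS mulN1r.
apply: smooth_add => //; apply: smooth_add; first exact: smooth_mul.
by apply: smooth_mul; [exact: smooth_cst|exact: smooth_mul].
Qed.

(** The closed form satisfies the recurrence of [disk_poly]; the induction is on l and, inside, on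
    p. The falling factorial [a ^_ l] is the point of the formula: it vanishes for a < l, so with a
    = 0 the coefficient of E^l, l >= 1, is orthogonal to every power of z. *)
Lemma integral_disk_poly l p a b :
  cintegral area disk (fun q => disk_poly l p q * (z q ^+ a * (z q)^* ^+ b)) =
  if (a + p == b + l)%N
  then ((-1) ^+ p * pi * (a ^_ l)%:R * b`!%:R / (a + p).+1`!%:R)%:C else 0.
Proof.
have md := @measurable_disk R.
have fn0 n : n`!%:R != 0 :> R by rewrite pnatr_eq0 -lt0n fact_gt0.
have ii l0 p0 a0 b0 : cintegrable area disk
    (fun q : R2 => disk_poly l0 p0 q * (z q ^+ a0 * (z q)^* ^+ b0)).
  apply: smooth_cintegrable; apply: smooth_mul; first exact: smooth_disk_poly.
  exact: smooth_zmonom.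
elim: l p a b => [|l IHl] p a b.
  rewrite (eq_cintegral (fun q : R2 => (-1) ^+ p * (z q ^+ (a + p) * (z q)^* ^+ b)));
    last by move=> q _; rewrite disk_poly0p [(- z q) ^+ _]exprNn exprD; ring.
  rewrite cintegralZ//; last exact/smooth_cintegrable/smooth_zmonom.
  rewrite integral_zmonom addn0; case: eqP => [<-|]; last by rewrite mulr0.
  rewrite -(rmorphN1 (real_complex R)) -rmorphXn -rmorphM /=; congr (_%:C).
  rewrite ffactn0 factS natrM; field.
  by rewrite fn0 -natrD nat1r pnatr_eq0.
elim: p a b => [|p IHp] a b.
  rewrite (eq_cintegral (fun q : R2 => (z q ^+ a * (z q)^* ^+ (b + l.+1)))); last first.
    by move=> q _; rewrite disk_polyl0 exprD; ring.
  rewrite integral_zmonom addn0; case: eqP => // ->; congr (_%:C).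
  rewrite expr0 mul1r -[pi * _ * _]mulrA -natrM.
  have -> : ((b + l.+1) ^_ l.+1 * b`! = (b + l.+1)`!)%N.
    by rewrite -[in b`!](addnK l.+1 b) ffact_fact// leq_addl.
  move: (b + l.+1)%N => c; rewrite factS natrM; field.
  by rewrite fn0 nat1r pnatr_eq0.
rewrite (eq_cintegral (fun q : R2 =>
  disk_poly l p.+1 q * (z q ^+ a * (z q)^* ^+ b.+1) -
  disk_poly l.+1 p q * (z q ^+ a.+1 * (z q)^* ^+ b) +
  disk_poly l p q * (z q ^+ a * (z q)^* ^+ b))); last first.
  by move=> q _; rewrite disk_polySS !exprS; ring.
rewrite (cintegralD md (cintegrableB md (ii _ _ _ _) (ii _ _ _ _)) (ii _ _ _ _)).
rewrite (cintegralB md (ii _ _ _ _) (ii _ _ _ _)) !IHl IHp.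
rewrite !addnS !addSn !eqSS; case: eqP => [E|]; last by rewrite subr0 addr0.
rewrite -rmorphB -rmorphD /=; congr (_%:C).
have E' : a%:R + p%:R = b%:R + l%:R :> R by rewrite -!natrD E.
(* This holds for l > a as well, both sides being 0. *)
have ff : (a ^_ l.+1)%:R = (a ^_ l)%:R * (a%:R - l%:R) :> R.
  rewrite ffactnSr natrM; have [la|la] := leqP l a; first by rewrite natrB.
  by rewrite ffact_small// !mul0r.
rewrite ffactSS ff natrM !factS !natrM exprS.
have -> : l%:R = a%:R + p%:R - b%:R :> R by rewrite E'; ring.
rewrite -!natr1 natrD; field.
by rewrite fn0 -natrD natr1 natr1 !pnatr_eq0.
Qed.

End Moments.
Arguments disk_poly {R} l p q : simpl never.

(** * Transport along chords *)

Section Transport.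
Context {R : realType}.
Local Notation C := R[i].
Local Notation z := (@zcoord R).

(* The closed form of [v_j]; see [chord_funSS] for the recurrence. *)
Definition chord_fun (j : nat) (q : (R * R) * R) : C :=
  \sum_(l < j.+1) (expi q.2 ^+ 2) ^+ l * disk_poly l (j - l) q.1.

Definition chord_invariant (q : (R * R) * R) : C :=
  (z q.1)^* * expi q.2 ^+ 2 - z q.1.

Lemma chord_fun0 q : chord_fun 0 q = 1.
Proof. by rewrite /chord_fun big_ord1 expr0 mul1r disk_poly0p expr0. Qed.

Lemma chord_fun1 q : chord_fun 1 q = chord_invariant q.
Proof.
rewrite /chord_fun 2!big_ord_recl big_ord0 addr0 /= expr0 expr1 mul1r.
by rewrite disk_poly0p disk_polyl0 expr1 [bump _ _]/= expr1 addrC mulrC.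
Qed.

(** The terms in E^0 and E^(j+2) are set apart; the others match by the recurrence of
    [disk_poly]. *)
Lemma chord_funSS j q : chord_fun j.+2 q =
  chord_invariant q * chord_fun j.+1 q + expi q.2 ^+ 2 * chord_fun j q.
Proof.
rewrite /chord_invariant; set E := expi q.2 ^+ 2; set c := (z q.1)^*.
rewrite /chord_fun -/E; set p := q.1.
pose S1 := \sum_(i < j.+1) E ^+ i * disk_poly i (j.+1 - i) p.
pose S2 := \sum_(i < j.+1) E ^+ i.+1 * disk_poly i.+1 (j - i) p.
pose S3 := \sum_(i < j.+1) E ^+ i * disk_poly i (j - i) p.
have h1 : \sum_(i < j.+1) E ^+ i.+1 * disk_poly i.+1 (j.+1 - i) p =
    c * E * S1 - z p * S2 + E * S3.
  rewrite !mulr_sumr -sumrB -big_split /=; apply: eq_bigr => i _.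
  have -> : (j.+1 - i = (j - i).+1)%N by rewrite subSn// -ltnS.
  by rewrite disk_polySS exprS; ring.
rewrite big_ord_recl big_ord_recr /= subn0 expr0 mul1r disk_poly0p.
rewrite mulrBl [X in c * E * X]big_ord_recr [X in z p * X]big_ord_recl /=.
rewrite subn0 expr0 mul1r disk_poly0p /bump /= !add1n !subnn !disk_polyl0.
under eq_bigr do rewrite add1n subSS.
under [X in z p * (_ + X)]eq_bigr do rewrite add1n subSS.
by rewrite h1 -/S1 -/S2 -/S3 !exprS; ring.
Qed.

(** By its recurrence [chord_fun] is a polynomial in E and T alone, although its definition involves
    z and conj z separately. *)
Lemma chord_fun_ext j q q' : expi q.2 = expi q'.2 ->
  chord_invariant q = chord_invariant q' -> chord_fun j q = chord_fun j q'.
Proof.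
move=> eE eT.
suff [] : chord_fun j q = chord_fun j q' /\ chord_fun j.+1 q = chord_fun j.+1 q' by [].
elim: j => [|j [IH1 IH2]]; first by rewrite !chord_fun0 !chord_fun1.
by split=> //; rewrite !chord_funSS IH1 IH2 eE eT.
Qed.

Lemma expi_mul_conj (t : R) : (expi t)^* * expi t = 1.
Proof.
by rewrite [_^*]expi_conj mulrC expiNK.
Qed.

(** A move by t along e = exp(i theta) adds t conj(e) e^2 - t e = 0 to T. *)
Lemma chord_fun_line j p t th :
  chord_fun j (p + t *: dir th, th) = chord_fun j (p, th).
Proof.
apply: chord_fun_ext => //; rewrite /chord_invariant /=.
have -> : z (p + t *: dir th) = z p + t%:C * expi th.
  by apply: complex_eqP => /=; rewrite /GRing.scale /=; ring.
have tc : (t%:C)^* = t%:C :> C by apply: complex_eqP => //=; rewrite oppr0.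
rewrite rmorphD rmorphM /= tc expr2.
have := expi_mul_conj th; set e := expi th; set e' := _^* => ee.
rewrite (_ : _ - _ = (z p)^* * (e * e) - z p + t%:C * e * (e' * e - 1)); last by ring.
by rewrite ee subrr mulr0 addr0.
Qed.

(* [sine_coord] is [sin alpha] for the chord through the point, by
   [sine_coord_boundary]. *)
Definition sine_coord (q : (R * R) * R) : R := q.1.2 * cos q.2 - q.1.1 * sin q.2.

Lemma sine_coord_line p t th : sine_coord (p + t *: dir th, th) = sine_coord (p, th).
Proof. by rewrite /sine_coord /= /GRing.scale /=; ring. Qed.

(** The two squares are those of the components of p normal and parallel to the direction; in
    particular |[sine_coord]| < 1 over the open disc. *)
Lemma sine_coord_sqr p th : sine_coord (p, th) ^+ 2 +
  (p.1 * cos th + p.2 * sin th) ^+ 2 = p.1 ^+ 2 + p.2 ^+ 2.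
Proof.
rewrite /sine_coord /=.
rewrite (_ : _ + _ = (p.1 ^+ 2 + p.2 ^+ 2) * (cos th ^+ 2 + sin th ^+ 2)); last by ring.
by rewrite cos2Dsin2 mulr1.
Qed.

Lemma sine_coord_boundary b a : sine_coord (dir b, b + pi + a) = sin a :> R.
Proof.
rewrite /sine_coord /= addrAC sinDpi cosDpi sinD cosD.
have := cos2Dsin2 b => h.
rewrite (_ : _ - _ = sin a * (cos b ^+ 2 + sin b ^+ 2)); last by ring.
by rewrite h mulr1.
Qed.

(* The value 0 is forced on the tangent lines by the convention in [divcos]. *)
Definition u'_transport k (q : (R * R) * R) : C :=
  if sine_coord q ^+ 2 == 1 then 0 else (Num.sqrt 2 / pi)%:C * chord_fun k q.

Lemma u'_transport_line k p t th :
  u'_transport k (p + t *: dir th, th) = u'_transport k (p, th).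
Proof. by rewrite /u'_transport sine_coord_line chord_fun_line. Qed.

(** With x = B A^2 and y = - B one has T = x + y and E = - x y, hence v_j = (x^(j+1) - y^(j+1)) / (x
    - y). The identity is multiplied out because x - y vanishes at tangential directions. *)
Lemma chord_fun_boundary j (b a : R) :
  let B := expi b in let A := expi a in
  chord_fun j (dir b, b + pi + a) * (B * (A ^+ 2 + 1)) =
  B ^+ j.+1 * (A ^+ j.+1 ^+ 2 + (-1) ^+ j).
Proof.
move=> B A.
have eE : expi (b + pi + a) ^+ 2 = B ^+ 2 * A ^+ 2.
  have epi : expi (pi : R) = -1.
    by apply: complex_eqP => /=; rewrite ?cospi ?sinpi ?oppr0.
  by rewrite expiD (expiD b) epi -/B -/A; ring.
have eT : chord_invariant (dir b, b + pi + a) = B * A ^+ 2 - B.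
  rewrite /chord_invariant /= eE (_ : z (dir b) = B)//.
  by rewrite expr2 !mulrA expi_mul_conj mul1r.
suff [] : chord_fun j (dir b, b + pi + a) * (B * (A ^+ 2 + 1)) =
    B ^+ j.+1 * (A ^+ j.+1 ^+ 2 + (-1) ^+ j) /\
  chord_fun j.+1 (dir b, b + pi + a) * (B * (A ^+ 2 + 1)) =
    B ^+ j.+2 * (A ^+ j.+2 ^+ 2 + (-1) ^+ j.+1) by [].
elim: j => [|j [IH1 IH2]].
  by rewrite chord_fun0 chord_fun1 eT; split; ring.
split=> //; rewrite chord_funSS eE eT [LHS]mulrDl -[X in X + _]mulrA IH2.
by rewrite -[X in _ + X]mulrA IH1 !exprS; ring.
Qed.

Lemma transport_solution_u' k : transport_solution (divcos (@u' R k)) (u'_transport k).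
Proof.
split; [split|].
- move=> p th _.
  have d (g : C -> R) : is_derive p (dir th) (fun q => g (u'_transport k (q, th))) 0.
    apply/is_derive_line.
    rewrite (_ : (fun h => _) = (fun=> g (u'_transport k (p, th)))).
      exact: is_derive_const.
    by apply/funext => h; rewrite addrC u'_transport_line.
  split; first by split; [case: (d (@complex.Re R))|case: (d (@complex.Im R))].
  by apply: complex_eqP; [case: (d (@complex.Re R))|case: (d (@complex.Im R))].
- move=> p th _.
  have E : (fun t => u'_transport k (p + t *: dir th, th)) =
      (fun=> u'_transport k (p, th)).
    by apply/funext => t; rewrite u'_transport_line.
  by rewrite E; split; apply: continuous_subspaceT => t; exact: cvg_cst.
- move=> b a _; rewrite /u'_transport sine_coord_boundary /divcos /= sin2cos2.
  rewrite (_ : (1 - cos a ^+ 2 == 1) = (cos a == 0)); last first.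
    by rewrite -subr_eq0 addrAC subrr sub0r oppr_eq0 sqrf_eq0.
  (* Tangential directions: the division by 0 in [divcos] gives 0, the value chosen for
     [u'_transport]. *)
  have [->|ca] := eqVneq (cos a) 0.
    by rewrite rmorph0 invr0 mulr0.
  have := chord_fun_boundary k b a; rewrite /=.
  set V := chord_fun _ _; set B := expi b; set A := expi a => h.
  have BB : B * expi (- b) = 1 by exact: expiNK.
  have AA : A * expi (- a) = 1 by exact: expiNK.
  have AE : A ^+ k.*2.+1 = A * (A ^+ k) ^+ 2 by rewrite exprS -muln2 exprM.
  (* The boundary identity divided by B A. *)
  have {}h : V * (A + expi (- a)) =
      B ^+ k * (A ^+ k.*2.+1 + (-1) ^+ k * expi (- a)).
    rewrite -[LHS]mulr1 -[1]mulr1 -{1}BB -AA.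
    transitivity (V * (B * (A ^+ 2 + 1)) * (expi (- b) * expi (- a)) *
       (A * expi (- a)) + V * B * expi (- b) * A * (A * expi (- a)) *
       (1 - A * expi (- a))); first by ring.
    rewrite AA subrr mulr0 addr0 mulr1 h AE.
    transitivity (B ^+ k * (B * expi (- b)) *
      (A * (A ^+ k) ^+ 2 * (A * expi (- a)) + (-1) ^+ k * expi (- a))).
      by rewrite !exprS; ring.
    by rewrite BB AA !mulr1.
  have c2 : A + expi (- a) = 2 * (cos a)%:C.
    by apply: complex_eqP => /=; rewrite ?cosN ?sinN; ring.
  have cn : (cos a)%:C != 0 :> C
    by rewrite -(rmorph0 (real_complex R)) (inj_eq (@complexI R)).
  apply: (mulIf cn); rewrite divfK// /u' /= !expiMn -mulrA -h c2.
  have s2 : Num.sqrt 2 ^+ 2 = 2 :> R by rewrite sqr_sqrtr.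
  have s0 : Num.sqrt 2 != 0 :> R by rewrite sqrtr_eq0 -ltNge.
  have p0 : pi != 0 :> R by rewrite gt_eqF// pi_gt0.
  (* Used with x = sqrt 2 and y = pi: the 2 in 2 cos alpha turns the constant (pi sqrt 2)^-1 of [u']
     into sqrt 2 / pi. *)
  have gen (x y : R) : x != 0 -> y != 0 -> x / y = (y * x)^-1 * x ^+ 2.
    by move=> x0 y0; field; rewrite x0 y0.
  rewrite (gen _ _ s0 p0).
  by rewrite s2 rmorphM /= rmorph_nat; ring.
Qed.

(* The point where the oriented line through [p] enters the disc: a transport
   solution is constant from there to [p]. *)
Lemma chord_entry (p : R * R) (th : R) : open_disk p -> exists b a : R,
  - (pi / 2) <= a <= pi / 2 /\
  forall (h : R * R -> C) u, transport_solution h u -> u (p, th) = h (b, a).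
Proof.
move=> pd; set s := sine_coord (p, th).
pose m := p.1 * cos th + p.2 * sin th.
have sm : s ^+ 2 + m ^+ 2 < 1 by rewrite sine_coord_sqr.
have s1 : -1 <= s <= 1.
  rewrite -ler_norml -(expr_le1 (ltn0Sn 1))// real_normK ?num_real//.
  by have := sqr_ge0 m; lra.
(* Inversion of the fan-beam relations sin alpha = [sine_coord] and theta = beta + pi + alpha. *)
pose a := asin s; pose b := th - pi - a.
have arange : - (pi / 2) <= a <= pi / 2 by rewrite asin_geNpi2 ?asin_lepi2.
have sa : sin a = s by rewrite asinK// in_itv.
have ca0 : 0 <= cos a by exact: cos_ge0_pihalf.
have ca : cos a ^+ 2 = 1 - s ^+ 2 by rewrite cos2sin2 sa.
have cs := cos2Dsin2 th.
have thE : th = b + pi + a by rewrite /b; ring.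
have cb : cos b = - (cos th * cos a + sin th * s).
  by rewrite /b addrAC -[LHS]opprK -cosDpi subrK cosB sa.
have sb : sin b = - (sin th * cos a - cos th * s).
  by rewrite /b addrAC -[LHS]opprK -sinDpi subrK sinB sa.
(* m is the abscissa of p on its line, counted from the midpoint of the chord, whose length is 2 cos
   a; so tau is the distance from the entry point to p. *)
pose tau := m + cos a.
have tau0 : 0 < tau.
  rewrite /tau; case: (lerP 0 m) => m0.
    apply: ltr_wpDl => //; rewrite lt_neqAle ca0 andbT; apply/eqP => c0.
    by move: ca; rewrite -c0 expr0n/=; have := sqr_ge0 m; lra.
  rewrite -ltrBlDl sub0r -(ltr_pXn2r (ltn0Sn 1)) ?nnegrE ?oppr_ge0 ?(ltW m0)//.
  by rewrite sqrrN ca; lra.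
have tau2 : tau < 2 * cos a.
  rewrite /tau; suff : m < cos a by lra.
  case: (ltrP m 0) => mN; first exact: lt_le_trans ca0.
  by rewrite -(ltr_pXn2r (ltn0Sn 1)) ?nnegrE// ca; lra.
have lineE (t : R) : (dir b + t *: dir th).1 ^+ 2 + (dir b + t *: dir th).2 ^+ 2 =
    1 - t * (2 * cos a - t).
  rewrite /= /GRing.scale /= cb sb.
  transitivity ((cos a ^+ 2 + s ^+ 2 - t * (2 * cos a - t)) *
    (cos th ^+ 2 + sin th ^+ 2)); first by ring.
  by rewrite cs ca; ring.
have pE : p = dir b + tau *: dir th.
  have ext (x y : R * R) : x.1 = y.1 -> x.2 = y.2 -> x = y.
    by case: x y => [? ?] [? ?] /= -> ->.
  apply: ext; rewrite /= /GRing.scale /= ?cb ?sb /tau /m /s /sine_coord /=.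
    by rewrite -[LHS]mulr1 -cs; ring.
  by rewrite -[LHS]mulr1 -cs; ring.
exists b, a; split=> // h u [[Xd Xc] hb].
rewrite -(hb _ _ arange) -thE {1}pE.
pose q t := dir b + t *: dir th.
have qd t : 0 <= t <= tau -> disk (q t).
  move=> /andP[t0 t1]; rewrite /disk /= -/(q t) lineE.
  rewrite gerBl mulr_ge0//; lra.
have qo t : 0 < t < tau -> open_disk (q t).
  move=> /andP[t0 t1]; rewrite /open_disk /= -/(q t) lineE.
  rewrite gtrBl mulr_gt0//; lra.
(* Mean value theorem on [0, tau]. At 0 the point is on the circle, where [X_null] provides only
   continuity along the chord. *)
have key (g : C -> R) :
    (forall p, open_disk p -> is_derive p (dir th) (fun q => g (u (q, th))) 0) ->
    {within [set t : R | disk (dir b + t *: dir th)],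
       continuous (fun t => g (u (dir b + t *: dir th, th)))} ->
    g (u (q tau, th)) = g (u (dir b, th)).
  move=> gd gc.
  have [] := @MVT _ (fun t => g (u (q t, th))) (fun=> 0) 0 tau tau0.
  - move=> t; rewrite in_itv/= => tt.
    have := gd _ (qo t tt) => /is_derive_line d; apply/is_derive_line.
    move: d; congr (is_derive _ _ _ _); apply/funext => r; congr (g (u (_, _))).
    rewrite /q [r *: 1]mulr1 scalerDl.
    by rewrite addrCA.
  - apply: continuous_subspaceW gc => t /=; rewrite in_itv/=; exact: qd.
  - move=> t _; rewrite mul0r => /eqP; rewrite subr_eq0 => /eqP ->.
    by rewrite /q scale0r addr0.
have db : disk (dir b) by rewrite /disk /= cos2Dsin2.
have [c1 c2] := Xc _ th db.
apply: complex_eqP.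
- apply: key => // r ro; have [[d1 d2] /(congr1 (@complex.Re R)) /= d0] := Xd r th ro.
  by have := derivableP d1; rewrite d0.
- apply: key => // r ro; have [[d1 d2] /(congr1 (@complex.Im R)) /= d0] := Xd r th ro.
  by have := derivableP d2; rewrite d0.
Qed.

(** [psi] selects an unspecified transport solution. One exists, [u'_transport], and by
    [chord_entry] all of them agree over the open disc, where the tangential default does not
    occur. *)
Lemma psi_divcos_u' k p th : open_disk p ->
  psi (divcos (@u' R k)) (p, th) = (Num.sqrt 2 / pi)%:C * chord_fun k (p, th).
Proof.
move=> pd; have [b [a [ab uniq_u]]] := chord_entry th pd.
have sol := transport_solution_u' k.
have psol : transport_solution (divcos (@u' R k)) (psi (divcos (@u' R k))).
  by apply: xgetPex; exists (u'_transport k).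
rewrite (uniq_u _ _ psol) -(uniq_u _ _ sol) /u'_transport ifF//.
apply/negbTE; rewrite lt_eqF//; apply: le_lt_trans pd.
by rewrite -(sine_coord_sqr p th) lerDl sqr_ge0.
Qed.

End Transport.

(** * Integrals of products of functions of separate variables *)

Section ProductIntegral.
Context d1 d2 (T1 : measurableType d1) (T2 : measurableType d2) (R : realType).
Variables (m1 : {sigma_finite_measure set T1 -> \bar R}).
Variables (m2 : {sigma_finite_measure set T2 -> \bar R}).
Variables (D1 : set T1) (D2 : set T2).
Hypotheses (mD1 : measurable D1) (mD2 : measurable D2).
Local Notation C := R[i].

Section RealCase.
Variables (f : T1 -> R) (g : T2 -> R).
Hypotheses (fi : m1.-integrable D1 (EFin \o f)).
Hypotheses (gi : m2.-integrable D2 (EFin \o g)).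

Let f' := f \_ D1.
Let g' := g \_ D2.

Let fi' : m1.-integrable setT (EFin \o f').
Proof. by move/(integrable_mkcond _ mD1) : fi; rewrite restrict_EFin. Qed.

Let gi' : m2.-integrable setT (EFin \o g').
Proof. by move/(integrable_mkcond _ mD2) : gi; rewrite restrict_EFin. Qed.

Let prodE : (fun q : T1 * T2 => f q.1 * g q.2) \_ (D1 `*` D2) =
  (fun q => f' q.1 * g' q.2).
Proof.
apply/funext => q; rewrite /f' /g' !patchE in_setX.
by case: (q.1 \in D1); case: (q.2 \in D2); rewrite /= ?mul0r ?mulr0.
Qed.

Let prod_integrable :
  (m1 \x m2)%E.-integrable setT (EFin \o (fun q : T1 * T2 => f' q.1 * g' q.2)).
Proof.
have mf := measurable_int _ fi'; have mg := measurable_int _ gi'.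
apply/integrable12ltyP.
  apply/measurable_EFinP; apply: measurable_funM.
    by apply: measurableT_comp; [exact/measurable_EFinP|exact: measurable_fst].
  by apply: measurableT_comp; [exact/measurable_EFinP|exact: measurable_snd].
have [_ ff] := integrableP _ _ _ fi'; have [_ gg] := integrableP _ _ _ gi'.
under eq_integral do under eq_integral do rewrite /= normrM EFinM.
under eq_integral => x _.
  rewrite ge0_integralZl//; last first.
    by apply/measurable_EFinP/measurableT_comp => //; exact/measurable_EFinP.
  over.
rewrite /= ge0_integralZr//; last 2 first.
- by apply/measurable_EFinP/measurableT_comp => //; exact/measurable_EFinP.
- exact: integral_ge0.
by rewrite lte_mul_pinfty// ?integral_ge0// ge0_fin_numE// integral_ge0.
Qed.

Lemma integrable_prod : (m1 \x m2)%E.-integrable (D1 `*` D2)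
  (EFin \o (fun q : T1 * T2 => f q.1 * g q.2)).
Proof.
apply/(integrable_mkcond _ (measurableX mD1 mD2)).
by rewrite restrict_EFin prodE.
Qed.

Lemma Rintegral_prod :
  \int[(m1 \x m2)%E]_(q in D1 `*` D2) (f q.1 * g q.2) =
  \int[m1]_(x in D1) f x * \int[m2]_(y in D2) g y.
Proof.
rewrite Rintegral_mkcond prodE (Rintegral_mkcond _ D1) (Rintegral_mkcond _ D2).
rewrite -/f' -/g' {1}/Rintegral -(integral12_prod_meas1 prod_integrable).
have B : (\int[m2]_y (g' y)%:E)%E \is a fin_num by exact: integrable_fin_num.
have A : (\int[m1]_x (f' x)%:E)%E \is a fin_num by exact: integrable_fin_num.
under eq_integral => x _.
  rewrite /fubini_F /=; under eq_integral do rewrite EFinM.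
  rewrite integralZl// -(fineK B); over.
by rewrite integralZr// -(fineK A).
Qed.

End RealCase.

Lemma cintegrable_prod (f : T1 -> C) (g : T2 -> C) :
  cintegrable m1 D1 f -> cintegrable m2 D2 g ->
  cintegrable (m1 \x m2)%E (D1 `*` D2) (fun q : T1 * T2 => f q.1 * g q.2).
Proof.
move=> [f1 f2] [g1 g2]; have mD := measurableX mD1 mD2; split.
- rewrite (_ : _ \o _ =
    ((EFin \o (fun q : T1 * T2 => (complex.Re (f q.1) * complex.Re (g q.2))%R)) \-
     (EFin \o (fun q : T1 * T2 => (complex.Im (f q.1) * complex.Im (g q.2))%R)))%E).
    by have := integrableB mD (integrable_prod f1 g1) (integrable_prod f2 g2); exact.
  by apply/funext => q /=; rewrite ReM EFinB.
- rewrite (_ : _ \o _ =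
    ((EFin \o (fun q : T1 * T2 => (complex.Re (f q.1) * complex.Im (g q.2))%R)) \+
     (EFin \o (fun q : T1 * T2 => (complex.Im (f q.1) * complex.Re (g q.2))%R)))%E).
    by have := integrableD mD (integrable_prod f1 g2) (integrable_prod f2 g1); exact.
  by apply/funext => q /=; rewrite ImM EFinD.
Qed.

Lemma cintegral_prod (f : T1 -> C) (g : T2 -> C) :
  cintegrable m1 D1 f -> cintegrable m2 D2 g ->
  cintegral (m1 \x m2)%E (D1 `*` D2) (fun q : T1 * T2 => f q.1 * g q.2) =
  cintegral m1 D1 f * cintegral m2 D2 g.
Proof.
move=> [f1 f2] [g1 g2]; have mD := measurableX mD1 mD2.
have E1 := Rintegral_prod f1 g1; have E2 := Rintegral_prod f2 g2.
have E3 := Rintegral_prod f1 g2; have E4 := Rintegral_prod f2 g1.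
apply: complex_eqP.
- rewrite ReM -[LHS]/(\int[(m1 \x m2)%E]_(q in D1 `*` D2) complex.Re (f q.1 * g q.2)).
  under eq_Rintegral do rewrite ReM.
  by rewrite (RintegralB mD (integrable_prod f1 g1) (integrable_prod f2 g2)) E1 E2.
- rewrite ImM -[LHS]/(\int[(m1 \x m2)%E]_(q in D1 `*` D2) complex.Im (f q.1 * g q.2)).
  under eq_Rintegral do rewrite ImM.
  by rewrite (RintegralD mD (integrable_prod f1 g2) (integrable_prod f2 g1)) E3 E4.
Qed.

End ProductIntegral.

Section SphereBundle.
Context {R : realType}.
Local Notation C := R[i].
Local Notation RT := (measurableTypeR R).
Local Notation R2 := (RT * RT)%type.
Local Notation mu := (@lebesgue_measure R).
Local Notation area := (@area R).
Local Notation disk := (@disk R : set R2).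
Local Notation circle := (@circle R : set RT).

Lemma sigma_finite_area : sigma_finite setT area.
Proof.
pose F n : set R2 := `[(- n%:R : R), n%:R] `*` `[(- n%:R : R), n%:R].
exists F.
  apply/seteqP; split=> // p _; pose N := maxn (Num.bound `|p.1|) (Num.bound `|p.2|).
  have h (x : R) k : (Num.bound `|x| <= k)%N -> - k%:R <= x <= k%:R.
    move=> xk; rewrite -ler_norml; apply: le_trans (ltW (archi_boundP (normr_ge0 x))) _.
    by rewrite ler_nat.
  exists N => //; split; rewrite /= in_itv/=; apply: h; rewrite /N ?leq_maxl//.
  exact: leq_maxr.
move=> n; split; first by apply: measurableX; exact: measurable_itv.
rewrite /Defs.area product_measure1E; [|exact: measurable_itv|exact: measurable_itv].
rewrite /= !lebesgue_measure_itv/=; case: ifP => _; last by rewrite mul0e ltry.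
by rewrite -EFinB -EFinM ltry.
Qed.

(** The plane measure packaged with its sigma-finiteness, so that Fubini applies to [volume], of
    which it is the first factor. *)
Definition area_sigma_finite : {sigma_finite_measure set R2 -> \bar R} :=
  let m := Measure_isSigmaFinite.Build _ R2 R (mu \x mu)%E sigma_finite_area in
  HB.pack_for (SigmaFiniteMeasure.type R2 R) (mu \x mu)%E m.

Lemma cintegral_SM_prod (f : R2 -> C) (g : RT -> C) :
  cintegrable area disk f -> cintegrable mu circle g ->
  cintegral (@volume R) (@SM R) (fun q => f q.1 * g q.2) =
  cintegral area disk f * cintegral mu circle g.
Proof.
exact: (@cintegral_prod _ _ _ _ _ area_sigma_finite mu disk circle
  (@measurable_disk R) (@measurable_circle R)).
Qed.

Lemma cintegrable_SM_prod (f : R2 -> C) (g : RT -> C) :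
  cintegrable area disk f -> cintegrable mu circle g ->
  cintegrable (@volume R) (@SM R) (fun q => f q.1 * g q.2).
Proof.
exact: (@cintegrable_prod _ _ _ _ _ area_sigma_finite mu disk circle
  (@measurable_disk R) (@measurable_circle R)).
Qed.

End SphereBundle.

(** * Harmonics in theta and pairings on SM *)

Section FiberAnalysis.
Context {R : realType}.
Local Notation C := R[i].
Local Notation RT := (measurableTypeR R).
Local Notation R2 := (RT * RT)%type.
Local Notation mu := (@lebesgue_measure R).
Local Notation area := (@area R).
Local Notation volume := (@volume R).
Local Notation disk := (@disk R : set R2).
Local Notation open_disk := (@open_disk R : set R2).
Local Notation circle := (@circle R : set RT).
Local Notation SM := (@SM R : set (R2 * RT)%type).
Local Notation z := (@zcoord R).

(** The part of [SM] over the boundary circle is null. Arbitrary integrands are allowed, since [psi]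
    is known over interior points only. *)
Lemma eq_cintegral_SM (f g : (R * R) * R -> C) :
  (forall p t, open_disk p -> f (p, t) = g (p, t)) ->
  cintegral volume SM f = cintegral volume SM g.
Proof.
move=> fg; pose N : set (R2 * RT) := (disk `\` open_disk) `*` circle.
have mN : measurable N.
  by apply: measurableX; [exact: measurable_unit_circle|exact: measurable_circle].
have N0 : volume N = 0%E.
  rewrite /Defs.volume product_measure1E; [|exact: measurable_unit_circle|
    exact: measurable_circle].
  by rewrite [X in (X * _)%E]area_unit_circle mul0e.
have fgN q : (SM `\` N) q -> f q = g q.
  case: q => p t [[/= pd tc] /= npN]; apply: fg.
  by apply: contrapT => po; apply: npN.
congr (_ +i* _); rewrite /Rintegral; congr fine;
  rewrite (integral_setD_null SM _ mN N0) [RHS](integral_setD_null SM _ mN N0);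
  by apply: eq_integral => q /[!inE] /fgN ->.
Qed.

Lemma cintegrable_expi (m : int) : cintegrable mu circle (fun t => expi (m%:~R * t)).
Proof.
apply: (@cintegrable_bounded _ _ _ mu circle _ 1).
- exact: measurable_circle.
- by rewrite [X in (X < _)%E]lebesgue_circle ltry.
- split; apply: (measurable_funS measurableT (@subsetT _ circle)).
    apply: continuous_measurable_fun.
    exact: is_derive_continuous (is_derive_cosZ m%:~R).
  apply: continuous_measurable_fun.
  exact: is_derive_continuous (is_derive_sinZ m%:~R).
- by move=> t _; rewrite normc_expi.
Qed.

Lemma expi_harmonic (m : int) (l : nat) (t : R) :
  expi (- (m%:~R * t)) * (expi t ^+ 2) ^+ l = expi (((l.*2)%:Z - m)%:~R * t).
Proof.
by rewrite -exprM -expiMn -expiD mul2n; congr expi; rewrite rmorphB /=; ring.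
Qed.

Lemma fiber_coef_psi (m : int) k p : open_disk p ->
  fiber_coef m (psi (divcos (@u' R k))) p = (Num.sqrt 2 / pi)%:C *
  \sum_(l < k.+1) (if (l.*2)%:Z == m then disk_poly l (k - l) p else 0).
Proof.
move=> pd; rewrite /fiber_coef /fiber_average.
set c := (Num.sqrt 2 / pi)%:C.
rewrite (eq_cintegral (fun t : RT => c * \sum_(l < k.+1)
    disk_poly l (k - l) p * expi (((l.*2)%:Z - m)%:~R * t))); last first.
  move=> t _; rewrite [(p, t).2]/= psi_divcos_u'// mulrCA; congr (_ * _).
  rewrite mulr_sumr; apply: eq_bigr => l _.
  by rewrite -expi_harmonic /=; ring.
have mc := @measurable_circle R.
have ie (l : 'I_k.+1) : cintegrable mu circle
    (fun t : RT => disk_poly l (k - l) p * expi (((l.*2)%:Z - m)%:~R * t)).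
  by apply: cintegrableZ => //; exact: cintegrable_expi.
rewrite (cintegralZ c mc (cintegrable_sum _ mc ie)) (cintegral_sum _ mc ie).
rewrite mulrCA; congr (_ * _); rewrite mulr_sumr; apply: eq_bigr => l _.
rewrite (cintegralZ _ mc (cintegrable_expi _)) cintegral_expi subr_eq0.
case: eqP => _; last by rewrite !mulr0.
have p0 : 2 * pi != 0 :> R by rewrite mulf_neq0// ?pnatr_eq0// gt_eqF// pi_gt0.
by rewrite mulrCA -rmorphM /= mulVf// rmorph1 mulr1.
Qed.

Lemma fiber_average_coef (u : (R * R) * R -> C) : fiber_average u = fiber_coef 0 u.
Proof.
rewrite /fiber_coef; congr fiber_average; apply/funext => q.
by rewrite mul0r oppr0 expi0 mul1r.
Qed.

(* [I_0^* u'_k = adj_factor k Z_k], the inverse of [W_factor k]. *)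
Definition adj_factor (k : nat) : C :=
  2 * (-1) ^+ k * ((Num.sqrt k.+1%:R)^-1)%:C.

Lemma I0adj_u' k p : open_disk p -> I0adj (@u' R k) p = adj_factor k * Z k p.
Proof.
move=> pd; rewrite /I0adj fiber_average_coef fiber_coef_psi// big_ord_recl.
(* The terms with l >= 1 are nonzero harmonics and average out. *)
rewrite big1// addr0 subn0 disk_poly0p [(- z p) ^+ k]exprNn /Z /adj_factor.
have s0 : Num.sqrt k.+1%:R != 0 :> R by rewrite sqrtr_eq0 -ltNge ltr0n.
have p0 : pi != 0 :> R by rewrite gt_eqF// pi_gt0.
have t0 : Num.sqrt 2 != 0 :> R by rewrite sqrtr_eq0 -ltNge.
have -> : Num.sqrt (k.+1%:R / (2 * pi ^+ 2)) =
    Num.sqrt k.+1%:R / (Num.sqrt 2 * pi) :> R.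
  have e : Num.sqrt (2 * pi ^+ 2) = Num.sqrt 2 * pi :> R.
    by rewrite sqrtrM// sqrtr_sqr ger0_norm// pi_ge0.
  have h : 0 <= 2 * pi ^+ 2 :> R by rewrite mulr_ge0// sqr_ge0.
  by rewrite sqrtrM ?ler0n// sqrtrV// e.
have gen (x y s : R) : x != 0 -> y != 0 -> s != 0 ->
    x / y = x ^+ 2 * s^-1 * (s / (x * y)).
  by move=> x0 y0 s'0; field; rewrite x0 y0 s'0.
rewrite (gen _ _ _ t0 p0 s0) sqr_sqrtr// !rmorphM /= rmorph_nat.
by ring.
Qed.

(** Integration in theta retains only the coefficient of E^l with 2 l = m, so that l >= 1. Its
    pairing with z^k is [integral_disk_poly] at a = 0, where the falling factorial vanishes. *)
Lemma innerSM_psi_eZ j (k : nat) (m : int) : 0 < m ->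
  innerSM (psi (divcos (@u' R j))) (eZ m k) = 0.
Proof.
move=> m0; rewrite /innerSM.
pose c := (Num.sqrt 2 / pi)%:C * (Num.sqrt (k.+1%:R / (2 * pi ^+ 2)))%:C : C.
rewrite (eq_cintegral_SM (g := fun q => \sum_(l < j.+1)
   (c * (disk_poly l (j - l) q.1 * (z q.1 ^+ 0 * (z q.1)^* ^+ k))) *
    expi (((l.*2)%:Z - m)%:~R * q.2))); last first.
  move=> p t pd; rewrite psi_divcos_u'// /chord_fun -mulrA mulr_suml mulr_sumr.
  apply: eq_bigr => l _; rewrite -expi_harmonic /eZ /Z /=.
  rewrite !rmorphM rmorphXn /= [(expi _)^*]expi_conj.
  have -> : ((Num.sqrt (k.+1%:R / (2 * pi ^+ 2)))%:C)^* =
    (Num.sqrt (k.+1%:R / (2 * pi ^+ 2)))%:C :> C.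
    by apply: complex_eqP => //=; rewrite oppr0.
  by rewrite expr0 /c; ring.
have md := @measurable_disk R.
have ip (l : 'I_j.+1) : cintegrable area disk (fun q : R2 =>
    c * (disk_poly l (j - l) q * (z q ^+ 0 * (z q)^* ^+ k))).
  apply: cintegrableZ => //; apply: smooth_cintegrable; apply: smooth_mul.
    exact: smooth_disk_poly.
  exact: smooth_zmonom.
have iSM (l : 'I_j.+1) := cintegrable_SM_prod (ip l)
  (cintegrable_expi ((l.*2)%:Z - m)).
have mSM : measurable SM.
  exact: measurableX md (@measurable_circle R).
rewrite (cintegral_sum _ mSM iSM) big1// => l _.
rewrite (cintegral_SM_prod (ip l) (cintegrable_expi _)) cintegral_expi subr_eq0.
case: eqP => lm; last by rewrite mulr0.
rewrite cintegralZ//; last first.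
  apply: smooth_cintegrable; apply: smooth_mul; first exact: smooth_disk_poly.
  exact: smooth_zmonom.
rewrite integral_disk_poly; case: ifP => _; last by rewrite mulr0 mul0r.
case: l lm {ip iSM} => [[|l] lj] lm; first by rewrite -lm in m0.
by rewrite /= ffact_small// mulr0 !mul0r mulr0 mul0r.
Qed.

(** The fibre contributes 2 pi, and (2 pi)^2 (k+1) / (2 pi^2) = 2 (k+1). *)
Lemma innerSM_lift (f : R * R -> C) k : cintegrable area disk (f : R2 -> C) ->
  innerSM (liftSM f) (liftSM (Z k)) =
  (Num.sqrt (2 * k.+1%:R))%:C * moment f 0 k.
Proof.
move=> fi; rewrite /innerSM.
have md := @measurable_disk R.
pose c := (Num.sqrt (k.+1%:R / (2 * pi ^+ 2)))%:C : C.
pose g := (fun p : R2 => c * (f p * (z p ^+ 0 * (z p)^* ^+ k))).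
have fm : cintegrable area disk (fun p : R2 => f p * (z p ^+ 0 * (z p)^* ^+ k)).
  exact: moment_integrable.
have gi : cintegrable area disk g by exact: cintegrableZ.
have i1 : cintegrable mu circle (fun t => expi (0%:~R * t)).
  exact: cintegrable_expi.
rewrite (eq_cintegral (fun q : (R2 * RT)%type => g q.1 * expi (0%:~R * q.2))); last first.
  move=> [p t] _; rewrite /liftSM /Z /g /= mul0r expi0 mulr1 rmorphM rmorphXn /=.
  have -> : ((Num.sqrt (k.+1%:R / (2 * pi ^+ 2)))%:C)^* = c :> C.
    by apply: complex_eqP => //=; rewrite oppr0.
  by rewrite expr0; ring.
rewrite (cintegral_SM_prod gi i1) cintegral_expi eqxx /g cintegralZ//.
rewrite /moment mulrAC; congr (_ * _).
rewrite -rmorphM; congr (_%:C).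
have p0 := pi_gt0 R.
have -> : 2 * k.+1%:R = k.+1%:R / (2 * pi ^+ 2) * (2 * pi) ^+ 2 :> R.
  have : pi != 0 :> R by rewrite gt_eqF.
  by move: (pi : R) (k.+1%:R : R) => x y x0; field.
have h : 0 <= k.+1%:R / (2 * pi ^+ 2) :> R.
  by rewrite divr_ge0// mulr_ge0// sqr_ge0.
by rewrite [RHS]sqrtrM// sqrtr_sqr ger0_norm// mulr_ge0// ltW.
Qed.

End FiberAnalysis.

(** * Determination by moments *)

Section RayApproximation.
Context {R : realType}.

(** Pointwise convergence with a uniform bound is what dominated convergence asks for; unlike
    uniform convergence it reaches indicators. *)
Definition poly_limit (g : R -> R) := exists (P : nat -> {poly R}) (M : R),
  (forall n t, `|t| <= 1 -> `|(P n).[t]| <= M) /\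
  (forall t, `|t| <= 1 -> (P n).[t] @[n --> \oo] --> g t).

Lemma poly_limit1 : poly_limit (fun=> 1).
Proof.
exists (fun=> 1), 1; split=> [n t _|t _]; first by rewrite hornerC normr1.
by under eq_fun do rewrite hornerC; exact: cvg_cst.
Qed.

(* The map [t |-> (3 t - t^3) / 2] fixes -1, 0, 1 and attracts ]0, 1] to 1. *)
Fixpoint sgn_poly (n : nat) : {poly R} :=
  if n is m.+1 then ((3 / 2) *: 'X - 2^-1 *: 'X^3) \Po sgn_poly m else 'X.

Lemma sgn_polyS n t : (sgn_poly n.+1).[t] =
  (sgn_poly n).[t] * (3 - (sgn_poly n).[t] ^+ 2) / 2.
Proof. by rewrite /= horner_comp !hornerE /=; field. Qed.

Lemma sgn_polyN n t : (sgn_poly n).[- t] = - (sgn_poly n).[t].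
Proof.
elim: n => [|n IHn]; first by rewrite /= !hornerX.
by rewrite !sgn_polyS IHn sqrrN mulNr mulNr.
Qed.

(** For the current value s, 1 - s (3 - s^2) / 2 = (1 - s) (1 - s (1 + s) / 2). As s >= t, the last
    factor is at most 1 - t / 2, whence the geometric rate. *)
Lemma sgn_poly_bounds n t : 0 <= t <= 1 ->
  t <= (sgn_poly n).[t] <= 1 /\ 1 - (sgn_poly n).[t] <= (1 - t / 2) ^+ n.
Proof.
move=> /andP[t0 t1]; elim: n => [|n [/andP[a b] c]].
  by rewrite /= hornerX lexx t1 expr0; split => //; lra.
rewrite sgn_polyS [_ ^+ n.+1]exprS; move: (_.[t]) a b c => s a b c.
have e : 1 - s * (3 - s ^+ 2) / 2 = (1 - s) * (1 - s * (1 + s) / 2) by field.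
have h1 : 0 <= s * (1 + s) / 2 by nra.
have h2 : 1 - s * (1 + s) / 2 <= 1 - t / 2 by nra.
have h3 : 0 <= s * (1 - s) * (1 + s) by rewrite !mulr_ge0//; lra.
have h4 : 0 <= (1 - s) * (1 - s * (1 + s) / 2) by rewrite mulr_ge0//; nra.
have E : s * (3 - s ^+ 2) / 2 = s + s * (1 - s) * (1 + s) / 2 by field.
split; first by apply/andP; split; [rewrite E; lra|rewrite -subr_ge0 e].
rewrite e mulrC; apply: (@le_trans _ _ ((1 - t / 2) * (1 - s))).
  by apply: ler_wpM2r => //; lra.
by apply: ler_wpM2l => //; lra.
Qed.

Lemma sgn_poly_le1 n t : `|t| <= 1 -> `|(sgn_poly n).[t]| <= 1.
Proof.
move=> t1; wlog t0 : t t1 / 0 <= t => [h|].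
  have [/h->//|/ltW tn] := leP 0 t.
  by rewrite -normrN -sgn_polyN h ?normrN// oppr_ge0.
have [|/andP[a b] _] := @sgn_poly_bounds n t; first by rewrite t0 -(ger0_norm t0).
by rewrite ger0_norm// (le_trans t0).
Qed.

Lemma sgn_poly_cvg t : 0 < t <= 1 -> (sgn_poly n).[t] @[n --> \oo] --> (1 : R).
Proof.
move=> /andP[t0 t1].
have B n : 1 - (1 - t / 2) ^+ n <= (sgn_poly n).[t] <= 1.
  have [|/andP[_ ->] h] := @sgn_poly_bounds n t; first by rewrite ltW.
  by rewrite andbT; lra.
apply: (@squeeze_cvgr _ _ _ _ (fun n => 1 - (1 - t / 2) ^+ n) (fun=> 1)).
- by apply: nearW.
- rewrite -[X in _ --> X]subr0; apply: cvgB; first exact: cvg_cst.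
  by apply: cvg_expr; rewrite ger0_norm; lra.
- exact: cvg_cst.
Qed.

(** The map s |-> (s + s^2) / 2 sends -1, 0, 1 to 0, 0, 1 and so turns the sign of t - a into the
    indicator. Division by 1 + |a| brings t - a into [-1, 1], where [sgn_poly] is controlled. *)
Lemma poly_limit_ray (a : R) : poly_limit (\1_`]a, +oo[).
Proof.
have c0 : 0 < 1 + `|a| by rewrite ltr_pwDl.
pose L : {poly R} := (1 + `|a|)^-1 *: ('X - a%:P).
pose P n : {poly R} := (2^-1 *: ('X + 'X^2)) \Po (sgn_poly n \Po L).
have LE t : L.[t] = (t - a) / (1 + `|a|) by rewrite /L !hornerE mulrC.
have PE n t : (P n).[t] = ((sgn_poly n).[L.[t]] + (sgn_poly n).[L.[t]] ^+ 2) / 2.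
  by rewrite /P !horner_comp !hornerE mulrC.
have L1 t : `|t| <= 1 -> `|L.[t]| <= 1.
  move=> t1; rewrite LE normrM normfV (gtr0_norm c0) ler_pdivrMr// mul1r.
  by rewrite (le_trans (ler_normB _ _))// lerD2r.
exists P, 1; split=> [n t /L1 /(sgn_poly_le1 n)|t /L1 Lt].
  rewrite PE; move: (_.[_]) => s; rewrite ler_norml => /andP[s1 s2].
  by rewrite ler_norml; apply/andP; split; nra.
suff h (l : R) : (sgn_poly n).[L.[t]] @[n --> \oo] --> l ->
    (P n).[t] @[n --> \oo] --> (l + l ^+ 2) / 2.
  rewrite indicE mem_setE in_itv /= andbT; have [ta|ta|ta] := ltgtP a t.
  - rewrite (_ : 1%:R = (1 + 1 ^+ 2) / 2 :> R); last by field.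
    apply: h; apply: sgn_poly_cvg; move: Lt; rewrite ler_norml => /andP[_ ->].
    by rewrite andbT LE divr_gt0// subr_gt0.
  - rewrite (_ : 0%:R = (- 1 + (- 1) ^+ 2) / 2 :> R); last by field.
    apply: h; have -> : L.[t] = - (- L.[t]) by rewrite opprK.
    under eq_fun do rewrite sgn_polyN; apply: cvgN; apply: sgn_poly_cvg.
    move: Lt; rewrite ler_norml lerNl => /andP[-> _]; rewrite andbT oppr_gt0 LE.
    by rewrite pmulr_llt0 ?invr_gt0// subr_lt0.
  - rewrite (_ : 0%:R = (0 + 0 ^+ 2) / 2 :> R); last by field.
    apply: h; rewrite LE ta subrr mul0r.
    rewrite (_ : (fun n => _) = (fun=> 0)); first exact: cvg_cst.
    apply/funext => n; apply/eqP; rewrite -[_ == 0]orFb -(mulrn_eq0 _ 2) mulr2n.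
    by rewrite -{1}[0]oppr0 sgn_polyN addNr.
move=> hl; under eq_fun do rewrite PE.
apply: cvgM; last exact: cvg_cst.
by apply: cvgD => //; rewrite expr2; under eq_fun do rewrite expr2; exact: cvgM.
Qed.

End RayApproximation.

(** * From vanishing moments to vanishing almost everywhere *)

Section MomentDensity.
Context {R : realType}.
Local Notation C := R[i].
Local Notation RT := (measurableTypeR R).
Local Notation R2 := (RT * RT)%type.
Local Notation area := (@area R).
Local Notation disk := (@disk R : set R2).
Local Notation z := (@zcoord R).

Section NullIntegrals.
Context d (T : measurableType d) (m : {measure set T -> \bar R}).
Variables (D : set T) (f : T -> \bar R).
Hypotheses (mD : measurable D) (fi : m.-integrable D f).

Let null (E : set T) := (\int[m]_(x in D `&` E) f x = 0)%E.

(** Together with disjoint unions, this makes the sets over which [f] integrates to 0 a Dynkin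
    system. As [f] is signed, such sets are not stable under passing to subsets, so only nested sets
    are subtracted. *)
Lemma null_integral_setD (A B : set T) : measurable A -> measurable B ->
  B `<=` A -> null A -> null B -> null (A `\` B).
Proof.
move=> mA mB BA; rewrite /null => A0 B0.
have E : D `&` A = (D `&` B) `|` (D `&` (A `\` B)).
  by rewrite -setIUr setDE setUIr setUv setIT (setUidr BA).
move: A0; rewrite E integral_setU//; last 4 first.
- exact: measurableI.
- by apply: measurableI => //; exact: measurableD.
- by rewrite -E; apply: measurable_funS (measurable_int _ fi).
- by apply/disj_setPS => x [[_ Bx] [_ [_ /(_ Bx)]]].
by rewrite B0 add0e.
Qed.

Lemma null_integral_bigcup (F : (set T)^nat) : (forall n, measurable (F n)) ->
  trivIset setT F -> (forall n, null (F n)) -> null (\bigcup_k F k).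
Proof.
move=> mF tF F0; rewrite /null setI_bigcupr integral_bigcup//.
- by rewrite eseries0// => n _ _; exact: F0.
- by apply: trivIset_setIl.
- by move=> k; exact: measurableI.
- rewrite -setI_bigcupr; apply: integrableS fi => //.
  by apply: measurableI => //; exact: bigcup_measurable.
Qed.

End NullIntegrals.

Lemma setI_closed_rays : setI_closed (@RGenOInfty.G R).
Proof.
move=> _ _ [x ->] [y ->]; exists (Num.max x y).
by apply/seteqP; split=> t /=; rewrite !in_itv /= !andbT gt_max => /andP.
Qed.

Section NullRectangles.
Variables (D : set R2) (f : R2 -> \bar R).
Hypotheses (mD : measurable D) (fi : area.-integrable D f).

Let null (E : set R2) := (\int[area]_(x in D `&` E) f x = 0)%E.
(** The whole line is included because a complement in one factor is a difference from a full
    strip. *)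
Let ray (A : set RT) := A = setT \/ exists x : R, A = `]x, +oo[%classic.

(** Rays are stable under intersection and generate the Borel sets: the Dynkin argument enlarges the
    first factor, then the second, and a third use passes from rectangles to the product
    sigma-algebra. *)
Lemma null_integral_rays :
  (forall A B, ray A -> ray B -> null (A `*` B)) ->
  forall E, measurable E -> null E.
Proof.
move=> H.
have mray A : ray A -> measurable A.
  by case=> [->|[x ->]]; [exact: measurableT|exact: measurable_itv].
have mE : @measurable _ RT = <<s @RGenOInfty.G R >>.
  exact: RGenOInfty.measurableE.
have H1 A B : measurable A -> ray B -> null (A `*` B).
  move=> mA rB; have mB := mray _ rB; rewrite mE in mA; move: A mA.
  apply: (dynkin_induction mE setI_closed_rays); first by apply: H => //; left.
  - by move=> _ [x ->]; apply: H => //; right; exists x.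
  - move=> S mS S0.
    have -> : ~` S `*` B = (setT `*` B) `\` (S `*` B).
      apply/seteqP; split=> [[x y] [/= Sx By]|[x y] [[/= _ By] nS]].
        by split=> // -[].
      by split=> // Sx; apply: nS.
    apply: null_integral_setD => //; try exact: measurableX.
      by move=> [x y] [].
    by apply: H => //; left.
  - move=> F mF tF F0.
    have -> : (\bigcup_k F k) `*` B = \bigcup_k (F k `*` B).
      apply/seteqP; split=> [[x y] [[k _ Fk] By]|[x y] [k _ [Fk By]]].
        by exists k.
      by split=> //; exists k.
    apply: null_integral_bigcup => //; first by move=> n; exact: measurableX.
    move=> i j _ _ [[x y] [[/= Fi _] [/= Fj _]]].
    by apply: tF => //; exists x.
have H2 A B : measurable A -> measurable B -> null (A `*` B).
  move=> mA mB; rewrite mE in mB; move: B mB.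
  apply: (dynkin_induction mE setI_closed_rays); first by apply: H1 => //; left.
  - by move=> _ [x ->]; apply: H1 => //; right; exists x.
  - move=> S mS S0.
    have -> : A `*` ~` S = (A `*` setT) `\` (A `*` S).
      apply/seteqP; split=> [[x y] [/= Ax Sy]|[x y] [[/= Ax _] nS]].
        by split=> // -[].
      by split=> // Sy; apply: nS.
    apply: null_integral_setD => //; try exact: measurableX.
      by move=> [x y] [].
    by apply: H1 => //; left.
  - move=> F mF tF F0.
    have -> : A `*` (\bigcup_k F k) = \bigcup_k (A `*` F k).
      apply/seteqP; split=> [[x y] [Ax [k _ Fk]]|[x y] [k _ [Ax Fk]]].
        by exists k.
      by split=> //; exists k.
    apply: null_integral_bigcup => //; first by move=> n; exact: measurableX.
    move=> i j _ _ [[x y] [[/= _ Fi] [/= _ Fj]]].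
    by apply: tF => //; exists y.
move=> E; rewrite measurable_prod_measurableType; move: E.
apply: (dynkin_induction (measurable_prod_measurableType _ _)).
- move=> _ _ [A mA [B mB <-]] [A' mA' [B' mB' <-]].
  rewrite -setXI; exists (A `&` A'); first exact: measurableI.
  by exists (B `&` B') => //; exact: measurableI.
- by rewrite -setXTT; apply: H2.
- by move=> _ [A mA [B mB <-]]; exact: H2.
- move=> S mS S0; rewrite -setTD; apply: null_integral_setD => //.
  by rewrite -setXTT; apply: H2.
- by move=> F mF tF F0; exact: null_integral_bigcup.
Qed.

End NullRectangles.

Section VanishingMoments.
Variable f : R * R -> C.
Hypotheses (fi : cintegrable area disk (f : R2 -> C))
  (f0 : forall a b, moment f a b = 0).

(** Moments are taken against z and conj z, but approximation is by polynomials in x and y. This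
    class contains 1 and is stable under products with z and conj z, hence with x = (z + conj z) / 2
    and y = (z - conj z) / (2 i). *)
Let annihilated (g : R * R -> C) := smooth g /\
  forall a b, moment (fun p => f p * g p) a b = 0.

Let annihilatedD g h : annihilated g -> annihilated h ->
  annihilated (fun p => g p + h p).
Proof.
move=> [sg g0] [sh h0]; split=> [|a b]; first exact: smooth_add.
have md := @measurable_disk R.
have ig := moment_integrable a b (cintegrableM_smooth fi sg).
have ih := moment_integrable a b (cintegrableM_smooth fi sh).
rewrite -[RHS]addr0 -{1}(g0 a b) -(h0 a b) /moment -cintegralD//.
by apply: eq_cintegral => p _; rewrite mulrDr mulrDl.
Qed.

Let annihilatedZ c g : annihilated g -> annihilated (fun p => c * g p).
Proof.
move=> [sg g0]; split=> [|a b].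
  by apply: smooth_mul => //; exact: smooth_cst.
have md := @measurable_disk R.
have ig := moment_integrable a b (cintegrableM_smooth fi sg).
rewrite -[RHS](mulr0 c) -(g0 a b) /moment -cintegralZ//.
by apply: eq_cintegral => p _; ring.
Qed.

Let annihilated_zmonom g a b : annihilated g ->
  annihilated (fun p => z p ^+ a * (z p)^* ^+ b * g p).
Proof.
move=> [sg g0]; split=> [|a' b'].
  by apply: smooth_mul => //; exact: smooth_zmonom.
rewrite -(g0 (a + a')%N (b + b')%N); apply: eq_cintegral => p _.
by rewrite !exprD; ring.
Qed.

Let annihilated_x g : annihilated g -> annihilated (fun p => p.1%:C * g p).
Proof.
move=> ag; have := annihilatedD (annihilatedZ 2^-1 (annihilated_zmonom 1 0 ag))
  (annihilatedZ 2^-1 (annihilated_zmonom 0 1 ag)).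
congr (annihilated _); apply/funext => p; rewrite expr0 !expr1 mulr1 mul1r.
rewrite !mulrA -mulrDl; congr (_ * _); rewrite -mulrDr.
have -> : z p + (z p)^* = 2 * p.1%:C.
  by apply: complex_eqP; rewrite /= ?mul0r ?mul1r; ring.
by rewrite mulrA mulVf ?mul1r// pnatr_eq0.
Qed.

Let annihilated_y g : annihilated g -> annihilated (fun p => p.2%:C * g p).
Proof.
move=> ag.
pose i : C := 0 +i* 1.
have := annihilatedD (annihilatedZ (- i / 2) (annihilated_zmonom 1 0 ag))
  (annihilatedZ (i / 2) (annihilated_zmonom 0 1 ag)).
congr (annihilated _); apply/funext => p; rewrite expr0 !expr1 mulr1 mul1r.
rewrite !mulrA -mulrDl; congr (_ * _); rewrite mulNr mulNr addrC -mulrBr.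
have -> : (z p)^* - z p = - (2 * (i * p.2%:C)).
  by apply: complex_eqP; rewrite /= ?mul0r ?mul1r; ring.
rewrite mulrN [i / 2 * _]mulrA divfK ?pnatr_eq0// mulrA.
have -> : i * i = -1 by apply: complex_eqP; rewrite /=; ring.
by rewrite mulN1r opprK.
Qed.

Lemma integral_moment_poly (P Q : {poly R}) :
  cintegral area disk (fun p => f p * (P.[p.1] * Q.[p.2])%:C) = 0.
Proof.
have a1 : annihilated (fun=> 1).
  split=> [|a b]; first exact: smooth_cst.
  by rewrite -(f0 a b); apply: eq_cintegral => p _; rewrite mulr1.
have aQ : annihilated (fun p => Q.[p.2]%:C * 1).
  elim/poly_ind: Q => [|Q c IH].
    have := annihilatedZ 0 a1; congr (annihilated _); apply/funext => p.
    by rewrite horner0 mul0r.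
  have := annihilatedD (annihilated_y IH) (annihilatedZ c%:C a1).
  congr (annihilated _); apply/funext => p; rewrite !hornerE /= rmorphD rmorphM.
  by rewrite !mulr1 mulrC.
have [_ /(_ 0 0)] : annihilated (fun p => P.[p.1]%:C * (Q.[p.2]%:C * 1)).
  elim/poly_ind: P => [|P c IH].
    have := annihilatedZ 0 aQ; congr (annihilated _); apply/funext => p.
    by rewrite horner0.
  have := annihilatedD (annihilated_x IH) (annihilatedZ c%:C aQ).
  congr (annihilated _); apply/funext => p; rewrite !hornerE /= rmorphD rmorphM.
  by ring.
move=> <-; apply: eq_cintegral => p _.
by rewrite !expr0 !mulr1 rmorphM.
Qed.

Lemma integral_moment_limit (g h : R -> R) : poly_limit g -> poly_limit h ->
  measurable_fun setT (g : RT -> RT) -> measurable_fun setT (h : RT -> RT) ->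
  cintegral area disk (fun p => f p * (g p.1 * h p.2)%:C) = 0.
Proof.
move=> [P [M [PM Pg]]] [Q [N [QN Qh]]] mg mh.
have md := @measurable_disk R.
have [mf nf] := (cintegrableP (f : R2 -> C) md).1 fi.
have mprod (g' h' : RT -> RT) : measurable_fun setT g' -> measurable_fun setT h' ->
    cmeasurable_fun disk (fun p : R2 => f p * (g' p.1 * h' p.2)%:C).
  move=> mg' mh'; apply: cmeasurableM mf _; split; last exact: measurable_cst.
  apply: (measurable_funS measurableT (@subsetT _ disk)) => /=.
  apply: measurable_funM.
    exact: (measurableT_comp mg' (@measurable_fst _ _ RT RT)).
  exact: (measurableT_comp mh' (@measurable_snd _ _ RT RT)).
have mpoly (p : {poly R}) : measurable_fun setT (fun x : RT => p.[x] : RT).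
  by apply: continuous_measurable_fun; exact: continuous_horner.
have disk1 (p : R2) : disk p -> `|p.1| <= 1 /\ `|p.2| <= 1.
  move=> /disk_norm pd; split; apply: le_trans pd.
    exact: (normr_Re (z p)).
  exact: (normr_Im (z p)).
have cvgPQ (p : R2) : disk p ->
    (P n).[p.1] * (Q n).[p.2] @[n --> \oo] --> g p.1 * h p.2.
  by move=> /disk1[p1 p2]; apply: cvgM; [exact: Pg|exact: Qh].
apply: (@cintegral_dominated_eq0 _ R2 R area disk md
  (fun n p => f p * ((P n).[p.1] * (Q n).[p.2])%:C) _
  (fun p => normc (f p) * (M * N))).
- by move=> n; apply: (mprod (fun x => (P n).[x]) (fun x => (Q n).[x])).
- exact: mprod.
- move=> p pd /=; under eq_fun do rewrite ReM /= mulr0 subr0.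
  by rewrite ReM /= mulr0 subr0; apply: cvgM; [exact: cvg_cst|exact: cvgPQ].
- move=> p pd /=; under eq_fun do rewrite ImM /= mulr0 add0r.
  by rewrite ImM /= mulr0 add0r; apply: cvgM; [exact: cvg_cst|exact: cvgPQ].
- exact: (integrableZr md (M * N) nf).
- move=> n p pd; have [p1 p2] := disk1 _ pd.
  rewrite ComplexField.Normc.normcM normc_real normrM.
  by apply: ler_wpM2l; [exact: normc_ge0|apply: ler_pM => //; [exact: PM|exact: QN]].
- by move=> n; exact: integral_moment_poly.
Qed.

(** Indicators of products of rays are bounded limits of polynomials, so the real and imaginary
    parts of [f] integrate to 0 over them, hence over every measurable subset of the disc. *)
Lemma moments_eq0_ae : {ae area, forall p : R2, disk p -> f p = 0}.
Proof.
have md := @measurable_disk R.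
have [f1 f2] := fi.
have null_rays (h : R2 -> R) : area.-integrable disk (EFin \o h) ->
    (forall g g' : RT -> RT, poly_limit g -> poly_limit g' ->
      measurable_fun setT g -> measurable_fun setT g' ->
      \int[area]_(p in disk) (h p * (g p.1 * g' p.2)) = 0) ->
    {ae area, forall p : R2, disk p -> h p = 0}.
  move=> hi h0.
  have ray_limit (A : set RT) : A = setT \/ (exists x : R, A = `]x, +oo[%classic) ->
      poly_limit \1_A /\ measurable_fun setT (\1_A : RT -> RT).
    case=> [->|[x ->]]; split.
    - by rewrite indicT; exact: poly_limit1.
    - exact: measurable_indic.
    - exact: poly_limit_ray.
    - by apply: measurable_indic; exact: measurable_itv.
  have nul := null_integral_rays md hi.
  suff : ae_eq area disk (EFin \o h) (cst 0%E).
    by apply: filterS => p /= hp pd; have /= [] := hp pd.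
  apply: integral_ae_eq => // E ED mE.
  rewrite integral0 -(setIidr ED).
  apply: nul => // A B /ray_limit[pA mA] /ray_limit[pB mB].
  have mAB : measurable (A `*` B).
    by apply: measurableX; [move/measurable_indicP: mA|move/measurable_indicP: mB].
  have E1 : (\int[area]_(p in disk `&` (A `*` B)) (h p)%:E =
      \int[area]_(p in disk) (h p * (\1_A p.1 * \1_B p.2))%:E)%E.
    rewrite integral_mkcondr; apply: eq_integral => -[x y] _.
    rewrite patchE /= !indicE in_setX.
    by case: (x \in A); case: (y \in B); rewrite ?(mulr0, mul0r, mulr1).
  have fn : (\int[area]_(p in disk `&` (A `*` B)) (h p)%:E)%E \is a fin_num.
    apply: integrable_fin_num; first exact: measurableI.
    by apply: integrableS hi => //; exact: measurableI.
  rewrite -(fineK fn) E1; congr EFin.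
  exact: (h0 _ _ pA pB mA mB).
have c0 g g' := @integral_moment_limit g g'.
have h1 : {ae area, forall p : R2, disk p -> complex.Re (f p) = 0}.
  apply: null_rays => // g g' pg pg' mg mg'.
  have := congr1 (@complex.Re R) (c0 g g' pg pg' mg mg'); rewrite /= => H.
  by rewrite -[RHS]H; apply: eq_Rintegral => p _; rewrite ReM /= mulr0 subr0.
have h2 : {ae area, forall p : R2, disk p -> complex.Im (f p) = 0}.
  apply: null_rays => // g g' pg pg' mg mg'.
  have := congr1 (@complex.Im R) (c0 g g' pg pg' mg mg'); rewrite /= => H.
  by rewrite -[RHS]H; apply: eq_Rintegral => p _; rewrite ImM /= mulr0 add0r.
move: h1 h2; apply: filterS2 => p /= h1 h2 pd.
by apply: complex_eqP; [exact: h1|exact: h2].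
Qed.

End VanishingMoments.

End MomentDensity.

(** * Expansion in the Z_k *)

Section SquareIntegrable.
Context {R : realType}.
Local Notation C := R[i].
Local Notation RT := (measurableTypeR R).
Local Notation R2 := (RT * RT)%type.
Local Notation area := (@area R).
Local Notation disk := (@disk R : set R2).
Local Notation z := (@zcoord R).
Implicit Types (f g : R * R -> C) (c : nat -> C).

Let md := @measurable_disk R.

Lemma L2M_integrable f : L2M f ->
  area.-integrable disk (fun p : R2 => (normc (f p) ^+ 2)%:E).
Proof.
move=> [mf f2]; apply/integrableP; split.
  by apply/measurable_EFinP; exact: measurable_sqr_normc.
under eq_integral do rewrite gee0_abs ?lee_fin ?sqr_ge0//.
exact: f2.
Qed.

Lemma L2M_sqnormE f : L2M f ->
  sqnormM f = (\int[area]_(p in disk) (normc (f p) ^+ 2))%:E.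
Proof.
by move=> /L2M_integrable fi; rewrite /Rintegral fineK// integrable_fin_num.
Qed.

Lemma integrable_cst_disk (r : R) : area.-integrable disk (EFin \o (fun=> r)).
Proof.
apply/integrableP; split; first exact: measurable_cst.
by rewrite /= integral_cst// [X in (_ * X)%E]area_disk -EFinM ltry.
Qed.

(** |f| <= 1 + |f|^2, and the disc has finite area. *)
Lemma L2M_cintegrable f : L2M f -> cintegrable area disk (f : R2 -> C).
Proof.
move=> f2; apply/(cintegrableP _ md); split; first by case: f2.
have f2i := L2M_integrable f2.
have i1 := integrable_cst_disk 1.
apply: (le_integrable md _ _ (integrableD md i1 f2i)).
  by apply/measurable_EFinP; apply: measurable_normc; case: f2.
move=> p _ /=; rewrite lee_fin ger0_norm ?normc_ge0// ger0_norm; last first.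
  by rewrite addr_ge0// sqr_ge0.
by move: (normc _) => t; have := sqr_ge0 (t - 1); have := sqr_ge0 t; lra.
Qed.

Lemma smooth_L2M f : smooth f -> L2M f.
Proof.
move=> sf; split; first exact: smooth_measurable.
have [M M0 fM] := smooth_bounded sf.
rewrite /sqnormM; apply: (@le_lt_trans _ _ (\int[area]_(p in disk) (M ^+ 2)%:E)%E).
  apply: ge0_le_integral => //.
  - by move=> p _; rewrite lee_fin sqr_ge0.
  - apply/measurable_EFinP; apply: measurable_sqr_normc.
    exact: smooth_measurable.
  - by move=> p pd; rewrite lee_fin ler_pXn2r ?nnegrE ?normc_ge0// fM.
by rewrite integral_cst// [X in (_ * X)%E]area_disk -EFinM ltry.
Qed.

Lemma L2MB f g : L2M f -> L2M g -> L2M (fun p => f p - g p).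
Proof.
move=> f2 g2; have [mf _] := f2; have [mg _] := g2.
split; first exact: cmeasurableB.
have mfg := measurable_sqr_normc (cmeasurableB mf mg).
have i1 := integrableD md (integrableZl md 2 (L2M_integrable f2))
  (integrableZl md 2 (L2M_integrable g2)).
have : area.-integrable disk (fun p : R2 => (normc (f p - g p) ^+ 2)%:E).
  apply: (le_integrable md _ _ i1); first exact/measurable_EFinP.
  move=> p _ /=; rewrite lee_fin !ger0_norm ?sqr_ge0 ?sqr_normcB_le//.
  by rewrite addr_ge0// mulr_ge0// sqr_ge0.
move=> /integrableP[_]; rewrite /sqnormM.
by under eq_integral do rewrite gee0_abs ?lee_fin ?sqr_ge0//.
Qed.

Lemma L2_ker_dbar_weakly f : L2_ker_dbar f -> weakly_holomorphic f.
Proof. by case=> f2 f0; split=> //; exact: L2M_cintegrable. Qed.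

Definition Z_norm k : R := Num.sqrt (k.+1%:R / (2 * pi ^+ 2)).

Lemma Z_normE k : Z_norm k = Num.sqrt (2 * k.+1%:R) / (2 * pi).
Proof.
have p0 := pi_gt0 R.
have e : k.+1%:R / (2 * pi ^+ 2) = 2 * k.+1%:R / (2 * pi) ^+ 2 :> R.
  have : pi != 0 :> R by rewrite gt_eqF.
  by move: (pi : R) (k.+1%:R : R) => x y x0; field.
have h : 0 < 2 * pi :> R by rewrite mulr_gt0.
have h2 : 0 <= 2 * k.+1%:R :> R by rewrite mulr_ge0.
have h3 : 0 <= (2 * pi) ^+ 2 :> R by exact: sqr_ge0.
by rewrite /Z_norm e [LHS]sqrtrM// sqrtrV// sqrtr_sqr ger0_norm// ltW.
Qed.

Lemma sqr_Z_norm k : Z_norm k ^+ 2 = k.+1%:R / (2 * pi ^+ 2).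
Proof. by rewrite sqr_sqrtr// divr_ge0// mulr_ge0// sqr_ge0. Qed.

Lemma smooth_Z k : smooth (@Z R k).
Proof.
apply: smooth_mul; first exact: smooth_cst.
by move=> n; apply: class_C_exp; exact: class_C_zcoord.
Qed.

Lemma conj_Z k p : (Z k p)^* = (Z_norm k)%:C * (z p ^+ 0 * (z p)^* ^+ k).
Proof.
rewrite /Z rmorphM rmorphXn expr0 mul1r; congr (_ * _).
by apply: complex_eqP => //=; rewrite oppr0.
Qed.

Lemma cintegrable_conj_Z f k : cintegrable area disk (f : R2 -> C) ->
  cintegrable area disk (fun p : R2 => f p * (Z k p)^*).
Proof.
move=> fi; apply: (eq_cintegrable (f := fun p : R2 =>
  (Z_norm k)%:C * (f p * (z p ^+ 0 * (z p)^* ^+ k)))) => //.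
  by move=> p _; rewrite conj_Z mulrCA.
by apply: cintegrableZ => //; exact: moment_integrable.
Qed.

Lemma integral_conj_Z f k : cintegrable area disk (f : R2 -> C) ->
  cintegral area disk (fun p => f p * (Z k p)^*) = (Z_norm k)%:C * moment f 0 k.
Proof.
move=> fi; rewrite /moment -cintegralZ//; last exact: moment_integrable.
by apply: eq_cintegral => p _; rewrite conj_Z mulrCA.
Qed.

(** The coefficients are inner products over [SM]; an integral over the disc alone lacks the length
    2 pi of the fibre. *)
Lemma Z_expansionE f k : cintegrable area disk (f : R2 -> C) ->
  cintegral area disk (fun p => f p * (Z k p)^*) =
  ((2 * pi)^-1)%:C * Z_expansion f k.
Proof.
move=> fi; rewrite integral_conj_Z// /Z_expansion innerSM_lift// Z_normE.
by rewrite rmorphM /= mulrA; congr (_ * _); rewrite mulrC.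
Qed.

Lemma Z_orthogonal j k : cintegral area disk (fun p => Z j p * (Z k p)^*) =
  if j == k then ((2 * pi)^-1)%:C else 0.
Proof.
rewrite integral_conj_Z; last exact: smooth_cintegrable (smooth_Z j).
have -> : moment (Z j) 0 k = (Z_norm j)%:C *
    cintegral area disk (fun p => z p ^+ j * (z p)^* ^+ k).
  rewrite -cintegralZ//; last exact: smooth_cintegrable (smooth_zmonom j k).
  by apply: eq_cintegral => p _; rewrite expr0 mul1r -mulrA.
rewrite integral_zmonom; case: eqP => [<-|_]; last by rewrite !mulr0.
rewrite mulrA -!rmorphM; congr (_%:C) => /=.
rewrite -expr2 sqr_Z_norm; have : pi != 0 :> R by rewrite gt_eqF// pi_gt0.
have : j.+1%:R != 0 :> R by rewrite pnatr_eq0.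
by move: (pi : R) (j.+1%:R : R) => x y x0 y0; field; rewrite x0 y0.
Qed.

Definition psum c m n : R * R -> C := fun p => \sum_(m <= k < n) c k * Z k p.

Lemma smooth_psum c m n : smooth (psum c m n).
Proof.
rewrite /psum; elim: (index_iota m n) => [|k s IHs].
  by under eq_fun do rewrite big_nil; exact: smooth_cst.
under eq_fun do rewrite big_cons; apply: smooth_add => //.
by apply: smooth_mul; [exact: smooth_cst|exact: smooth_Z].
Qed.

Lemma psum_cintegrable c m n : cintegrable area disk (psum c m n : R2 -> C).
Proof. exact: smooth_cintegrable (smooth_psum c m n). Qed.

Lemma integral_psum_conj_Z c m n k :
  cintegral area disk (fun p => psum c m n p * (Z k p)^*) =
  if (m <= k < n)%N then ((2 * pi)^-1)%:C * c k else 0.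
Proof.
rewrite (eq_cintegral (fun p : R2 =>
  \sum_(m <= j < n) c j * (Z j p * (Z k p)^*))); last first.
  by move=> p _; rewrite mulr_suml; apply: eq_bigr => j _; rewrite mulrA.
have iZ (j : nat) : cintegrable area disk (fun p : R2 => Z j p * (Z k p)^*).
  by apply: cintegrable_conj_Z; exact: smooth_cintegrable (smooth_Z j).
rewrite cintegral_sum//; last by move=> j; exact: cintegrableZ.
under eq_bigr => j _ do
  rewrite cintegralZ// Z_orthogonal (fun_if ( *%R (c j))) mulr0 mulrC.
rewrite -big_mkcond big_nat1_eq.
by [].
Qed.

Lemma integral_conj_psum f c m n : cintegrable area disk (f : R2 -> C) ->
  cintegrable area disk (fun p : R2 => f p * (psum c m n p)^*) /\
  cintegral area disk (fun p => f p * (psum c m n p)^*) =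
  \sum_(m <= k < n) (c k)^* * cintegral area disk (fun p => f p * (Z k p)^*).
Proof.
move=> fi; have e p : f p * (psum c m n p)^* =
    \sum_(m <= k < n) (c k)^* * (f p * (Z k p)^*).
  rewrite rmorph_sum mulr_sumr; apply: eq_bigr => k _.
  by rewrite rmorphM mulrCA.
have iZ (k : nat) : cintegrable area disk
    (fun p : R2 => (c k)^* * (f p * (Z k p)^*)).
  by apply: cintegrableZ => //; exact: cintegrable_conj_Z.
split.
  by apply: (eq_cintegrable md _ (cintegrable_sum (index_iota m n) md iZ)) => p _.
rewrite (eq_cintegral (fun p : R2 =>
  \sum_(m <= k < n) (c k)^* * (f p * (Z k p)^*))); last by move=> p _; rewrite e.
rewrite cintegral_sum//; apply: eq_bigr => k _.
by rewrite cintegralZ//; exact: cintegrable_conj_Z.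
Qed.

Lemma sqnorm_psum c m n : sqnormM (psum c m n) =
  ((2 * pi)^-1 * \sum_(m <= k < n) normc (c k) ^+ 2)%:E.
Proof.
rewrite L2M_sqnormE; last exact: smooth_L2M (smooth_psum c m n).
congr (_%:E).
have [_] := integral_conj_psum c m n (psum_cintegrable c m n).
under eq_big_nat => k kmn do rewrite integral_psum_conj_Z kmn.
move=> /(congr1 (@complex.Re R)) /=.
under eq_Rintegral do rewrite -sqr_normc_conj /=.
move=> ->; rewrite Re_sum mulr_sumr; apply: eq_bigr => k _.
by rewrite mulrCA [_ * c k]mulrC -sqr_normc_conj -rmorphM.
Qed.

(** Let S_n be the partial sum and s the left side. In the integral of |f - S_n|^2 >= 0, both Re (f
    conj S_n) and |S_n|^2 contribute s / (2 pi), with factors -2 and 1. *)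
Lemma bessel f n : L2M f ->
  \sum_(0 <= k < n) normc (Z_expansion f k) ^+ 2 <=
  2 * pi * \int[area]_(p in disk) (normc (f p) ^+ 2).
Proof.
move=> f2; have fi := L2M_cintegrable f2.
set c := Z_expansion f; set s := \sum_(_ <= k < _) _.
have S2 := smooth_L2M (smooth_psum c 0 n).
have [i1 e1] := integral_conj_psum c 0 n fi.
have e2 : \int[area]_(p in disk) (normc (psum c 0 n p) ^+ 2) = (2 * pi)^-1 * s.
  by apply: EFin_inj; rewrite -L2M_sqnormE// sqnorm_psum.
have e3 : \int[area]_(p in disk) complex.Re (f p * (psum c 0 n p)^*) = (2 * pi)^-1 * s.
  have := congr1 (@complex.Re R) e1; rewrite /= => ->.
  rewrite Re_sum /s mulr_sumr; apply: eq_bigr => k _.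
  by rewrite Z_expansionE// mulrCA [_ * Z_expansion f k]mulrC -sqr_normc_conj -rmorphM.
have : 0 <= \int[area]_(p in disk) (normc (f p - psum c 0 n p) ^+ 2).
  by apply: Rintegral_ge0 => p _; exact: sqr_ge0.
have i2 : area.-integrable disk
    (EFin \o (fun p : R2 => 2 * complex.Re (f p * (psum c 0 n p)^*))).
  exact: (integrableZl md 2 (proj1 i1)).
have j1 := L2M_integrable f2; have j2 := L2M_integrable S2.
have j3 := integrableB md j1 i2.
under eq_Rintegral do rewrite sqr_normcB.
rewrite (RintegralD md j3 j2) (RintegralB md j1 i2) (RintegralZl 2 md (proj1 i1)).
rewrite e2 e3.
have h : 0 < 2 * pi :> R by rewrite mulr_gt0// pi_gt0.
set F := \int[area]_(p in disk) _ => H.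
have {}H : (2 * pi)^-1 * s <= F by lra.
by rewrite -ler_pdivrMl.
Qed.

End SquareIntegrable.

(** * Power series with square summable coefficients *)

Section RieszFischer.
Context {R : realType}.
Local Notation C := R[i].
Local Notation RT := (measurableTypeR R).
Local Notation R2 := (RT * RT)%type.
Local Notation area := (@area R).
Local Notation disk := (@disk R : set R2).
Local Notation open_disk := (@open_disk R : set R2).
Local Notation z := (@zcoord R).

Let md := @measurable_disk R.

Lemma cvg_series_succ_expr (x : R) : 0 <= x < 1 ->
  cvgn (series (fun k => k.+1%:R * x ^+ k)).
Proof.
move=> /andP[x0 x1]; apply: nondecreasing_is_cvgn.
  by apply: nondecreasing_series => k _ _; rewrite mulr_ge0// exprn_ge0.
exists ((1 - x) ^- 2) => _ [n _ <-].
(* Closed form of the partial sums; the subtracted term is nonnegative, so they are bounded by (1 -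
   x)^-2. *)
have e : series (fun k => k.+1%:R * x ^+ k) n * (1 - x) ^+ 2 =
    1 - x ^+ n * (1 + n%:R * (1 - x)).
  elim: n => [|n IHn]; first by rewrite /series /= big_geq// expr0; ring.
  by rewrite seriesSr mulrDl IHn [x ^+ n.+1]exprS -natr1; ring.
have h : 0 < (1 - x) ^+ 2 by rewrite exprn_gt0// subr_gt0.
rewrite -[leRHS]mul1r ler_pdivlMr// e gerBl mulr_ge0 ?exprn_ge0//.
by rewrite addr_ge0// mulr_ge0// subr_ge0 ltW.
Qed.

(** |Z_k|^2 is a constant times (k+1) |z|^(2k). The convergence makes a series with square summable
    coefficients converge absolutely at interior points. *)
Lemma cvg_sqr_Z (p : R * R) : open_disk p ->
  cvgn (series (fun k => normc (@Z R k p) ^+ 2)).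
Proof.
move=> /open_disk_norm zp.
have x01 : 0 <= normc (z p) ^+ 2 < 1.
  by rewrite sqr_ge0 expr_lt1// normc_ge0.
suff -> : (fun k => normc (@Z R k p) ^+ 2) =
    (2 * pi ^+ 2)^-1 *: (fun k => k.+1%:R * (normc (z p) ^+ 2) ^+ k).
  exact/is_cvg_seriesZ/cvg_series_succ_expr.
apply/funext => k; have -> : normc (Z k p) ^+ 2 = Z_norm k ^+ 2 * (normc (z p) ^+ 2) ^+ k.
  rewrite /Z ComplexField.Normc.normcM normc_real normcX exprMn.
  by rewrite real_normK ?num_real// -!exprM mulnC.
by rewrite sqr_Z_norm mulrAC mulrC.
Qed.

(** Pairing with a bounded function is continuous in mean square. Young's inequality K t <= K^2 t^2
    / (2 e) + e / 2 replaces Cauchy-Schwarz and bounds the error by e (1 + pi) for every e > 0. *)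
Lemma L2_limit_integral (h : nat -> R * R -> C) (g psi : R * R -> C) N (a : C) :
  (forall n, L2M (h n)) -> L2M g -> smooth psi ->
  sqnormM (fun p => h n p - g p) @[n --> \oo] --> 0%E ->
  (forall n, (N <= n)%N -> cintegral area disk (fun p => h n p * psi p) = a) ->
  cintegral area disk (fun p => g p * psi p) = a.
Proof.
move=> h2 g2 spsi hg hN; set I := cintegral _ _ _.
have [K K0 psiK] := smooth_bounded spsi.
have p0 := pi_gt0 R.
have bound (e : R) : 0 < e -> normc (a - I) <= e * (1 + pi).
  move=> e0; have K1 : 0 < K ^+ 2 + 1 by rewrite ltr_wpDl// sqr_ge0.
  have h0 n : (0 <= sqnormM (fun p => h n p - g p)%R)%E.
    by apply: integral_ge0 => p _; rewrite lee_fin sqr_ge0.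
  (* The denominator K^2 + 1 allows for K = 0. *)
  have [n [Nn ne]] : exists n, (N <= n)%N /\
      (sqnormM (fun p => h n p - g p)%R < (e ^+ 2 / (K ^+ 2 + 1))%:E)%E.
    have r0 : 0 < e ^+ 2 / (K ^+ 2 + 1) by rewrite divr_gt0// exprn_gt0.
    have [|M _ hM] := hg [set x | (x < (e ^+ 2 / (K ^+ 2 + 1))%:E)%E].
      by apply: open_nbhs_nbhs; split; [exact: open_ereal_lt_ereal|rewrite /= lte_fin].
    by exists (maxn N M); rewrite leq_maxl; split=> //; apply: hM; exact: leq_maxr.
  have d2 := L2MB (h2 n) g2; have di := L2M_integrable d2.
  move: ne; rewrite L2M_sqnormE// lte_fin => H.
  have hi := cintegrableM_smooth (L2M_cintegrable (h2 n)) spsi.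
  have gi := cintegrableM_smooth (L2M_cintegrable g2) spsi.
  have dpi := cintegrableM_smooth (L2M_cintegrable d2) spsi.
  have -> : a - I = cintegral area disk (fun p => (h n p - g p) * psi p).
    rewrite -(hN _ Nn) /I -cintegralB//.
    by apply: eq_cintegral => p _; rewrite mulrBl.
  pose G (p : R2) := (K ^+ 2 / e / 2) * normc (h n p - g p) ^+ 2 + e / 2.
  have i1 : area.-integrable disk (EFin \o (fun p : R2 =>
      (K ^+ 2 / e / 2) * normc (h n p - g p) ^+ 2)).
    exact: (integrableZl md (K ^+ 2 / e / 2) di).
  have i2 : area.-integrable disk (EFin \o (fun _ : R2 => e / 2)).
    exact: integrable_cst_disk.
  apply: le_trans (cintegral_le (g := G) md dpi _ _) _.
  - exact: (integrableD md i1 i2).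
  - move=> p pd; rewrite ComplexField.Normc.normcM.
    apply: (@le_trans _ _ (normc (h n p - g p) * K)).
      by apply: ler_wpM2l; [exact: normc_ge0|exact: psiK].
    rewrite /G; move: (normc _) => t.
    have : 0 <= (K * t - e) ^+ 2 / (2 * e) by rewrite divr_ge0 ?sqr_ge0// mulr_ge0// ltW.
    have -> : (K * t - e) ^+ 2 / (2 * e) =
      K ^+ 2 / e / 2 * t ^+ 2 + e / 2 - t * K by field; rewrite gt_eqF.
    by rewrite subr_ge0.
  rewrite /G (RintegralD md i1 i2) (RintegralZl _ md di) Rintegral_cst//.
  rewrite [X in fine X]area_disk /=.
  set H' := \int[_]_(_ in _) _.
  have H0 : 0 <= H' by apply: Rintegral_ge0 => p _; exact: sqr_ge0.
  move: H; rewrite -/H' ltr_pdivlMr// => H.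
  have : K ^+ 2 / e * H' <= e by rewrite mulrAC ler_pdivrMr// -expr2; lra.
  by lra.
apply/eqP; rewrite eq_sym -subr_eq0; apply/eqP/ComplexField.Normc.eq0_normc.
apply/eqP; rewrite eq_le normc_ge0 andbT leNgt; apply/negP => d0.
(* For this e the bound becomes |a - I| / 2, a contradiction. *)
have e0 : 0 < normc (a - I) / (2 * (1 + pi)).
  by rewrite divr_gt0// mulr_gt0// addr_gt0.
have := bound _ e0.
have -> : normc (a - I) / (2 * (1 + pi)) * (1 + pi) = normc (a - I) / 2.
  have : 1 + pi != 0 :> R by rewrite gt_eqF// addr_gt0.
  by move: (1 + pi) (normc _) => x y x0; field.
by lra.
Qed.

Section SquareSummable.
Variable c : nat -> C.
Hypothesis c2 : cvgn (series (fun k => normc (c k) ^+ 2)).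

(** Off the open disc, where they may diverge, the partial sums are set to 0; the pointwise limit
    then exists everywhere and inherits measurability. *)
Let cut n (p : R * R) : C := (\1_open_disk p)%:C * psum c 0 n p.

Definition power_series_sum (p : R * R) : C :=
  limn (fun n => complex.Re (cut n p)) +i* limn (fun n => complex.Im (cut n p)).
Local Notation g := power_series_sum.

Let cut_open n p : open_disk p -> cut n p = psum c 0 n p.
Proof. by move=> po; rewrite /cut indicE mem_set// mul1r. Qed.

(** |c_k Z_k| <= |c_k|^2 + |Z_k|^2, a sum of two convergent series; [re] stands for the real or the
    imaginary part. *)
Let cvg_terms (re : C -> R) (p : R * R) : (forall x, `|re x| <= normc x) ->
  open_disk p -> cvgn (series (fun k => re (c k * Z k p))).
Proof.
move=> re1 po; apply: normed_cvg; rewrite /=.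
apply: (series_le_cvg (v_ := fun k => normc (c k) ^+ 2 + normc (Z k p) ^+ 2)).
- by move=> n; exact: normr_ge0.
- by move=> n; rewrite addr_ge0// sqr_ge0.
- move=> n; apply: le_trans (re1 _) _; rewrite ComplexField.Normc.normcM.
  have := sqr_ge0 (normc (c n) - normc (Z n p)).
  have := mulr_ge0 (normc_ge0 (c n)) (normc_ge0 (Z n p)).
  by rewrite sqrrB; lra.
- exact: is_cvg_seriesD c2 (cvg_sqr_Z po).
Qed.

Let cvg_cut p :
  complex.Re (cut n p) @[n --> \oo] --> complex.Re (g p) /\
  complex.Im (cut n p) @[n --> \oo] --> complex.Im (g p).
Proof.
have [po|po] := pselect (open_disk p); last first.
  rewrite /power_series_sum /=.
  have e n : cut n p = 0 by rewrite /cut indicE memNset// mul0r.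
  by split; under eq_fun do rewrite e; apply: is_cvg_cst.
have e n : cut n p = \sum_(0 <= k < n) c k * Z k p by rewrite cut_open.
split.
- rewrite /power_series_sum /=; under eq_fun do rewrite e Re_sum.
  by apply: cvg_terms => //; exact: normr_Re.
- rewrite /power_series_sum /=; under eq_fun do rewrite e Im_sum.
  by apply: cvg_terms => //; exact: normr_Im.
Qed.

Lemma cmeasurable_power_series_sum : cmeasurable_fun disk (g : R2 -> C).
Proof.
have mcut n : cmeasurable_fun disk (cut n : R2 -> C).
  apply: cmeasurableM; last exact: smooth_measurable (smooth_psum c 0 n).
  split; last exact: measurable_cst.
  by apply: measurable_indic; exact: measurable_open_disk.
split.
- apply: (@measurable_fun_cvg _ R2 R disk (fun n p => complex.Re (cut n p))).
    by move=> n; case: (mcut n).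
  by move=> p _; case: (cvg_cut p).
- apply: (@measurable_fun_cvg _ R2 R disk (fun n p => complex.Im (cut n p))).
    by move=> n; case: (mcut n).
  by move=> p _; case: (cvg_cut p).
Qed.

Let tail n := (2 * pi)^-1 *
  (limn (series (fun k => normc (c k) ^+ 2)) - series (fun k => normc (c k) ^+ 2) n).

(** Fatou's lemma for [psum c n (n + m)] as m grows: orthogonality gives their square norms, which
    converge to [tail n]. Both the square integrability of the sum and the mean square convergence
    follow. *)
Lemma sqnorm_power_series_tail n :
  (sqnormM (fun p => psum c 0 n p - g p)%R <= (tail n)%:E)%E.
Proof.
have mo := @measurable_open_disk R.
pose h m (p : R2) : \bar R := (normc (psum c n (n + m) p) ^+ 2)%:E.
have hE m p : h m p = (normc (psum c 0 n p - psum c 0 (n + m) p) ^+ 2)%:E.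
  have -> : psum c 0 (n + m) p = psum c 0 n p + psum c n (n + m) p.
    by rewrite /psum -big_cat_nat// leq_addr.
  by rewrite opprD addNKr normcN.
have mh m : measurable_fun open_disk (h m).
  apply/measurable_EFinP; apply: measurable_sqr_normc.
  apply: cmeasurableS (smooth_measurable (smooth_psum c n (n + m))) => //.
  exact: open_disk_sub.
have h0 m p : open_disk p -> (0 <= h m p)%E by rewrite lee_fin sqr_ge0.
have := fatou area mo mh h0.
have -> : (\int[area]_(p in open_disk) limn_einf (h ^~ p) =
    sqnormM (fun p => psum c 0 n p - g p)%R)%E.
  rewrite /sqnormM integral_disk; apply: eq_integral => p; rewrite inE => po.
  have cv : h ^~ p @ \oo --> (normc (psum c 0 n p - g p) ^+ 2)%:E.
    under eq_fun do rewrite hE; apply: cvg_EFin; first exact: nearW.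
    have [cr ci] := cvg_cut p.
    under eq_fun do rewrite sqr_normcE ReD ReN ImD ImN.
    rewrite sqr_normcE ReD ReN ImD ImN.
    have cr' : complex.Re (psum c 0 (n + m) p) @[m --> \oo] --> complex.Re (g p).
      under eq_fun do rewrite -cut_open//.
      exact: (cvg_comp _ _ (@cvg_addnl n) cr).
    have ci' : complex.Im (psum c 0 (n + m) p) @[m --> \oo] --> complex.Im (g p).
      under eq_fun do rewrite -cut_open//.
      exact: (cvg_comp _ _ (@cvg_addnl n) ci).
    rewrite !expr2; apply: cvgD.
      by under eq_fun do rewrite expr2; apply: cvgM; apply: cvgB => //; exact: cvg_cst.
    by under eq_fun do rewrite expr2; apply: cvgM; apply: cvgB => //; exact: cvg_cst.
  rewrite is_cvg_limn_einfE; first exact/cvg_lim.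
  by apply/cvg_ex; eexists; exact: cv.
have cv : (\int[area]_(p in open_disk) h m p)%E @[m --> \oo] --> (tail n)%:E.
  have e m : (\int[area]_(p in open_disk) h m p)%E = ((2 * pi)^-1 *
      (series (fun k => normc (c k) ^+ 2) (n + m)%N -
       series (fun k => normc (c k) ^+ 2) n))%:E.
    rewrite -integral_disk -[LHS]/(sqnormM (psum c n (n + m))) sqnorm_psum.
    by rewrite sub_series_geq// leq_addr.
  under eq_fun do rewrite e; apply: cvg_EFin; first exact: nearW.
  apply: cvgM; first exact: cvg_cst.
  apply: cvgB; last exact: cvg_cst.
  exact: (cvg_comp _ _ (@cvg_addnl n) c2).
rewrite is_cvg_limn_einfE; last by apply/cvg_ex; eexists; exact: cv.
by move/cvg_lim : cv => ->.
Qed.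

Lemma sqnorm_power_series_cvg :
  sqnormM (fun p => psum c 0 n p - g p) @[n --> \oo] --> 0%E.
Proof.
apply: (@squeeze_cvge _ _ _ _ (fun=> 0%E) _ (fun n => (tail n)%:E)).
- apply: nearW => n; rewrite sqnorm_power_series_tail andbT.
  by apply: integral_ge0 => p _; rewrite lee_fin sqr_ge0.
- exact: cvg_cst.
- apply: cvg_EFin; first exact: nearW.
  rewrite -[X in _ --> X](mulr0 (2 * pi)^-1); apply: cvgM; first exact: cvg_cst.
  rewrite -[X in _ --> X](subrr (limn (series (fun k => normc (c k) ^+ 2)))).
  by apply: cvgB; [exact: cvg_cst|exact: c2].
Qed.

Lemma L2M_power_series_sum : L2M g.
Proof.
split; first exact: cmeasurable_power_series_sum.
(* For n = 0 the partial sum is empty and the tail bound concerns the sum itself. *)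
apply: le_lt_trans (ltry (tail 0)); apply: le_trans (sqnorm_power_series_tail 0).
rewrite le_eqVlt; apply/orP; left; apply/eqP.
by apply: eq_integral => p _; rewrite /psum big_geq// sub0r normcN.
Qed.

(** By orthogonality the k-th coefficient of the n-th partial sum is c_k as soon as n > k. *)
Lemma Z_expansion_power_series_sum k : Z_expansion g k = c k.
Proof.
have K0 : ((2 * pi)^-1)%:C != 0 :> C.
  by rewrite fmorph_eq0 invr_eq0 mulf_neq0// gt_eqF// pi_gt0.
apply: (mulfI K0); rewrite -Z_expansionE; last first.
  exact: L2M_cintegrable L2M_power_series_sum.
have sZ : smooth (fun p => (@Z R k p)^*).
  have -> : (fun p => (@Z R k p)^*) =
      (fun p => (Z_norm k)%:C * (z p ^+ 0 * (z p)^* ^+ k)).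
    by apply/funext => p; exact: conj_Z.
  by apply: smooth_mul; [exact: smooth_cst|exact: smooth_zmonom].
apply: (L2_limit_integral (N := k.+1) _ L2M_power_series_sum sZ
  sqnorm_power_series_cvg) => [n|n kn].
  exact: smooth_L2M (smooth_psum c 0 n).
by rewrite integral_psum_conj_Z /= kn.
Qed.

(** Each z^k is weakly holomorphic, and the weak equation survives the mean square limit because
    [dbar phi] is bounded on the disc. *)
Lemma L2_ker_dbar_power_series_sum : L2_ker_dbar g.
Proof.
split=> [|phi tphi]; first exact: L2M_power_series_sum.
have sphi : smooth (dbar phi) by apply: smooth_dbar; case: tphi.
apply: (L2_limit_integral (N := 0) _ L2M_power_series_sum sphi
  sqnorm_power_series_cvg) => [n|n _].
  exact: smooth_L2M (smooth_psum c 0 n).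
rewrite (eq_cintegral (fun p : R2 => \sum_(0 <= k < n)
    (c k * (Z_norm k)%:C) * (z p ^+ k * dbar phi p))); last first.
  by move=> p _; rewrite mulr_suml; apply: eq_bigr => k _; rewrite /Z; ring.
have zi (k : nat) : cintegrable area disk (fun p : R2 => z p ^+ k * dbar phi p).
  by have [zk _] := @weakly_holomorphic_zexp R k; exact: cintegrableM_smooth.
rewrite cintegral_sum//; last by move=> k; exact: cintegrableZ.
rewrite big1// => k _; rewrite cintegralZ//.
by have [_ ->] := @weakly_holomorphic_zexp R k; rewrite ?mulr0.
Qed.

End SquareSummable.
End RieszFischer.

(** * Completeness of the Z_k and transfer to the u'_k *)

Section Expansion.
Context {R : realType}.
Local Notation C := R[i].
Local Notation RT := (measurableTypeR R).
Local Notation R2 := (RT * RT)%type.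
Local Notation area := (@area R).
Local Notation disk := (@disk R : set R2).
Local Notation open_disk := (@open_disk R : set R2).

Let md := @measurable_disk R.

Lemma Z_expansion_summable f : L2M f ->
  cvgn (series (fun k => normc (Z_expansion f k : C) ^+ 2)).
Proof.
move=> f2; apply: nondecreasing_is_cvgn.
  by apply: nondecreasing_series => k _ _; exact: sqr_ge0.
exists (2 * pi * \int[area]_(p in disk) (normc (f p) ^+ 2)) => _ [n _ <-].
exact: bessel.
Qed.

Lemma weakly_holomorphicB (f g : R * R -> C) : weakly_holomorphic f ->
  weakly_holomorphic g -> weakly_holomorphic (fun p => f p - g p).
Proof.
move=> [fi f0] [gi g0]; split; first exact: cintegrableB.
move=> phi tphi; have sphi : smooth (dbar phi) by apply: smooth_dbar; case: tphi.
have e := cintegralB md (cintegrableM_smooth fi sphi) (cintegrableM_smooth gi sphi).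
rewrite f0// g0// subrr in e; rewrite -[RHS]e.
by apply: eq_cintegral => p _; rewrite mulrBl.
Qed.

(** The coefficients determine the moments (0, k), so those of f - g vanish, and with them all its
    moments. *)
Lemma eq_Z_expansion_ae (f g : R * R -> C) : L2_ker_dbar f -> L2_ker_dbar g ->
  Z_expansion f = Z_expansion g -> {ae area, forall p : R2, disk p -> f p = g p}.
Proof.
move=> kf kg fg; have wf := L2_ker_dbar_weakly kf; have wg := L2_ker_dbar_weakly kg.
have [fi _] := wf; have [gi _] := wg.
have wd := weakly_holomorphicB wf wg.
have d0 k : moment (fun p => f p - g p) 0 k = 0.
  have -> : moment (fun p => f p - g p) 0 k = moment f 0 k - moment g 0 k.
    have e := cintegralB md (moment_integrable 0 k fi) (moment_integrable 0 k gi).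
    by apply: etrans e; apply: eq_cintegral => p _; rewrite mulrBl.
  have Zn0 : (Z_norm k)%:C != 0 :> C.
    by rewrite fmorph_eq0 sqrtr_eq0 -ltNge divr_gt0// mulr_gt0// exprn_gt0// pi_gt0.
  apply/eqP; rewrite subr_eq0; apply/eqP/(mulfI Zn0).
  by rewrite -!integral_conj_Z// !Z_expansionE// fg.
have := moments_eq0_ae (proj1 wd) (moment_eq0 wd d0).
by apply: filterS => p h /h /eqP; rewrite subr_eq0 => /eqP.
Qed.

Lemma sums_to_Z_expansion (f : R * R -> C) : L2_ker_dbar f ->
  sums_to (Z_expansion f) f.
Proof.
move=> kf; have [f2 _] := kf; have c2 := Z_expansion_summable f2.
set c := Z_expansion f in c2; pose g := power_series_sum c.
have kg : L2_ker_dbar g := L2_ker_dbar_power_series_sum c2.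
have ae_fg : {ae area, forall p : R2, disk p -> f p = g p}.
  apply: eq_Z_expansion_ae => //; apply/funext => k.
  by rewrite Z_expansion_power_series_sum.
have := sqnorm_power_series_cvg c2; rewrite /sums_to.
(* f and the sum of its series agree only almost everywhere, a difference that the square norm does
   not see. *)
suff e n : sqnormM (fun p => psum c 0 n p - g p) =
    sqnormM (fun p => \sum_(0 <= k < n) c k * Z k p - f p).
  by under eq_fun do rewrite e.
have mS := smooth_measurable (smooth_psum c 0 n).
have [[mf _] _] := kf; have [[mg _] _] := kg.
apply: ge0_ae_eq_integral => //.
- by apply/measurable_EFinP; apply: measurable_sqr_normc; exact: cmeasurableB.
- by apply/measurable_EFinP; apply: measurable_sqr_normc; exact: cmeasurableB.
- by move=> p _; rewrite lee_fin sqr_ge0.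
- by move=> p _; rewrite lee_fin sqr_ge0.
- by move: ae_fg; apply: filterS => p h pd; rewrite -h.
Qed.

(** Carries an expansion in the Z_k over to a family known to be a_k Z_k only over the open disc,
    such as the images of the u'_k under [I0adj]. *)
Lemma sums_to_unscale (e : nat -> R * R -> C) (a b : nat -> C)
    (c : fseries e) (g : R * R -> C) :
  (forall k p, open_disk p -> e k p = a k * Z k p) ->
  (forall k, b k = c k * a k) ->
  sums_to (b : fseries Z) g -> sums_to c g.
Proof.
move=> ea bE; rewrite /sums_to.
suff E n : sqnormM (fun p => \sum_(0 <= k < n) b k * Z k p - g p) =
    sqnormM (fun p => \sum_(0 <= k < n) c k * e k p - g p).
  by under eq_fun do rewrite E.
apply: eq_sqnormM => p po; congr (_ - _).
by apply: eq_bigr => k _; rewrite ea// bE mulrA.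
Qed.

Lemma W_adj_factor k : W_factor k * adj_factor k = 1 :> C.
Proof.
rewrite /W_factor /adj_factor.
have s0 : Num.sqrt k.+1%:R != 0 :> R by rewrite sqrtr_eq0 -ltNge ltr0n.
have gen (u x y : C) : u * x * (2 * u * y) = u * u * (2 * (x * y)) by ring.
rewrite gen -expr2 sqrr_sign mul1r -rmorphM /=.
have -> : 2 = 2%:C :> C by rewrite rmorph_nat.
rewrite -rmorphM; apply: complex_eqP => //=; field.
exact: s0.
Qed.

(** The weight 1 / (k+1) of h^(-1/2) absorbs exactly this growth: square summable coefficients on
    the Z_k correspond to h^(-1/2) coefficients on the u'_k. *)
Lemma sqr_normc_W_factor k : normc (W_factor k : C) ^+ 2 = k.+1%:R / 4.
Proof.
rewrite /W_factor ComplexField.Normc.normcM normcX normcN.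
rewrite ComplexField.Normc.normc1 expr1n mul1r.
rewrite normc_real real_normK ?num_real// exprMn sqr_sqrtr//.
by field.
Qed.

Lemma sqr_normc_adj_factor k : normc (adj_factor k : C) ^+ 2 = 4 / k.+1%:R.
Proof.
have : normc (W_factor k * adj_factor k : C) ^+ 2 = 1.
  by rewrite W_adj_factor ComplexField.Normc.normc1 expr1n.
rewrite ComplexField.Normc.normcM exprMn sqr_normc_W_factor => h.
have k0 : k.+1%:R != 0 :> R by rewrite pnatr_eq0.
have : k.+1%:R / 4 != 0 :> R by rewrite mulf_neq0.
move/mulfI; apply; rewrite h; by field.
Qed.

End Expansion.

Theorem theorem9 (R : realType) :
  [/\ (forall w : fseries (@u' R), h_neg_half w ->
         exists2 g, L2_ker_dbar g & sums_to (termwise I0adj w) g),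
      (forall g : R * R -> R[i], L2_ker_dbar g ->
         exists2 w : fseries (@u' R),
           h_neg_half w & sums_to (termwise I0adj w) g) &
      (forall f : R * R -> R[i], L2_ker_dbar f ->
         [/\ sums_to (Z_expansion f) f,
             h_neg_half (Wf f),
             sums_to (termwise I0adj (Wf f)) f /\
             sums_to (termwise fiber_average (Wf_psi f)) f,
             h_neg_half (Wf_psi f) &
             fiberwise_holomorphic (Wf_psi f) /\
             (forall (k : nat) (m : int), (1 <= k)%N -> 0 < m ->
                series_pairing (Wf_psi f) (eZ m k) 0)])].

Proof.
have fin (f : R * R -> R[i]) : L2_ker_dbar f ->
    [/\ h_neg_half (Wf f), sums_to (termwise I0adj (Wf f)) f &
        sums_to (termwise fiber_average (Wf_psi f)) f].
  move=> kf; have sf := sums_to_Z_expansion kf; split.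
  - rewrite /h_neg_half.
    have -> : (fun k => ComplexField.Normc.normc (Wf f k) ^+ 2 / k.+1%:R) =
        4^-1 *: (fun k => ComplexField.Normc.normc (Z_expansion f k) ^+ 2).
      apply/funext => k; rewrite /Wf /unscale ComplexField.Normc.normcM exprMn.
      rewrite sqr_normc_W_factor -mulrA mulrC; congr (_ * _).
      by rewrite mulrAC divff ?mul1r// pnatr_eq0.
    by apply: is_cvg_seriesZ; apply: Z_expansion_summable; case: kf.
  - apply: sums_to_unscale sf => [|k].
      exact: I0adj_u'.
    by rewrite /termwise /Wf /unscale -mulrA W_adj_factor mulr1.
  - apply: sums_to_unscale sf => [|k].
      exact: I0adj_u'.
    by rewrite /termwise /Wf_psi /termwise /Wf /unscale -mulrA W_adj_factor mulr1.
split.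
(* These are the coefficients on the Z_k of the image of [w]; they are square summable, so their
   power series lies in the kernel of dbar. *)
- move=> w hw; pose c k := w k * adj_factor k.
  have c2 : cvgn (series (fun k => ComplexField.Normc.normc (c k) ^+ 2)).
    have -> : (fun k => ComplexField.Normc.normc (c k) ^+ 2) =
        (4 : R) *: (fun k => ComplexField.Normc.normc (w k) ^+ 2 / k.+1%:R).
      apply/funext => k; rewrite /c ComplexField.Normc.normcM exprMn.
      by rewrite sqr_normc_adj_factor mulrCA.
    exact: is_cvg_seriesZ.
  exists (power_series_sum c); first exact: L2_ker_dbar_power_series_sum.
  apply: (sums_to_unscale (b := c) (a := @adj_factor R)) => //.
    exact: I0adj_u'.
  exact: sqnorm_power_series_cvg.
- by move=> g kg; have [h1 h2 _] := fin g kg; exists (Wf g).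
- move=> f kf; have [h1 h2 h3] := fin f kf.
  (* [Wf_psi f] carries the coefficients of [Wf f], hence satisfies the same summability
     condition. *)
  split=> //; first exact: sums_to_Z_expansion.
  split=> [m m0|k m _ m0].
    rewrite /sums_to.
    (* A negative m is never of the form 2 l, so every partial sum is already 0 over the open
       disc. *)
    have e n : sqnormM (fun p => \sum_(0 <= k < n) termwise (fiber_coef m) (Wf_psi f) k *
        (fiber_coef m \o (psi \o (divcos \o (@u' R)))) k p - 0) = 0%E.
      rewrite (@eq_sqnormM _ _ (fun=> 0)).
        by apply: integral0_eq => p _; rewrite ComplexField.Normc.normc0 expr0n.
      move=> p po; rewrite subr0 big1// => k _ /=.
      rewrite fiber_coef_psi// big1 ?mulr0// => l _.
      by case: eqP => // lm; rewrite -lm in m0.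
    by under eq_fun do rewrite e; exact: cvg_cst.
  rewrite /series_pairing /cseries_cvg.
  have e n : ComplexField.Normc.normc (\sum_(0 <= j < n)
      Wf_psi f j * innerSM ((psi \o (divcos \o (@u' R))) j) (eZ m k) - 0) = 0.
    rewrite subr0 big1 ?ComplexField.Normc.normc0// => j _ /=.
    by rewrite innerSM_psi_eZ// mulr0.
  by under eq_fun do rewrite e; exact: cvg_cst.
Qed.
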